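(* Consider the conjugate Gibbs sampler (defined in the context) for regularized sparse probit regression with local scale prior density $\pi_{\rm loc}$ on $(0,\infty)$, fixed slab width $\zeta>0$, arbitrary design matrix $\boldsymbol X\in\mathbb R^{n\times p}$ and binary outcomes $\boldsymbol y\in\{0,1\}^n$. Suppose that the local scale prior satisfies $\|\pi_{\rm loc}\|_\infty<\infty$ (and is absolutely continuous at $\lambda_{\min}$, in the sense of the context) and that the global scale prior $\pi_{\rm glo}(\cdot)$ is supported on $[\tau_{\min},\tau_{\max}]$ for $0<\tau_{\min}\le\tau_{\max}<\infty$. Then the sampler is geometrically ergodic.
   Context: Model: $y_i\mid\boldsymbol x_i,\boldsymbol\beta\sim\mathrm{Bernoulli}(\Phi(\boldsymbol x_i^\top\boldsymbol\beta))$, with $\Phi$ the standard Gaussian cumulative distribution function and $\boldsymbol x_i^\top$ the rows of $\boldsymbol X$; fictitious data $z_j=0$ with $z_j\mid\beta_j\sim\mathcal N(\beta_j,\zeta^2)$; $\beta_j\mid\tau,\lambda_j\sim\mathcal N(0,\tau^2\lambda_j^2)$, $\lambda_j\sim\pi_{\rm loc}$ independently for $j=1,\dots,p$, $\tau\sim\pi_{\rm glo}$. Here $\|\pi_{\rm loc}\|_\infty=\sup_\lambda\pi_{\rm loc}(\lambda)$. Standing assumption: with $\lambda_{\min}=\inf\{\lambda:\pi_{\rm loc}(\lambda)>0\}$, $\pi_{\rm loc}$ is absolutely continuous at $\lambda_{\min}$, i.e. absolutely continuous on some right-neighborhood $[\lambda_{\min},\lambda_{\min}+\epsilon)$. Conjugate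 Gibbs sampler (on states whose $\boldsymbol\beta$ has all coordinates nonzero, a set of full Lebesgue measure): a transition $(\boldsymbol\beta^*,\boldsymbol\lambda^*,\tau^* )\to(\boldsymbol\beta,\boldsymbol\lambda,\tau)$ consists of: (1) draw $\tau$ from $\pi(\tau\mid\boldsymbol\beta^*,\boldsymbol\lambda^* )\propto\pi_{\rm glo}(\tau)\prod_j\tau^{-1}\exp(-\beta_j^{*2}/(2\tau^2\lambda_j^{*2}))$; (2) draw $\lambda_j$ independently from $\pi(\lambda_j\mid\beta_j^*,\tau)\propto\lambda_j^{-1}\exp(-\beta_j^{*2}/(2\tau^2\lambda_j^2))\,\pi_{\rm loc}(\lambda_j)$; (3) draw $\boldsymbol\beta$ from the density proportional to $\prod_i\Phi(\boldsymbol x_i^\top\boldsymbol\beta)^{y_i}(1-\Phi(\boldsymbol x_i^\top\boldsymbol\beta))^{1-y_i}\,\prod_j\exp\!\big(-\tfrac12(\zeta^{-2}+\tau^{-2}\lambda_j^{-2})\beta_j^2\big)$. Geometric ergodicity: there are $\rho<1$ and a finite function $M(\cdot)$ of the starting state such that the total variation distance between the $k$-step distribution and the stationary distribution is at most $M(\text{start})\rho^k$ for all $k$. *)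

(* Defs.v *)
From HB Require Import structures.
From mathcomp Require Import all_boot all_order all_algebra.
From mathcomp Require Import all_classical all_reals all_analysis.
From mathcomp Require Import measurable_realfun.

Set Implicit Arguments.
Unset Strict Implicit.
Unset Printing Implicit Defensive.

Import Order.TTheory GRing.Theory Num.Theory.
Import numFieldNormedType.Exports.

Local Open Scope classical_set_scope.
Local Open Scope ring_scope.

(* The product of Lebesgue measure on R and m, transported to (p+1)-tuples. *)
Section cons_lebesgue.
Context {R : realType} (p : nat).
Variable m : {sigma_finite_measure set (p.-tuple (measurableTypeR R)) -> \bar R}.
Local Open Scope ereal_scope.

Let f (x : measurableTypeR R * p.-tuple (measurableTypeR R)) :
  p.+1.-tuple (measurableTypeR R) := [tuple of x.1 :: x.2].

Let mf : measurable_fun [set: measurableTypeR R * p.-tuple (measurableTypeR R)] f.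
Proof. exact: (measurable_cons measurable_fst measurable_snd). Qed.

Definition cons_lebesgue : set (p.+1.-tuple (measurableTypeR R)) -> \bar R :=
  pushforward (@lebesgue_measure R \x m)
    (fun x => [tuple of x.1 :: x.2] : p.+1.-tuple (measurableTypeR R)).

Let cons0 : cons_lebesgue set0 = 0.
Proof. by rewrite /cons_lebesgue /pushforward preimage_set0 measure0. Qed.

Let cons_ge0 A : 0 <= cons_lebesgue A.
Proof. exact: measure_ge0. Qed.

Let cons_sigma_additive : semi_sigma_additive cons_lebesgue.
Proof. exact: (@measure_semi_sigma_additive _ _ _ (pushforward _ f)). Qed.

HB.instance Definition _ := isMeasure.Build _ _ _ cons_lebesgue
  cons0 cons_ge0 cons_sigma_additive.

Let cons_sigma_finite : sigma_finite setT cons_lebesgue.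
Proof.
have /sigma_finiteP[A [TA ndA Aoo]] := sigma_finiteT (@lebesgue_measure R).
have /sigma_finiteP[B [TB ndB Boo]] := sigma_finiteT m.
pose g (v : p.+1.-tuple (measurableTypeR R)) :
  measurableTypeR R * p.-tuple (measurableTypeR R) := (thead v, [tuple of behead v]).
have mg : measurable_fun setT g.
  apply/measurable_fun_pair => /=; first exact: measurable_tnth.
  exact: measurable_behead.
have fK x : g (f x) = x.
  by case: x => a t; rewrite /g /f/=; congr pair; apply/val_inj.
exists (fun n => g @^-1` (A n `*` B n)).
  apply/esym/seteqP; split => // v _.
  have [i _ Ai] : (\bigcup_n A n) (g v).1 by rewrite -TA.
  have [j _ Bj] : (\bigcup_n B n) (g v).2 by rewrite -TB.
  exists (maxn i j) => //; split.
  - by move: Ai; exact/subsetPset/ndA/leq_maxl.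
  - by move: Bj; exact/subsetPset/ndB/leq_maxr.
move=> n; have [mA An] := Aoo n; have [mB Bn] := Boo n; split.
  by rewrite -[X in measurable X]setTI; apply: mg => //; exact: measurableX.
have -> : cons_lebesgue (g @^-1` (A n `*` B n)) =
    (@lebesgue_measure R \x m) (A n `*` B n).
  by congr (_ \x _); apply/funext => x; congr ((A n `*` B n) _); exact: fK.
by rewrite product_measure1E// lte_mul_pinfty// ge0_fin_numE.
Qed.

HB.instance Definition _ := Measure_isSigmaFinite.Build _ _ _ cons_lebesgue
  cons_sigma_finite.

End cons_lebesgue.

Fixpoint tuple_lebesgue (R : realType) (p : nat) :
    {sigma_finite_measure set (p.-tuple (measurableTypeR R)) -> \bar R} :=
  match p with
  | 0 => dirac [tuple]
  | q.+1 => cons_lebesgue (tuple_lebesgue R q)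
  end.

Section density_kernel.
Context d d' (X : measurableType d) (Y : measurableType d') (R : realType).
Variables (mu : {sigma_finite_measure set Y -> \bar R}) (w : X * Y -> R).
Local Open Scope ereal_scope.

Definition density_kernel (mw : measurable_fun [set: X * Y] w)
    (w0 : forall z, (0 <= w z)%R) (x : X) (A : set Y) : \bar R :=
  \int[mu]_(y in A) (w (x, y))%:E.

Hypothesis mw : measurable_fun [set: X * Y] w.
Hypothesis w0 : forall z, (0 <= w z)%R.

Local Notation dk := (density_kernel mw w0).

Let mw1 x : measurable_fun [set: Y] (fun y => (w (x, y))%:E).
Proof. apply/measurable_EFinP; exact: (measurableT_comp mw (pair1_measurable x)). Qed.

Let dk0 x : dk x set0 = 0.
Proof. exact: integral_set0. Qed.

Let dk_ge0 x A : 0 <= dk x A.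
Proof. by apply: integral_ge0 => y _; rewrite lee_fin. Qed.

Let dk_sigma_additive x : semi_sigma_additive (dk x).
Proof.
move=> F mF tF mUF; rewrite /density_kernel ge0_integral_bigcup//=; last 2 first.
- exact: measurable_funTS.
- by move=> y _; rewrite lee_fin.
by apply: is_cvg_ereal_nneg_natsum_cond => n _ _; apply: integral_ge0 => y _;
  rewrite lee_fin.
Qed.

HB.instance Definition _ x := isMeasure.Build _ _ _ (dk x)
  (dk0 x) (dk_ge0 x) (@dk_sigma_additive x).

Definition mdensity_kernel : X -> {measure set Y -> \bar R} := dk.

Let measurable_dk U : measurable U -> measurable_fun [set: X] (mdensity_kernel ^~ U).
Proof.
move=> mU; rewrite /mdensity_kernel/= /density_kernel.
rewrite (_ : (fun _ => _) =
    fubini_F mu (fun z => (w z * \1_U z.2)%:E)); last first.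
  apply/funext => x; rewrite /fubini_F [LHS]integral_mkcond; apply: eq_integral => y _.
  by rewrite patchE indicE/=; case: ifPn => _; rewrite ?mulr1 ?mulr0.
apply: measurable_fun_fubini_tonelli_F.
  apply/measurable_EFinP; apply: measurable_funM => //.
  by apply: (measurableT_comp (measurable_indic mU)) => //; exact: measurable_snd.
by move=> z; rewrite lee_fin mulr_ge0.
Qed.

HB.instance Definition _ := isKernel.Build _ _ _ _ _ mdensity_kernel measurable_dk.

End density_kernel.

(* Absolute continuity of the function f on D, over finite families of
   non-overlapping intervals included in D. *)
Definition abs_continuous_on (R : realType) (D : set R) (f : R -> R) :=
  forall e : R, 0 < e -> exists2 d : R, 0 < d &
    forall (m : nat) (a b : 'I_m -> R),
      (forall i, a i <= b i /\ `[a i, b i] `<=` D) ->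
      (forall i j, i != j -> b i <= a j \/ b j <= a i) ->
      \sum_(i < m) (b i - a i) < d ->
      \sum_(i < m) `|f (b i) - f (a i)| < e.

(* A probability density on (0, +oo); its values outside (0, +oo), in
   particular at 0, are irrelevant. *)
Record scale_density (R : realType) := ScaleDensity {
  scale_fun :> R -> R;
  measurable_scale_fun : measurable_fun (`]0, +oo[ : set R) scale_fun;
  scale_fun_ge0 : forall x, 0 < x -> 0 <= scale_fun x;
  scale_fun_int1 :
    (\int[@lebesgue_measure R]_(x in `]0%R, +oo[) (scale_fun x)%:E = 1)%E
}.

Definition scale_sup (R : realType) (f : scale_density R) : \bar R :=
  ereal_sup [set (f x)%:E | x in `]0, +oo[].

Definition scale_min (R : realType) (f : scale_density R) : R :=
  inf [set x | 0 < x /\ 0 < f x].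

(* [scale_min f, scale_min f + e) is intersected with the domain (0, +oo) of f,
   which only matters when scale_min f = 0. *)
Definition abs_continuous_at_scale_min (R : realType) (f : scale_density R) :=
  exists2 e : R, 0 < e &
    abs_continuous_on (`]0, +oo[ `&` `[scale_min f, scale_min f + e[) f.

Definition Phi (R : realType) (x : R) : R := fine (normal_prob 0 1 `]-oo, x]).

Section weights.
Context {R : realType} (n p : nat).
Implicit Types (b l : p.-tuple R) (t : R).

(* Unnormalized conditional density of tau with respect to its prior measure. *)
Definition tau_weight b l t : R :=
  if 0 < t then
    \prod_(j < p) (t^-1 * expR (- (tnth b j ^+ 2 / (2 * t ^+ 2 * tnth l j ^+ 2))))
  else 0.

Definition lambda_weight (piloc : scale_density R) (b t l : R) : R :=
  if 0 < l then l^-1 * expR (- (b ^+ 2 / (2 * t ^+ 2 * l ^+ 2))) * piloc l else 0.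

Definition lin_pred (X : 'M[R]_(n, p)) (i : 'I_n) b : R :=
  \sum_(j < p) X i j * tnth b j.

(* The term zeta ^- 2 comes from the fictitious observations z_j = 0. *)
Definition beta_weight (X : 'M[R]_(n, p)) (y : 'I_n -> bool) (zeta : R) t l b : R :=
  (\prod_(i < n) (Phi (lin_pred X i b) ^+ y i *
                  (1 - Phi (lin_pred X i b)) ^+ (1 - y i)%N)) *
  \prod_(j < p)
    expR (- (2^-1 * (zeta ^- 2 + t ^- 2 * tnth l j ^- 2) * tnth b j ^+ 2)).

End weights.

Section weight_facts.
Context {R : realType}.

Lemma measurable_invr : measurable_fun [set: R] (@GRing.inv R).
Proof.
have -> : [set: R] = [set 0] `|` [set x | x != 0].
  by apply/seteqP; split => // x _ /=; have [->|] := eqVneq x 0; [left|right].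
have o0 : open [set x : R | x != 0] by exact: open_neq.
apply/measurable_funU => //; first exact: open_measurable.
split; first exact: measurable_fun_set1.
apply: open_continuous_measurable_fun => //; apply/in_setP => x /= x0.
exact: inv_continuous.
Qed.

Lemma measurable_real_id : measurable_fun [set: measurableTypeR R] (id : _ -> R).
Proof. by []. Qed.

Lemma Phi_ge0 (x : R) : 0 <= Phi x.
Proof. by rewrite /Phi fine_ge0. Qed.

Lemma Phi_le1 (x : R) : Phi x <= 1.
Proof.
rewrite -lee_fin fineK ?fin_num_measure//; exact: probability_le1.
Qed.

Lemma measurable_Phi : measurable_fun [set: R] (@Phi R).
Proof.
apply: nondecreasing_measurable => // r s rs.
by rewrite fine_le ?fin_num_measure// le_measure ?inE//; exact: subitvPr.
Qed.

End weight_facts.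

(* (beta, lambda, tau) *)
Notation gibbs_state R p :=
  (p.-tuple (measurableTypeR R) * p.-tuple (measurableTypeR R) *
   measurableTypeR R)%type.

Section gibbs_kernels.
Context {R : realType} (n p : nat).
Local Notation Rm := (measurableTypeR R).
Local Notation Rp := (p.-tuple (measurableTypeR R)).
Local Notation state := (gibbs_state R p).

Let mcoord d (T : measurableType d) (f : T -> Rp) (j : 'I_p) :
  measurable_fun [set: T] f -> measurable_fun [set: T] (fun x => tnth (f x) j : R).
Proof.
move=> mf; apply: (measurableT_comp measurable_real_id).
exact: (measurableT_comp (measurable_tnth j) mf).
Qed.

Let mreal d (T : measurableType d) (f : T -> Rm) :
  measurable_fun [set: T] f -> measurable_fun [set: T] (f : T -> R).
Proof. exact: (measurableT_comp measurable_real_id). Qed.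

Let minv d (T : measurableType d) (f : T -> R) :
  measurable_fun [set: T] f -> measurable_fun [set: T] (fun x => (f x)^-1).
Proof. exact: (measurableT_comp measurable_invr). Qed.

Let mexp d (T : measurableType d) (f : T -> R) :
  measurable_fun [set: T] f -> measurable_fun [set: T] (fun x => expR (f x)).
Proof. exact: (measurableT_comp (@measurable_expR R)). Qed.

Let mopp d (T : measurableType d) (f : T -> R) :
  measurable_fun [set: T] f -> measurable_fun [set: T] (fun x => - f x).
Proof. by move=> mf; exact: measurable_funN. Qed.

Let mgauss d (T : measurableType d) (f t l : T -> R) :
  measurable_fun [set: T] f -> measurable_fun [set: T] t ->
  measurable_fun [set: T] l -> measurable_fun [set: T]
    (fun x => expR (- (f x ^+ 2 / (2 * t x ^+ 2 * l x ^+ 2)))).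
Proof.
move=> mf mt ml; apply/mexp/mopp/measurable_funM; first exact: measurable_funX.
apply: minv; apply: measurable_funM; last exact: measurable_funX.
by apply: measurable_funM => //; exact: measurable_funX.
Qed.

Lemma tau_weight_ge0 (b l : p.-tuple R) (t : R) : 0 <= tau_weight b l t.
Proof.
rewrite /tau_weight; case: ifPn => // t0; apply: prodr_ge0 => j _.
by rewrite mulr_ge0 ?expR_ge0// invr_ge0 ltW.
Qed.

Lemma measurable_tau_weight : measurable_fun [set: state * Rm]
  (fun z => tau_weight z.1.1.1 z.1.1.2 z.2).
Proof.
have mt : measurable_fun [set: state * Rm] (fun z => z.2 : R).
  by apply: mreal; exact: measurable_snd.
rewrite /tau_weight; apply: measurable_fun_ifT => //.
  by apply: measurable_fun_ltr => //.
apply: measurable_prod => j _; apply: measurable_funM; first exact: minv.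
apply: mgauss => //; apply: mcoord; rewrite -/(comp _ _).
  by do 2 apply: measurableT_comp => //.
by do 2 apply: measurableT_comp => //.
Qed.

Lemma lambda_weight_ge0 (piloc : scale_density R) (b t l : R) :
  0 <= lambda_weight piloc b t l.
Proof.
rewrite /lambda_weight; case: ifPn => // l0.
by rewrite !mulr_ge0 ?expR_ge0 ?scale_fun_ge0// invr_ge0 ltW.
Qed.

Lemma prod_lambda_weight_ge0 (piloc : scale_density R) (b : p.-tuple R) (t : R)
  (l : p.-tuple R) :
  0 <= \prod_(j < p) lambda_weight piloc (tnth b j) t (tnth l j).
Proof. by apply: prodr_ge0 => j _; exact: lambda_weight_ge0. Qed.

Lemma measurable_lambda_weight (piloc : scale_density R) :
  measurable_fun [set: state * Rm * Rp]
    (fun z => \prod_(j < p)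
       lambda_weight piloc (tnth z.1.1.1.1 j) z.1.2 (tnth z.2 j)).
Proof.
have mt : measurable_fun [set: state * Rm * Rp] (fun z => z.1.2 : R).
  by apply: mreal; apply: measurableT_comp => //; exact: measurable_fst.
have mb : measurable_fun [set: state * Rm * Rp] (fun z => z.1.1.1.1).
  by do 3 apply: measurableT_comp => //.
apply: measurable_prod => j _; rewrite /lambda_weight.
have ml : measurable_fun [set: state * Rm * Rp] (fun z => tnth z.2 j : R).
  by apply: mcoord; exact: measurable_snd.
under eq_fun do rewrite -[X in if _ then X else _](mulrC (piloc _)).
have mpi : measurable_fun [set: R] (fun x : R => if 0 < x then piloc x else 0).
  rewrite (_ : (fun _ => _) = piloc \_ `]0, +oo[).
    by apply/(measurable_restrictT _ _).1 => //; exact: measurable_scale_fun.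
  apply/funext => x; rewrite patchE; case: ifPn => x0.
    by rewrite mem_set//= in_itv/= x0.
  by rewrite memNset//= in_itv/= (negbTE x0).
rewrite (_ : (fun _ => _) = fun z : state * Rm * Rp =>
    (fun x : R => if 0 < x then piloc x else 0) (tnth z.2 j) *
    ((tnth z.2 j)^-1 *
    expR (- (tnth z.1.1.1.1 j ^+ 2 / (2 * z.1.2 ^+ 2 * tnth z.2 j ^+ 2))))); last first.
  by apply/funext => z; case: ifPn => //; rewrite mul0r.
apply: measurable_funM; first exact: (measurableT_comp mpi ml).
apply: measurable_funM; first exact: minv.
by apply: mgauss => //; exact: mcoord.
Qed.

Lemma beta_weight_ge0 (X : 'M[R]_(n, p)) (y : 'I_n -> bool) (zeta t : R)
  (l b : p.-tuple R) : 0 <= beta_weight X y zeta t l b.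
Proof.
rewrite /beta_weight mulr_ge0//; apply: prodr_ge0 => i _; last exact: expR_ge0.
by rewrite mulr_ge0// exprn_ge0// ?Phi_ge0// subr_ge0 Phi_le1.
Qed.

Lemma measurable_beta_weight (X : 'M[R]_(n, p)) (y : 'I_n -> bool) (zeta : R) :
  measurable_fun [set: state * Rm * Rp * Rp]
    (fun z => beta_weight X y zeta z.1.1.2 z.1.2 z.2).
Proof.
have mt : measurable_fun [set: state * Rm * Rp * Rp] (fun z => z.1.1.2 : R).
  by apply: mreal; do 2 apply: measurableT_comp => //.
have ml : measurable_fun [set: state * Rm * Rp * Rp] (fun z => z.1.2).
  by apply: measurableT_comp => //.
have mb j : measurable_fun [set: state * Rm * Rp * Rp] (fun z => tnth z.2 j : R).
  by apply: mcoord; exact: measurable_snd.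
have mP i : measurable_fun [set: state * Rm * Rp * Rp]
    (fun z => Phi (lin_pred X i z.2)).
  apply: (measurableT_comp measurable_Phi); rewrite /lin_pred.
  by apply: measurable_sum => j; apply: measurable_funM.
apply: measurable_funM; apply: measurable_prod => i _.
  apply: measurable_funM; first exact: measurable_funX.
  by apply: measurable_funX; exact: measurable_funB.
apply/mexp/mopp; apply: measurable_funM; last exact: measurable_funX.
apply: measurable_funM => //; apply: measurable_funD => //.
apply: measurable_funM; first by apply: minv; exact: measurable_funX.
by apply: minv; apply: measurable_funX; exact: mcoord.
Qed.

End gibbs_kernels.

(* [knormalize] falls back on its last argument when the total weight is 0 or
   +oo.  If piglo is concentrated on a compact subset of (0, +oo), this cannot
   happen along the chain started in [gibbs_start]: the lambda weight is
   integrable as soon as beta_j != 0. *)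
Section gibbs_sampler.
Context {R : realType} (n p : nat).
Variables (X : 'M[R]_(n, p)) (y : 'I_n -> bool) (zeta : R).
Variables (piloc : scale_density R) (piglo : probability (measurableTypeR R) R).
Local Notation Rm := (measurableTypeR R).
Local Notation Rp := (p.-tuple (measurableTypeR R)).
Local Notation state := (gibbs_state R p).

Definition tau_kernel : R.-pker state ~> Rm :=
  knormalize
    (mdensity_kernel piglo (@measurable_tau_weight R p)
       (fun z => tau_weight_ge0 z.1.1.1 z.1.1.2 z.2))
    (dirac (0 : Rm)).

(* The joint density is a product, so the lambda_j are drawn independently. *)
Definition lambda_kernel : R.-pker (state * Rm) ~> Rp :=
  knormalize
    (mdensity_kernel (tuple_lebesgue R p) (@measurable_lambda_weight R p piloc)
       (fun z => prod_lambda_weight_ge0 piloc z.1.1.1.1 z.1.2 z.2))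
    (dirac (nseq_tuple p (0 : Rm))).

Definition beta_kernel : R.-pker (state * Rm * Rp) ~> Rp :=
  knormalize
    (mdensity_kernel (tuple_lebesgue R p) (@measurable_beta_weight R n p X y zeta)
       (fun z => beta_weight_ge0 X y zeta z.1.1.2 z.1.2 z.2))
    (dirac (nseq_tuple p (0 : Rm))).

Definition new_state (z : state * Rm * Rp * Rp) : state := (z.2, z.1.2, z.1.1.2).

Lemma measurable_new_state : measurable_fun setT new_state.
Proof.
apply/measurable_fun_pair => /=; first apply/measurable_fun_pair => //=.
- exact: measurableT_comp.
- by do 2 apply: measurableT_comp => //.
Qed.

Definition gibbs_comp : state -> {measure set state -> \bar R} :=
  (tau_kernel \; (lambda_kernel \; (beta_kernel \; kdirac measurable_new_state)))%E.

HB.instance Definition _ := Kernel.on gibbs_comp.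

Lemma gibbs_comp1 s : gibbs_comp s setT = 1%E.
Proof.
rewrite /gibbs_comp/= /kcomp.
have int1 d1 d2 (A : measurableType d1) (B : measurableType d2)
    (k : R.-pker A ~> B) (h : B -> \bar R) a :
    (forall b, h b = 1%E) -> (\int[k a]_b h b = 1)%E.
  by move=> h1; rewrite (eq_integral (cst 1%E))// integral_cst// mul1e prob_kernel.
apply: (int1) => t; apply: (int1) => l; apply: (int1) => b.
by rewrite /kdirac/= diracT.
Qed.

HB.instance Definition _ := Kernel_isProbability.Build _ _ _ _ _ gibbs_comp gibbs_comp1.

Definition gibbs_kernel : R.-pker state ~> state := gibbs_comp.

End gibbs_sampler.

(* The states from which the sampler is defined. *)
Definition gibbs_start (R : realType) (p : nat) : set (gibbs_state R p) :=
  [set s | [/\ forall j, tnth s.1.1 j != 0 :> R, forall j, 0 < tnth s.1.2 j :> R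
             & 0 < s.2 :> R]].

Section markov_chain.
Context d (T : measurableType d) (R : realType).
Local Open Scope ereal_scope.

Fixpoint kernel_iter (K : R.-pker T ~> T) (k : nat) : R.-spker T ~> T :=
  match k with
  | 0 => kdirac (@measurable_id _ T setT)
  | k'.+1 => mkcomp_noparam K (kernel_iter K k')
  end.

Definition stationary (K : R.-pker T ~> T) (P : probability T R) :=
  forall A, measurable A -> \int[P]_x K x A = P A.

Definition tv_dist (P Q : set T -> \bar R) : \bar R :=
  ereal_sup [set `|P A - Q A| | A in measurable].

(* Geometric ergodicity of the chain started in S. *)
Definition geometrically_ergodic_on (S : set T) (K : R.-pker T ~> T) :=
  exists P : probability T R, stationary K P /\
  exists (rho : R) (M : T -> R), (0 <= rho < 1)%R /\
    forall x k, S x -> tv_dist (kernel_iter K k x) P <= (M x * rho ^+ k)%:E.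

End markov_chain.

(* Main.v *)
(** The chain is shown to satisfy the hypotheses of Harris' theorem, with Lyapunov
    function [V = \sum_j |b_j| ^ (-1/2)] and a two-step minorization.

    Drift: given the scales, [b_j] is Gaussian of precision [zeta^-2 + (tau l_j)^-2] up
    to the likelihood, which is bounded below near the origin, so that
    [E |b_j|^(-1/2) <= C0 + C1 l_j^(-1/2)].  Given [b] and [tau], one has
    [E l_j^(-1/2) <= eta |b_j|^(-1/2) + C] for every [eta > 0]: as [c = |b_j| / tau]
    tends to [0], either the normalizing constant [\int l^-1 exp (- (c/l)^2 / 2) pi(l) dl]
    blows up, and boundedness of [pi] suffices, or [l^-1 pi(l)] is integrable and gives
    little mass to the neighbourhoods of [0].

    Minorization: when [V] is bounded, with probability at least [1/2] the new scales are
    bounded away from [0], and then the new [b] has a density bounded below on a box.  The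
    law of the next [tau] given such [b] and scales dominates a multiple of its prior, and
    the rest of the second step depends only on [b] and [tau].  Two steps are needed
    because the draw of [tau] from an arbitrary state may concentrate near the end of its
    support. *)
Require Import Defs.
From HB Require Import structures.
From mathcomp Require Import all_boot all_order all_algebra.
From mathcomp Require Import all_classical all_reals all_analysis.
From mathcomp Require Import measurable_realfun.
From mathcomp Require Import ring lra.

Set Implicit Arguments.
Unset Strict Implicit.
Unset Printing Implicit Defensive.

Import Order.TTheory GRing.Theory Num.Theory.
Import numFieldNormedType.Exports.

Local Open Scope classical_set_scope.
Local Open Scope ring_scope.

(** * Setwise limits of probability measures *)

(** With exponent -1/2 the Lyapunov function is integrable at 0 and scales like [s ^ (-1/2)] under a
    Gaussian of standard deviation [s]; here [s] is of order [tau l_j] for small [l_j], which is how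
    a singularity of [b_j] is traded for one of [l_j] and back. The two halves of the drift compose
    to the factor [C1 eta], and [C1] is not small: hence the need for every [eta > 0]. [V] reads
    beta only, because the draws of lambda and beta given tau see the previous state through its
    beta part; tau is controlled by its compact support alone. [V] stays bounded at infinity, since
    the slab keeps the standard deviation of [b_j] below [zeta].

    [V] is [+oo] where some [b_j = 0], since the lambda weight may not be normalizable there.
    Harris' theorem is therefore proved for an extended-valued [V] and speaks of points of finite
    [V]. It presupposes no stationary law: the laws of the chain from a fixed point are Cauchy
    uniformly over measurable sets, and their setwise limit is shown to be stationary. *)

Section setwise.
Context d (T : measurableType d) (R : realType).
Local Open Scope ereal_scope.

(** Layer cake: by Tonelli on the region below the graph, [\int f] is the Lebesgue integral over
    [t >= 0] of the measure of [[set x | t < f x]]. The hypothesis applies to each level set, and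
    the slack [e] is paid only for [t] in [[0, 1[], as higher level sets are empty. This carries
    stationarity to a setwise limit. *)
Lemma integral_le_setwise (mu nu : probability T R) (e : R) (f : T -> R) :
  measurable_fun setT f -> (forall x, (0 <= f x <= 1)%R) -> (0 <= e)%R ->
  (forall A, measurable A -> mu A <= nu A + e%:E) ->
  \int[mu]_x (f x)%:E <= \int[nu]_x (f x)%:E + e%:E.
Proof.
move=> mf f01 e0 munu.
pose F (z : T * measurableTypeR R) : \bar R :=
  (\1_[set z : T * measurableTypeR R | (0 <= z.2 < f z.1)%R] z)%:E.
have mS : measurable [set z : T * measurableTypeR R | (0 <= z.2 < f z.1)%R].
  have m2 : measurable_fun setT (fun z : T * measurableTypeR R => z.2 : R).
    by apply: (measurableT_comp (@measurable_real_id R)); exact: measurable_snd.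
  have m1 : measurable_fun setT (fun z : T * measurableTypeR R => f z.1).
    by apply: (measurableT_comp mf); exact: measurable_fst.
  rewrite (_ : [set _ | _] = (fun z : T * measurableTypeR R =>
    (0 <= (z.2 : R))%R && ((z.2 : R) < f z.1)%R) @^-1` [set true]); last first.
    by apply/seteqP; split => z /=.
  rewrite -[X in measurable X]setTI; apply: (measurable_and) => //.
  - exact: measurable_fun_ler.
  - exact: measurable_fun_ltr.
have mF : measurable_fun setT F.
  by apply/measurable_EFinP; exact: measurable_indic.
have F0 z : 0 <= F z by rewrite lee_fin.
have FE (m : probability T R) : \int[m]_x (f x)%:E =
    \int[lebesgue_measure]_t m [set x | (0 <= t < f x)%R].
  transitivity (\int[m]_x \int[@lebesgue_measure R]_t F (x, t)).
    apply: eq_integral => x _.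
    rewrite (_ : (fun t => F (x, t)) = (fun t => (\1_(`[0%R, f x[%classic : set (measurableTypeR R)) t)%:E)); last first.
      by apply/funext => t; rewrite /F !indicE.
    rewrite integral_indic// setIT [RHS](lebesgue_measure_itv `[0%R, f x[)/= lte_fin.
    have /andP[fx0 _] := f01 x.
    case: ltP => h; first by rewrite oppr0 adde0.
    by apply/esym/eqP; rewrite eqe eq_le h fx0.
  rewrite fubini_tonelli//; apply: eq_integral => t _.
  rewrite (_ : (fun x => F (x, t)) = (fun x => (\1_[set x | (0 <= t < f x)%R] x)%:E)); last first.
    by apply/funext => x; rewrite /F !indicE.
  rewrite integral_indic ?setIT//.
  have := measurable_ysection t mS; congr measurable.
  by apply/seteqP; split => x; rewrite /ysection/= inE.
have mg (m : probability T R) :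
    measurable_fun setT (fun t : measurableTypeR R => m [set x | (0 <= t < f x)%R]).
  have := measurable_fun_ysection m mS; congr measurable_fun.
  apply/funext => t; rewrite /=; congr (m _).
  by apply/seteqP; split => x; rewrite /ysection/= inE.
rewrite !FE.
have -> : e%:E = \int[lebesgue_measure]_(t in [set: measurableTypeR R])
   (e%:E * (\1_(`[0%R, 1%R[%classic : set (measurableTypeR R)) t)%:E).
  rewrite ge0_integralZl//; last by apply/measurable_EFinP; exact: measurable_indic.
  rewrite integral_indic// setIT.
  by rewrite [X in _ * X](lebesgue_measure_itv `[0%R, 1%R[)/= lte_fin ltr01 oppr0 adde0 mule1.
rewrite -ge0_integralD//; last 2 first.
- by move=> t _; rewrite mule_ge0// lee_fin.
- by apply: measurable_funeM; apply/measurable_EFinP; exact: measurable_indic.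
apply: ge0_le_integral => //.
- apply: emeasurable_funD => //.
  by apply: measurable_funeM; apply/measurable_EFinP; exact: measurable_indic.
move=> t _; rewrite indicE; have [t01|t01] := boolP (t \in _).
  rewrite mule1; apply: munu.
  have := measurable_ysection t mS; congr measurable.
  by apply/seteqP; split => x; rewrite /ysection/= inE.
rewrite mule0 adde0 (_ : [set x | _] = set0) ?measure0//.
apply/seteqP; split => // x /= /andP[t0 tf].
move: t01; rewrite notin_setE/=; apply; rewrite in_itv/= t0/=.
by have /andP[_ ] := f01 x; exact: lt_le_trans.
Qed.

End setwise.

(** With [C = c / (1 - s)], the quantity [C * s ^+ n] drops by exactly [c * s ^+ n] at each step. So
    [u n - C * s ^+ n] is nondecreasing, [u n + C * s ^+ n] is nonincreasing, and the two squeeze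
    the limit at the announced rate. *)
Lemma cvg_geometric_increments (R : realType) (u : R^nat) (c s : R) :
  0 <= s < 1 -> (forall n, `|u n.+1 - u n| <= c * s ^+ n) ->
  cvgn u /\ forall n, `|u n - limn u| <= c / (1 - s) * s ^+ n.
Proof.
move=> /andP[s0 s1] uc.
have s1' : 0 < 1 - s by rewrite subr_gt0.
have c0 : 0 <= c by have := uc 0%N; rewrite expr0 mulr1; exact: le_trans.
set C := c / (1 - s).
have CE : c = C - C * s by rewrite /C; field; rewrite gt_eqF.
have C0 : 0 <= C by rewrite divr_ge0// ltW.
have sn n : 0 <= s ^+ n by exact: exprn_ge0.
have h0 : (fun n => C * s ^+ n) @ \oo --> 0.
  rewrite -(mulr0 C); apply: cvgMr; apply: cvg_expr; by rewrite ger0_norm.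
pose v n := u n - C * s ^+ n. pose w n := u n + C * s ^+ n.
have vnd : nondecreasing_seq v.
  apply/nondecreasing_seqP => n; have := uc n; rewrite ler_norml => /andP[h1 _].
  rewrite /v exprS; move: h1; rewrite {1}CE; lra.
have wni : nonincreasing_seq w.
  apply/nonincreasing_seqP => n; have := uc n; rewrite ler_norml => /andP[_ h1].
  rewrite /w exprS; move: h1; rewrite {1}CE; lra.
have vw n : v n <= w n by rewrite /v /w; have := mulr_ge0 C0 (sn n); lra.
have cv : cvgn v.
  apply: nondecreasing_is_cvgn => //; exists (w 0%N) => _ [n _ <-].
  by rewrite (le_trans (vw n))// wni.
have uE : u = (fun n => v n + C * s ^+ n) by apply/funext => n; rewrite /v; lra.
have ul : u @ \oo --> limn v.
  by rewrite uE -[limn v]addr0; apply: cvgD.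
have cu : cvgn u by apply/cvg_ex; exists (limn v).
have limu : limn u = limn v by apply/cvg_lim.
split=> // n.
have lw : w @ \oo --> limn u.
  by rewrite -[limn u]addr0; apply: cvgD.
have l1 : v n <= limn u by rewrite limu; exact: nondecreasing_cvgn_le.
have l2 : limn u <= w n.
  rewrite -(cvg_lim _ lw)//; apply: nonincreasing_cvgn_ge => //.
  by apply/cvg_ex; exists (limn u).
rewrite ler_norml; move: l1 l2; rewrite /v /w; lra.
Qed.

Section setwise_limit.
Context d (T : measurableType d) (R : realType).
Variables (P : nat -> probability T R) (c s : R).
Hypothesis s01 : 0 <= s < 1.
Hypothesis Pc : forall n A, measurable A ->
  `|fine (P n.+1 A) - fine (P n A)| <= c * s ^+ n.
Local Open Scope ereal_scope.

(* The absolute value only matters on non-measurable sets, where the limit may not exist. *)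
Let q (A : set T) : \bar R := `|limn (fun n => fine (P n A))|%:E.

Let cvq A : measurable A -> (fun n => fine (P n A)) @ \oo --> fine (q A).
Proof.
move=> mA; have [cA _] := cvg_geometric_increments s01 (fun n => Pc n mA).
rewrite /q/= ger0_norm//; apply: limr_ge => //.
by near=> n; rewrite fine_ge0.
Unshelve. all: by end_near. Qed.

Let q_err n A : measurable A ->
  (`|fine (P n A) - fine (q A)| <= c / (1 - s) * s ^+ n)%R.
Proof.
move=> mA; have [_ /(_ n)] := cvg_geometric_increments s01 (fun n => Pc n mA).
by rewrite (cvg_lim _ (cvq mA)).
Qed.

Let q0 : q set0 = 0.
Proof.
rewrite /q (_ : (fun n => _) = cst 0%R) ?lim_cst ?normr0//.
by apply/funext => n; rewrite measure0.
Qed.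

Let q_ge0 A : 0 <= q A.
Proof. by rewrite /q lee_fin. Qed.

Let qE A : q A = (fine (q A))%:E.
Proof. by []. Qed.

Let q_bigsetU (F : nat -> set T) n : (forall i, measurable (F i)) -> trivIset setT F ->
  fine (q (\big[setU/set0]_(i < n) F i)) = (\sum_(i < n) fine (q (F i)))%R.
Proof.
move=> mF tF.
have mU : measurable (\big[setU/set0]_(i < n) F i) by exact: bigsetU_measurable.
have h : (fun k => fine (P k (\big[setU/set0]_(i < n) F i))) @ \oo -->
   (\sum_(i < n) fine (q (F i)))%R.
  rewrite (_ : (fun k => _) = (fun k => \sum_(i < n) fine (P k (F i)))%R); last first.
    apply/funext => k; rewrite measure_bigsetU//.
    rewrite (eq_bigr (fun i : 'I_n => (fine (P k (F i)))%:E)) ?sumEFin// => i _.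
    by rewrite fineK// fin_num_measure.
  by apply: cvg_big => [|i _]; [exact: add_continuous|exact: cvq].
by rewrite -(cvg_lim _ h)// -(cvg_lim _ (cvq mU)).
Qed.

(** The error bound [q_err] is the same for all measurable sets. This allows an [e / 3] argument:
    fix one [k] for which [P k] is close to [q] on the union and on all its finite parts, then use
    the countable additivity of [P k]. *)
Let q_sigma_additive : semi_sigma_additive q.
Proof.
move=> F mF tF mUF.
rewrite (_ : (fun n => _) = (fun n => (\sum_(i < n) fine (q (F i)))%R%:E)); last first.
  by apply/funext => n; rewrite big_mkord -sumEFin.
rewrite qE; apply/fine_cvgP; split; first by near=> n.
set U := \bigcup_n F n; have := fun k => q_err k mUF; rewrite -/U.
move: (fine (q U)) => QU QUP; apply/cvgrPdist_le => e e0.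
have [k hk] : exists k, (c / (1 - s) * s ^+ k <= e / 3)%R.
  have : (fun n => c / (1 - s) * s ^+ n)%R @ \oo --> (0 : R)%R.
    rewrite -(mulr0 (c / (1 - s))%R); apply: cvgMr; apply: cvg_expr.
    by have /andP[? ?] := s01; rewrite ger0_norm.
  move=> /cvgrPdist_le /(_ (e / 3)%R ltac:(by rewrite divr_gt0)) [N _ /(_ N (leqnn N))].
  by rewrite sub0r normrN => /(le_trans (ler_norm _)) h; exists N.
have := @measure_semi_sigma_additive _ _ _ (P k) F mF tF mUF.
rewrite [X in _ --> X -> _](_ : _ = (fine (P k (\bigcup_n F n)))%:E); last first.
  by rewrite fineK// fin_num_measure.
move=> /fine_cvgP[_ /cvgrPdist_le /(_ (e / 3)%R ltac:(by rewrite divr_gt0))].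
apply: filterS => n /=; rewrite big_mkord -measure_bigsetU//= => h.
rewrite -q_bigsetU//.
have := QUP k; have := q_err k (bigsetU_measurable (index_enum 'I_n) (P := xpredT) (F := fun i : 'I_n => F i) (fun i _ => mF i)).
move: h; rewrite !ler_norml => /andP[? ?] /andP[? ?] /andP[? ?]; apply/andP; split; lra.
Unshelve. all: by end_near. Qed.

HB.instance Definition _ := isMeasure.Build _ _ _ q q0 q_ge0 q_sigma_additive.

Let q_setT : q setT = 1.
Proof.
rewrite qE -(cvg_lim _ (cvq measurableT))//.
rewrite (_ : (fun n => _) = cst 1%R) ?lim_cst//.
by apply/funext => n; rewrite probability_setT.
Qed.

HB.instance Definition _ := @Measure_isProbability.Build _ _ R q q_setT.

Lemma exists_setwise_limit : exists Q : probability T R, forall n A, measurable A ->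
  (`|fine (P n A) - fine (Q A)| <= c / (1 - s) * s ^+ n)%R.
Proof. by exists q => n A mA; exact: q_err. Qed.

End setwise_limit.

(** * Harris' theorem *)

Section kernel_iteration.
Context d (T : measurableType d) (R : realType).
Implicit Type K : R.-pker T ~> T.
Local Open Scope ereal_scope.

Lemma integral_mkcomp_noparam (K L : R.-spker T ~> T) x (f : T -> \bar R) :
  (forall z, 0 <= f z) -> measurable_fun setT f ->
  \int[mkcomp_noparam K L x]_z f z = \int[K x]_y \int[L y]_z f z.
Proof.
move=> f0 mf.
rewrite -[RHS](@integral_kcomp _ _ _ _ _ _ _ K (kernel.kernel_snd L) x)//.
Qed.

Lemma kernel_iterS K k x A :
  kernel_iter K k.+1 x A = \int[K x]_y kernel_iter K k y A.
Proof. by []. Qed.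

Lemma kernel_iter_setT K k x : kernel_iter K k x setT = 1.
Proof.
elim: k x => [x|k IH x]; first by rewrite /= /kdirac diracT.
rewrite kernel_iterS (eq_integral (cst 1)) ?integral_cst// ?mul1e ?prob_kernel//.
Qed.

(** The iterates are defined with the extra step taken at the start; stationarity of the limit law
    requires it at the end. *)
Lemma kernel_iterSr K k x A : measurable A ->
  kernel_iter K k.+1 x A = \int[kernel_iter K k x]_y K y A.
Proof.
move=> mA; elim: k x => [x|k IH x].
  rewrite kernel_iterS /= /kdirac integral_dirac// ?diracT ?mul1e//; last exact: measurable_kernel.
  by under eq_integral do rewrite diracE; rewrite integral_indic// setIT.
rewrite kernel_iterS; under eq_integral do rewrite IH.
by rewrite integral_mkcomp_noparam//; exact: measurable_kernel.
Qed.

Lemma kernel_iter_le1 K k x A : measurable A -> kernel_iter K k x A <= 1.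
Proof.
by move=> mA; rewrite -(kernel_iter_setT K k x); apply: le_measure; rewrite ?inE.
Qed.

Lemma kernel_iter_fin_num K k x A : measurable A -> kernel_iter K k x A \is a fin_num.
Proof.
move=> mA; rewrite ge0_fin_numE ?measure_ge0//.
exact: le_lt_trans (kernel_iter_le1 K k x mA) (ltry _).
Qed.

(** An alias on which a probability structure can be declared: [kernel_iter] is typed as a
    sub-probability kernel only. *)
Definition kernel_iter_prob K k x : set T -> \bar R := kernel_iter K k x.

HB.instance Definition _ K k x := Measure.on (kernel_iter_prob K k x).

HB.instance Definition _ K k x :=
  @Measure_isProbability.Build _ _ R (kernel_iter_prob K k x) (kernel_iter_setT K k x).

End kernel_iteration.

Section two_step.
Context d (T : measurableType d) (R : realType) (K : R.-pker T ~> T).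
Local Open Scope ereal_scope.

Definition two_step (f : T -> \bar R) x := \int[K x]_y \int[K y]_z f z.

Lemma measurable_kernel_integral (f : T -> \bar R) : (forall z, 0 <= f z) ->
  measurable_fun setT f -> measurable_fun setT (fun x => \int[K x]_y f y).
Proof.
by move=> f0 mf; apply: measurable_fun_integral_kernel => // U mU; exact: measurable_kernel.
Qed.

Lemma two_step_ge0 f x : (forall z, 0 <= f z) -> 0 <= two_step f x.
Proof. by move=> f0; do 2 apply: integral_ge0 => ? _. Qed.

Lemma two_stepD f g x : (forall z, 0 <= f z) -> (forall z, 0 <= g z) ->
  measurable_fun setT f -> measurable_fun setT g ->
  two_step (fun z => f z + g z) x = two_step f x + two_step g x.
Proof.
move=> f0 g0 mf mg; rewrite /two_step.
under eq_integral do rewrite ge0_integralD//.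
rewrite ge0_integralD//.
- by move=> y _; apply: integral_ge0 => ? _.
- exact: measurable_kernel_integral.
- by move=> y _; apply: integral_ge0 => ? _.
- exact: measurable_kernel_integral.
Qed.

Lemma two_stepZ (c : R) f x : (0 <= c)%R -> (forall z, 0 <= f z) ->
  measurable_fun setT f -> two_step (fun z => c%:E * f z) x = c%:E * two_step f x.
Proof.
move=> c0 f0 mf; rewrite /two_step.
under eq_integral do rewrite ge0_integralZl_EFin//.
rewrite ge0_integralZl_EFin//.
- by move=> y _; apply: integral_ge0 => ? _.
- exact: measurable_kernel_integral.
Qed.

Lemma two_step_cst (c : R) x : two_step (fun=> c%:E) x = c%:E.
Proof.
rewrite /two_step; under eq_integral do rewrite integral_cst// prob_kernel mule1.
by rewrite integral_cst// prob_kernel mule1.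
Qed.

Lemma two_step_le f g x : (forall z, 0 <= f z) -> measurable_fun setT f ->
  measurable_fun setT g -> (forall z, f z <= g z) -> two_step f x <= two_step g x.
Proof.
move=> f0 mf mg fg; have g0 z : 0 <= g z by exact: le_trans (f0 z) (fg z).
apply: ge0_le_integral => //.
- by move=> y _; apply: integral_ge0 => ? _.
- exact: measurable_kernel_integral.
- exact: measurable_kernel_integral.
by move=> y _; apply: ge0_le_integral.
Qed.

End two_step.

(* Harris' theorem, after Hairer and Mattingly: for small [b] the two-step kernel
   contracts the oscillation of functions measured against
   [2 + b * (V x + V y)]. *)
Section harris.
Context d (T : measurableType d) (R : realType) (K : R.-pker T ~> T).
Variables (V : T -> \bar R) (gamma B : R).
Hypotheses (mV : measurable_fun setT V) (V_ge0 : forall x, (0 <= V x)%E).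
Hypotheses (gamma01 : 0 <= gamma < 1) (B_ge0 : 0 <= B).
Hypothesis drift : forall x, (\int[K x]_y V y <= gamma%:E * V x + B%:E)%E.
(** Minorization in dual form. For indicators of a set and of its complement, with [a = 1], it says
    that the two-step laws from [x] and [y] are at total variation distance at most [1 - e]. General
    [f] and [g], possibly infinite, are what the contraction argument feeds it. *)
Hypothesis overlap : forall r : R, exists2 e : R, 0 < e &
  forall (x y : T) (f g : T -> \bar R) (a : R), (V x <= r%:E)%E -> (V y <= r%:E)%E ->
    (forall z, (0 <= f z)%E) -> (forall z, (0 <= g z)%E) ->
    measurable_fun setT f -> measurable_fun setT g ->
    0 <= a -> (forall z, (a%:E <= f z + g z)%E) ->
    ((e * a)%:E <= two_step K f x + two_step K g y)%E.
Variable x0 : T.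
Hypothesis Vx0 : (V x0 < +oo)%E.

Local Notation v x := (fine (V x)).

Let VE x : (V x < +oo)%E -> V x = (v x)%:E.
Proof. by move=> h; rewrite fineK// ge0_fin_numE. Qed.

Let v_ge0 x : 0 <= v x.
Proof. by rewrite fine_ge0. Qed.

(** One-sided, which suffices because [x] and [y] may be exchanged. Points of infinite [V] must be
    left out, since [fine] sends [+oo] to 0. *)
Definition osc_le (b c : R) (f : T -> R) := forall x y, (V x < +oo)%E -> (V y < +oo)%E ->
  f x - f y <= c * (2 + b * (v x + v y)).

Let gamma2 := gamma ^+ 2.
(** Iterating the drift twice gives the additive constant [(1 + gamma) * B]; the extra 1 makes it
    positive, so that one can divide by it. *)
Let B2 := (1 + gamma) * B + 1.

Let B2_gt0 : 0 < B2.
Proof.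
by case/andP: gamma01 => g0 g1; rewrite /B2 ltr_wpDl// mulr_ge0// addr_ge0.
Qed.

Let gamma2_ge0 : 0 <= gamma2. Proof. by rewrite /gamma2 exprn_ge0//; case/andP: gamma01. Qed.

Let gamma2_lt1 : gamma2 < 1.
Proof. by case/andP: gamma01 => g0 g1; rewrite /gamma2 expr_lt1. Qed.

Let two_step_V x : (V x < +oo)%E -> exists2 w, two_step K V x = w%:E & w <= gamma2 * v x + B2.
Proof.
move=> Vx; case/andP: gamma01 => g0 g1.
have h : (two_step K V x <= (gamma2 * v x + B2)%:E)%E.
  apply: (@le_trans _ _ (\int[K x]_y (gamma%:E * V y + B%:E))%E).
    apply: ge0_le_integral => //.
    - by move=> y _; apply: integral_ge0 => ? _.
    - exact: measurable_kernel_integral.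
    - by apply: emeasurable_funD => //; exact: measurable_funeM.
  rewrite ge0_integralD//; last 2 first.
  - by move=> y _; rewrite mule_ge0.
  - exact: measurable_funeM.
  rewrite ge0_integralZl_EFin// integral_cst// prob_kernel mule1.
  apply: (@le_trans _ _ (gamma%:E * (gamma%:E * V x + B%:E) + B%:E)%E).
    apply: leeD => //; apply: lee_pmul => //; first by apply: integral_ge0.
  rewrite VE//= -?EFinM -?EFinD -?EFinM -?EFinD lee_fin /gamma2 /B2.
  have : 0 <= gamma * v x by rewrite mulr_ge0.
  lra.
have fV : two_step K V x \is a fin_num.
  by rewrite ge0_fin_numE ?two_step_ge0// (le_lt_trans h) ?ltry.
by exists (fine (two_step K V x)); rewrite ?fineK// -lee_fin fineK.
Qed.

(** Put [u = b * (vx + vy)]; by the drift, [b * (wx + wy) <= g2 * u + e]. In the near case the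
    overlap gains [2 * e], which pays for this [e] and leaves [e >= 2 * del]. In the far case one
    needs [e + 2 * del <= (1 - g2 - del) * u]; at the smallest admissible value
    [u = 2 * e / (1 - g2)] this is an equality, precisely by the equation that defines [del]. *)
Let osc_arith (e b del g2 D c t wx wy vx vy : R) : 0 < c -> 0 < b ->
  0 <= vx -> 0 <= vy ->
  0 < 1 - g2 -> 0 < del -> 2 * del < 1 - g2 -> 2 * del < e ->
  del * (1 - g2 + e) * 2 = e * (1 - g2) ->
  wx <= g2 * vx + t -> wy <= g2 * vy + t -> 2 * b * t = e ->
  D <= c * (2 + b * (wx + wy)) ->
  (D <= c * (2 + b * (wx + wy) - 2 * e) \/ 4 * t <= (vx + vy) * (1 - g2)) ->
  D <= c * (1 - del) * (2 + b * (vx + vy)).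
Proof.
move=> c0 b0 vx0 vy0 g0 d0 dg de dE hx hy bt D1 D2.
have bw : b * (wx + wy) <= g2 * (b * (vx + vy)) + e.
  have : b * (wx + wy) <= b * (g2 * (vx + vy) + 2 * t) by rewrite ler_pM2l//; lra.
  by move/le_trans; apply; rewrite -bt; lra.
have T0 : 0 <= b * (vx + vy) by rewrite mulr_ge0 ?addr_ge0// ltW.
rewrite -mulrA.
case: D2 => [D2|large].
  apply: (le_trans D2); rewrite ler_pM2l//.
  have : 0 <= (1 - g2 - del) * (b * (vx + vy)) by apply: mulr_ge0 => //; lra.
  move: bw; move: (b * (vx + vy)) (b * (wx + wy)) => t1 t2; lra.
apply: (le_trans D1); rewrite ler_pM2l//.
have : 2 * e <= b * (vx + vy) * (1 - g2).
  have : b * (4 * t) <= b * ((vx + vy) * (1 - g2)) by rewrite ler_pM2l.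
  rewrite -bt; lra.
move: bw; move: (b * (vx + vy)) (b * (wx + wy)) T0 => u w u0 bw ug.
have : (1 - g2 - del) * (2 * e) <= (1 - g2 - del) * (u * (1 - g2)).
  by rewrite ler_pM2l//; lra.
have : 0 <= (1 - g2) * ((1 - g2 - del) * u - e - 2 * del) -> e + 2 * del <= (1 - g2 - del) * u.
  by rewrite pmulr_rge0// => h; lra.
move=> h1 h2; have /h1 : 0 <= (1 - g2) * ((1 - g2 - del) * u - e - 2 * del).
  move: h2 dE; lra.
lra.
Qed.

(** The oscillation bound is equivalent to a pointwise one after centring: for [m] the infimum of
    [S], [phi + m] lies between [- A] and [A], where [A = c * (1 + b * V)]. Hence
    [f = A - (phi + m)] and [g = A + (phi + m)] are nonnegative with [f + g = 2 * A >= 2 * c]. In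
    [two_step K f x + two_step K g y] the constant [m] cancels: nonnegativity of this sum gives the
    bound used for distant points, and [overlap] improves it by [2 * e * c] on a sublevel set of
    [V]. *)
Lemma two_step_osc : exists b rho : R, [/\ 0 < b, 0 < rho < 1 &
  forall (c : R) (phi : T -> R), 0 < c -> measurable_fun setT phi ->
    (forall x, 0 <= phi x <= 1) -> osc_le b c phi ->
    osc_le b (c * rho) (fun x => fine (two_step K (EFin \o phi) x))].
Proof.
pose r := 4 * B2 / (1 - gamma2).
have g1 : 0 < 1 - gamma2 by rewrite subr_gt0.
have [e e0 ovl] := overlap r.
(* Makes [2 * b * B2 = e]: the additive part of the drift then raises the weight by [e], half of
   what the overlap gains. *)
pose b := e / (2 * B2).
have b0 : 0 < b by rewrite divr_gt0// mulr_gt0.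
have ge : 0 < 1 - gamma2 + e by exact: addr_gt0.
pose del := e * (1 - gamma2) / (2 * (1 - gamma2 + e)).
have de : del * (1 - gamma2 + e) * 2 = e * (1 - gamma2).
  by rewrite /del; field; rewrite gt_eqF.
have del0 : 0 < del by rewrite divr_gt0// mulr_gt0.
have del1 : 2 * del < 1 - gamma2 by move: de del0 e0 g1; nra.
have del2 : 2 * del < e by move: de del0 e0 g1; nra.
exists b, (1 - del); split => //.
  by apply/andP; split; move: del1 del0 gamma2_ge0; lra.
move=> c phi c0 mphi phi01 phiosc x y Vx Vy.
pose S := [set c * (1 + b * v z) - phi z | z in [set z | (V z < +oo)%E]].
have S0 : S !=set0 by exists (c * (1 + b * v x0) - phi x0), x0.
have Slb z' : (V z' < +oo)%E -> lbound S (- (c * (1 + b * v z') + phi z')).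
  by move=> Vz' _ [z Vz <-]; have := phiosc z z' Vz Vz'; lra.
pose m := inf S.
(* The sign of [m] is unknown and integrals are split only for nonnegative functions, so [M] is
   added on both sides before integrating and removed afterwards. *)
pose M := `|m|.
have M1 : 0 <= m + M by rewrite /M; have := ler_normr 0 m; rewrite -lerBlDl sub0r -normrN ler_norm.
have M2 : 0 <= M - m by rewrite subr_ge0 ler_norm.
have M0 : 0 <= M by exact: normr_ge0.
have mle z : (V z < +oo)%E -> m <= c * (1 + b * v z) - phi z.
  move=> Vz; apply: ge_inf; last by exists z.
  by exists (- (c * (1 + b * v x0) + phi x0)); exact: Slb.
have mge z : (V z < +oo)%E -> - (c * (1 + b * v z) + phi z) <= m.
  by move=> Vz; apply: lb_le_inf => //; exact: Slb.
pose A z := (c%:E * (1 + b%:E * V z))%E.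
have AE z : (V z < +oo)%E -> A z = (c * (1 + b * v z))%:E.
  by move=> Vz; rewrite /A VE// -EFinM -EFinD -EFinM.
have Aoo z : ~~ (V z < +oo)%E -> A z = +oo%E.
  by rewrite -leNgt leye_eq /A => /eqP ->; rewrite gt0_muley ?lte_fin// addey// gt0_muley ?lte_fin.
have ooB (t : R) : (+oo - t%:E = +oo)%E by [].
have ooD (t : R) : (+oo + t%:E = +oo)%E by [].
have mA : measurable_fun setT A.
  by apply: measurable_funeM; apply: emeasurable_funD => //; exact: measurable_funeM.
have A0 z : (0 <= A z)%E.
  apply: mule_ge0; first by rewrite lee_fin ltW.
  by apply: adde_ge0 => //; apply: mule_ge0 => //; rewrite lee_fin ltW.
pose f z := (A z - (phi z + m)%:E)%E.
pose g z := (A z + (phi z + m)%:E)%E.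
have mphim (t : R) : measurable_fun setT (fun z => (phi z + t)%:E).
  by apply/measurable_EFinP; exact: measurable_funD.
have f0 z : (0 <= f z)%E.
  rewrite /f; have [Vz|Vz] := boolP (V z < +oo)%E; last by rewrite Aoo// ?ooB ?ooD.
  by rewrite AE// -EFinB lee_fin; have := mle z Vz; lra.
have g0 z : (0 <= g z)%E.
  rewrite /g; have [Vz|Vz] := boolP (V z < +oo)%E; last by rewrite Aoo// ?ooB ?ooD.
  by rewrite AE// -EFinD lee_fin; have := mge z Vz; lra.
have mf : measurable_fun setT f by apply: emeasurable_funB.
have mg : measurable_fun setT g by apply: emeasurable_funD.
have fE z : (f z + (phi z + (m + M))%:E = A z + M%:E)%E.
  rewrite /f; have [Vz|Vz] := boolP (V z < +oo)%E; last by rewrite Aoo// ?ooB ?ooD.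
  by rewrite AE// -EFinB -!EFinD; congr (_%:E); lra.
have gE z : (g z + (M - m)%:E = A z + (phi z + M)%:E)%E.
  rewrite /g; have [Vz|Vz] := boolP (V z < +oo)%E; last by rewrite Aoo// ?ooB ?ooD.
  by rewrite AE// -!EFinD; congr (_%:E); lra.
have fg z : ((2 * c)%:E <= f z + g z)%E.
  rewrite /f /g; have [Vz|Vz] := boolP (V z < +oo)%E; last by rewrite Aoo// ooB ooD leey.
  rewrite AE// -EFinB -!EFinD lee_fin.
  have : 0 <= c * (b * v z) by rewrite mulr_ge0 ?(ltW c0)// mulr_ge0// ltW.
  lra.
have phi0 z : (0 <= (EFin \o phi) z)%E by rewrite /= lee_fin; case/andP: (phi01 z).
have mphi' : measurable_fun setT (EFin \o phi) by exact/measurable_EFinP.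
have phiE z : two_step K (EFin \o phi) z = (fine (two_step K (EFin \o phi) z))%:E.
  rewrite fineK// ge0_fin_numE ?two_step_ge0//.
  apply: (@le_lt_trans _ _ 1%E); last exact: ltry.
  rewrite -[leRHS](two_step_cst K 1 z); apply: two_step_le => // z'.
  by rewrite /= lee_fin; case/andP: (phi01 z').
have AwE z w : two_step K V z = w%:E -> two_step K A z = (c * (1 + b * w))%:E.
  move=> h; rewrite /A two_stepZ ?ltW//; last 2 first.
  - by move=> z'; rewrite adde_ge0// mule_ge0// lee_fin ltW.
  - by apply: emeasurable_funD => //; exact: measurable_funeM.
  rewrite two_stepD//; last 2 first.
  - by move=> z'; rewrite mule_ge0// lee_fin ltW.
  - exact: measurable_funeM.
  by rewrite two_step_cst two_stepZ ?ltW// h.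
have [wx wxE wxle] := two_step_V Vx.
have [wy wyE wyle] := two_step_V Vy.
set px := fine (two_step K (EFin \o phi) x).
set py := fine (two_step K (EFin \o phi) y).
have fx : two_step K f x = (c * (1 + b * wx) - px - m)%:E.
  have : (two_step K f x + (px + (m + M))%:E = (c * (1 + b * wx) + M)%:E)%E.
    have <- : two_step K (fun z => (phi z + (m + M))%:E) x = (px + (m + M))%:E.
      under [X in two_step K X _]eq_fun do rewrite EFinD.
      rewrite two_stepD//.
      by rewrite two_step_cst phiE.
    rewrite -two_stepD//; last by move=> z; rewrite lee_fin addr_ge0//; case/andP: (phi01 z).
    under [X in two_step K X _]eq_fun do rewrite fE.
    by rewrite two_stepD// two_step_cst (AwE _ _ wxE) -EFinD.
  move/(congr1 (fun t => t - (px + (m + M))%:E)%E); rewrite addeK// => ->.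
  by rewrite -EFinB; congr (_%:E); lra.
have gy : two_step K g y = (c * (1 + b * wy) + py + m)%:E.
  have : (two_step K g y + (M - m)%:E = (c * (1 + b * wy) + py + M)%:E)%E.
    have <- : two_step K (fun=> (M - m)%:E) y = (M - m)%:E by rewrite two_step_cst.
    rewrite -two_stepD//.
    under [X in two_step K X _]eq_fun do rewrite gE EFinD.
    rewrite two_stepD//; last 2 first.
    - by move=> z; apply: adde_ge0; rewrite lee_fin//; case/andP: (phi01 z).
    - by apply: emeasurable_funD.
    by rewrite two_stepD// two_step_cst (AwE _ _ wyE) phiE -!EFinD addrA.
  move/(congr1 (fun t => t - (M - m)%:E)%E); rewrite addeK// => ->.
  by rewrite -EFinB; congr (_%:E); lra.
apply: (@osc_arith e b del gamma2 (px - py) c B2 wx wy (v x) (v y)) => //.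
- by rewrite /b; field; rewrite gt_eqF.
- have : (0 <= two_step K f x + two_step K g y)%E by rewrite adde_ge0// two_step_ge0.
  by rewrite fx gy -EFinD lee_fin; lra.
- have [small|large] := leP ((v x + v y) * (1 - gamma2)) (4 * B2); last by right; exact: ltW.
  left.
  have vr : v x + v y <= r by rewrite /r ler_pdivlMr.
  have Vxr : (V x <= r%:E)%E by rewrite VE// lee_fin; have := v_ge0 y; lra.
  have Vyr : (V y <= r%:E)%E by rewrite VE// lee_fin; have := v_ge0 x; lra.
  have c2 : 0 <= 2 * c by rewrite mulr_ge0// ltW.
  have := ovl x y f g (2 * c) Vxr Vyr f0 g0 mf mg c2 fg.
  by rewrite fx gy -EFinD lee_fin; lra.
Qed.

(** The oscillation bound compares the iterates from any [y] with those from [x0]. Averaging it over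
    [y] drawn from [K x0] shows that the laws from [x0] have geometrically small increments, which
    yields the limit [P]. Stationarity passes to [P] because the convergence is uniform over sets.
    For another starting point, the error is the oscillation between [x] and [x0] plus the error at
    [x0]. *)
Theorem harris (S : set T) : (forall x, S x -> (V x < +oo)%E) -> geometrically_ergodic_on S K.
Proof.
move=> SV.
have [b [rho [b0 /andP[r0 r1] H]]] := two_step_osc.
case/andP: gamma01 => gam0 gam1.
have KT x : K x setT = 1%E by exact: prob_kernel.
pose s := Num.sqrt rho.
have s0 : 0 < s by rewrite sqrtr_gt0.
have ss : s * s = rho by rewrite -expr2 sqr_sqrtr// ltW.
have s1 : s < 1 by rewrite -sqrtr1 ltr_sqrt.
have sV : 1 <= s^-1 by rewrite invf_ge1// ltW.
have sn k : 0 < s ^+ k by exact: exprn_gt0.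
have mK k A : measurable A -> measurable_fun setT (fun x => fine (kernel_iter K k x A)).
  by move=> mA; apply: measurableT_comp => //; exact: measurable_kernel.
have K01 k A x : measurable A -> 0 <= fine (kernel_iter K k x A) <= 1.
  move=> mA; rewrite fine_ge0//= -lee_fin fineK ?kernel_iter_fin_num//.
  exact: kernel_iter_le1.
have osc01 c (phi : T -> R) : 1 <= c -> (forall x, 0 <= phi x <= 1) -> osc_le b c phi.
  move=> c1 phi01 x y Vx Vy.
  have /andP[_ h1] := phi01 x; have /andP[h2 _] := phi01 y.
  have h3 : 1 <= 2 + b * (v x + v y).
    by have : 0 <= b * (v x + v y) by [rewrite mulr_ge0 ?addr_ge0// ltW]; lra.
  have : 1 * 1 <= c * (2 + b * (v x + v y)) by apply: ler_pM.
  lra.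
(* Each pair of steps contracts by [rho], that is, each step by [s = sqrt rho]. Even and odd
   iterates are chained separately, whence an induction on [k] and [k + 1] together; the factor
   [s^-1] keeps the constant at 1 for [k = 1], where the odd chain starts. *)
have osck A k : measurable A ->
    osc_le b (s^-1 * s ^+ k) (fun x => fine (kernel_iter K k x A)).
  move=> mA; suff [] : osc_le b (s^-1 * s ^+ k) (fun x => fine (kernel_iter K k x A)) /\
    osc_le b (s^-1 * s ^+ k.+1) (fun x => fine (kernel_iter K k.+1 x A)) by [].
  elim: k => [|k [IH1 IH2]]; split => //.
  - by apply: osc01 => [|x]; [rewrite expr0 mulr1|exact: K01].
  - by apply: osc01 => [|x]; [rewrite expr1 mulVf// gt_eqF|exact: K01].
  have -> : s^-1 * s ^+ k.+2 = s^-1 * s ^+ k * rho by rewrite -ss !exprSr; lra.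
  have := H _ _ _ (mK k A mA) (fun x => K01 k A x mA) IH1.
  move=> /(_ ltac:(by rewrite mulr_gt0// invr_gt0)).
  rewrite /osc_le (_ : EFin \o _ = (kernel_iter K k ^~ A)) //.
  by apply/funext => x; rewrite /= fineK// kernel_iter_fin_num.
(* The mean of [s^-1 * (2 + b * (V x0 + V y))] for [y] drawn from [K x0], with the drift bounding
   the mean of [V y]. *)
pose c0 := s^-1 * (2 + b * (v x0 + (gamma * v x0 + B))).
have incr k A : measurable A ->
    `|fine (kernel_iter_prob K k.+1 x0 A) - fine (kernel_iter_prob K k x0 A)| <= c0 * s ^+ k.
  move=> mA; pose ck := s^-1 * s ^+ k.
  have ck0 : 0 < ck by rewrite mulr_gt0// invr_gt0.
  (* The oscillation bound between [x0] and [y] as an extended real: being infinite where [V] is, it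
     holds at every [y] and can be integrated. *)
  pose Q y := ((ck * (2 + b * v x0))%:E + (ck * b)%:E * V y)%E.
  have Q1 : 0 <= ck * (2 + b * v x0) by apply: mulr_ge0; [exact: ltW|apply: addr_ge0 => //; apply: mulr_ge0 => //; exact: ltW].
  have Q2 : 0 < ck * b by rewrite mulr_gt0.
  have Q0 y : (0 <= Q y)%E by rewrite /Q adde_ge0 ?mule_ge0// lee_fin// ltW.
  have mQ : measurable_fun setT Q by apply: emeasurable_funD => //; exact: measurable_funeM.
  have mKk : measurable_fun setT (fun y => kernel_iter K k y A) by exact: measurable_kernel.
  have QE : (\int[K x0]_y Q y <= (c0 * s ^+ k)%:E)%E.
    rewrite ge0_integralD//; last 2 first.
    - by move=> y _; rewrite mule_ge0// lee_fin ltW.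
    - exact: measurable_funeM.
    rewrite integral_cst// prob_kernel mule1 ge0_integralZl_EFin// ?(ltW Q2)//.
    apply: (@le_trans _ _ ((ck * (2 + b * v x0))%:E + (ck * b)%:E * (gamma%:E * V x0 + B%:E))%E).
      by apply: leeD => //; apply: lee_pmul => //; [rewrite lee_fin ltW|apply: integral_ge0].
    rewrite VE//= -?EFinM -?EFinD -?EFinM -?EFinD lee_fin /c0 /ck; lra.
  have KkE y : kernel_iter K k y A = (fine (kernel_iter K k y A))%:E.
    by rewrite fineK// kernel_iter_fin_num.
  have Qoo y : ~~ (V y < +oo)%E -> Q y = +oo%E.
    by rewrite -leNgt leye_eq /Q => /eqP ->; rewrite gt0_muley ?lte_fin// addey.
  have le1 y : (kernel_iter K k y A <= kernel_iter K k x0 A + Q y)%E.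
    have [Vy|Vy] := boolP (V y < +oo)%E; last by rewrite Qoo// (KkE y) (KkE x0) addey// leey.
    rewrite (KkE y) (KkE x0) /Q (VE Vy) -?EFinM -?EFinD -?EFinD lee_fin.
    by have := osck A k mA y x0 Vy Vx0; rewrite -/ck; lra.
  have le2 y : (kernel_iter K k x0 A <= kernel_iter K k y A + Q y)%E.
    have [Vy|Vy] := boolP (V y < +oo)%E; last by rewrite Qoo// (KkE y) (KkE x0) addey// leey.
    rewrite (KkE y) (KkE x0) /Q (VE Vy) -?EFinM -?EFinD -?EFinD lee_fin.
    by have := osck A k mA x0 y Vx0 Vy; rewrite -/ck; lra.
  have S1E : kernel_iter K k.+1 x0 A = (fine (kernel_iter K k.+1 x0 A))%:E.
    by rewrite fineK// kernel_iter_fin_num.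
  have L1 : (kernel_iter K k.+1 x0 A <= kernel_iter K k x0 A + (c0 * s ^+ k)%:E)%E.
    rewrite kernel_iterS; apply: (@le_trans _ _ (\int[K x0]_y (kernel_iter K k x0 A + Q y))%E).
      apply: ge0_le_integral => //.
      by apply: emeasurable_funD.
    rewrite ge0_integralD// integral_cst// prob_kernel mule1.
    exact: leeD.
  have L2 : (kernel_iter K k x0 A <= kernel_iter K k.+1 x0 A + (c0 * s ^+ k)%:E)%E.
    apply: (@le_trans _ _ (\int[K x0]_y (kernel_iter K k y A + Q y))%E).
      rewrite [leLHS](_ : _ = \int[K x0]__ (kernel_iter K k x0 A))%E; last first.
        by rewrite integral_cst// KT mule1.
      apply: ge0_le_integral => //.
      by apply: emeasurable_funD.
    by rewrite ge0_integralD// kernel_iterS; apply: leeD.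
  move: L1 L2; rewrite S1E KkE -!EFinD !lee_fin /kernel_iter_prob => L1 L2.
  by rewrite ler_norml; apply/andP; split; lra.
have s01 : 0 <= s < 1 by rewrite ltW.
have [P PP] := exists_setwise_limit s01 incr.
have e0 : (fun k => c0 / (1 - s) * s ^+ k) @ \oo --> 0.
  rewrite -(mulr0 (c0 / (1 - s))); apply: cvgMr; apply: cvg_expr.
  by rewrite ger0_norm// ltW.
pose C := c0 / (1 - s).
have C0 : 0 <= C.
  rewrite /C /c0 divr_ge0// ?subr_ge0 ?(ltW s1)// mulr_ge0 ?invr_ge0 ?(ltW s0)//.
  by rewrite addr_ge0// mulr_ge0 ?(ltW b0)// !addr_ge0// mulr_ge0.
exists P; split.
  move=> A mA.
  have mKA : measurable_fun setT (fun x => fine (K x A)).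
    by apply: measurableT_comp => //; exact: measurable_kernel.
  have KAE x : K x A = (fine (K x A))%:E.
    rewrite fineK// ge0_fin_numE ?measure_ge0//; apply: (@le_lt_trans _ _ 1%E); last exact: ltry.
    by rewrite -(KT x); apply: le_measure; rewrite ?inE.
  have KA01 x : 0 <= fine (K x A) <= 1.
    rewrite fine_ge0//= -lee_fin -KAE -(KT x).
    by apply: le_measure; rewrite ?inE.
  have PA : P A = (fine (P A))%:E by rewrite fineK// fin_num_measure.
  have sw k B' : measurable B' ->
      (P B' <= kernel_iter_prob K k x0 B' + (C * s ^+ k)%:E)%E /\
      (kernel_iter_prob K k x0 B' <= P B' + (C * s ^+ k)%:E)%E.
    move=> mB; have := PP k B' mB.
    have -> : P B' = (fine (P B'))%:E by rewrite fineK// fin_num_measure.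
    have -> : kernel_iter_prob K k x0 B' = (fine (kernel_iter_prob K k x0 B'))%:E.
      by rewrite fineK// fin_num_measure.
    rewrite -!EFinD !lee_fin/= ler_norml -/C => /andP[h1 h2]; split; lra.
  have KiE k : (\int[kernel_iter_prob K k x0]_x (fine (K x A))%:E = kernel_iter_prob K k.+1 x0 A)%E.
    rewrite /kernel_iter_prob kernel_iterSr//; under eq_integral do rewrite -KAE.
    exact: eq_measure_integral.
  have e0k k : 0 <= C * s ^+ k by rewrite mulr_ge0// ltW.
  have up k : (\int[P]_x K x A <= P A + (C * s ^+ k.+1 + C * s ^+ k)%:E)%E.
    under eq_integral do rewrite KAE.
    apply: le_trans (integral_le_setwise mKA KA01 (e0k k) (fun B' mB => (sw k B' mB).1)) _.
    rewrite EFinD addeA KiE; apply: leeD => //.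
    by have [_] := sw k.+1 A mA.
  have low k : (P A <= \int[P]_x K x A + (C * s ^+ k.+1 + C * s ^+ k)%:E)%E.
    under eq_integral do rewrite KAE.
    have [h _] := sw k.+1 A mA; apply: (le_trans h).
    rewrite -KiE [(C * s ^+ k.+1 + _)]addrC EFinD addeA; apply: leeD => //.
    exact: integral_le_setwise mKA KA01 (e0k k) (fun B' mB => (sw k B' mB).2).
  have cv0 : (fun k => C * s ^+ k.+1 + C * s ^+ k) @ \oo --> 0.
    by rewrite -[0]addr0; apply: cvgD => //; rewrite (cvg_shiftS (fun k => C * s ^+ k)).
  have small (e : R) : 0 < e -> exists k, C * s ^+ k.+1 + C * s ^+ k <= e.
    move=> e_gt0; move/cvgrPdist_le : cv0 => /(_ e e_gt0)[N _ /(_ N (leqnn N))].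
    by rewrite sub0r normrN => /(le_trans (ler_norm _)) h; exists N.
  apply/eqP; rewrite eq_le; apply/andP; split; apply/lee_addgt0Pr => e e_gt0.
  - have [k hk] := small e e_gt0; apply: le_trans (up k) _.
    by apply: leeD => //; rewrite lee_fin.
  - have [k hk] := small e e_gt0; apply: le_trans (low k) _.
    by apply: leeD => //; rewrite lee_fin.
exists s, (fun x => s^-1 * (2 + b * (v x + v x0)) + C); split => // x k Sx.
apply: ge_ereal_sup => _ [A mA <-].
have Vx := SV x Sx.
have -> : P A = (fine (P A))%:E by rewrite fineK// fin_num_measure.
have -> : kernel_iter K k x A = (fine (kernel_iter K k x A))%:E.
  by rewrite fineK// kernel_iter_fin_num.
rewrite -EFinB abse_EFin lee_fin.
have := PP k A mA; rewrite /kernel_iter_prob -/C.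
have := osck A k mA x x0 Vx Vx0; have := osck A k mA x0 x Vx0 Vx.
rewrite !ler_norml => h1 h2 /andP[h3 h4].
by apply/andP; split; lra.
Qed.

End harris.

(** * Densities and product measures *)

Section density_integrals.
Context d d' (X : measurableType d) (Y : measurableType d') (R : realType).
Variables (mu : {sigma_finite_measure set Y -> \bar R}) (w : X * Y -> R).
Hypotheses (mw : measurable_fun setT w) (w0 : forall z, 0 <= w z).
Local Open Scope ereal_scope.
Local Notation dk := (mdensity_kernel mu mw w0).

Let mw1 x : measurable_fun setT (fun y => (w (x, y))%:E).
Proof. by apply/measurable_EFinP; exact: (measurableT_comp mw (pair1_measurable x)). Qed.

Let integral_density_indic x A : measurable A ->
  \int[dk x]_y (\1_A y)%:E = \int[mu]_y ((\1_A y)%:E * (w (x, y))%:E).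
Proof.
move=> mA; rewrite integral_indic// setIT /mdensity_kernel/= /density_kernel.
rewrite integral_mkcond; apply: eq_integral => y _.
by rewrite patchE indicE; case: ifPn => _; rewrite ?mul1e ?mul0e.
Qed.

Import HBNNSimple.

Let integral_density_nnsfun x (f : {nnsfun Y >-> R}) :
  \int[dk x]_y (f y)%:E = \int[mu]_y ((f y)%:E * (w (x, y))%:E).
Proof.
under [in LHS]eq_integral do rewrite fimfunE -fsumEFin//.
rewrite ge0_integral_fsum//; last 2 first.
  - by move=> r; exact/measurable_EFinP/measurableT_comp.
  - by move=> r z _; rewrite EFinM nnfun_muleindic_ge0.
under [in RHS]eq_integral.
  move=> y _; rewrite fimfunE -fsumEFin// ge0_mule_fsuml; last first.
    by move=> r; rewrite EFinM nnfun_muleindic_ge0.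
  over.
rewrite /= ge0_integral_fsum//; last 2 first.
  - move=> r; apply: emeasurable_funM => //.
    exact/measurable_EFinP/measurableT_comp.
  - move=> r z _; apply: mule_ge0; last by rewrite lee_fin.
    by rewrite EFinM nnfun_muleindic_ge0.
apply: eq_fsbigr => r _.
have [r0|r0] := leP 0%R r.
  transitivity (\int[dk x]_y (r%:E * (\1_(f @^-1` [set r]) y)%:E)).
    by apply: eq_integral => y _; rewrite EFinM.
  rewrite ge0_integralZl//; last first.
    by apply/measurable_EFinP; exact: measurable_indic.
  rewrite integral_density_indic// -ge0_integralZl//.
  - by apply: eq_integral => y _; rewrite EFinM muleA.
  - by apply: emeasurable_funM => //; apply/measurable_EFinP; exact: measurable_indic.
  - by move=> y _; rewrite mule_ge0// lee_fin.
rewrite !integral0_eq// => y _; rewrite preimage_nnfun0// indic0/= ?mulr0//.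
by rewrite mul0e.
Qed.

Lemma integral_density x (h : Y -> \bar R) : (forall y, 0 <= h y) -> measurable_fun setT h ->
  \int[dk x]_y h y = \int[mu]_y (h y * (w (x, y))%:E).
Proof.
move=> h0 mh; pose h_ := nnsfun_approx measurableT mh.
have hE y : h y = limn (fun n => (h_ n y)%:E).
  by apply/esym/cvg_lim => //; exact: cvg_nnsfun_approx.
transitivity (\int[dk x]_y limn (fun n => (h_ n y)%:E)).
  by apply: eq_integral => y _; rewrite hE.
rewrite monotone_convergence//; last 3 first.
- by move=> n; exact/measurable_EFinP.
- by move=> n z _; rewrite lee_fin.
- by move=> z _ a b ab; rewrite lee_fin; exact/lefP/nd_nnsfun_approx.
under eq_fun do rewrite integral_density_nnsfun.
rewrite -monotone_convergence//; last 3 first.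
- by move=> n; apply: emeasurable_funM => //; exact/measurable_EFinP.
- by move=> n z _; rewrite mule_ge0// lee_fin.
- by move=> z _ a b ab; rewrite lee_wpmul2r// lee_fin//; exact/lefP/nd_nnsfun_approx.
apply: eq_integral => y _; rewrite hE; apply/cvg_lim => //.
apply: cvgeMr => //.
apply/cvg_ex; exists (h y); exact: cvg_nnsfun_approx.
Qed.

(** The condition on the total mass rules out the default branch of [knormalize]. *)
Lemma integral_knormalize_density (P : probability Y R) x (h : Y -> \bar R) :
  (forall y, 0 <= h y) -> measurable_fun setT h ->
  0 < \int[mu]_y (w (x, y))%:E < +oo ->
  \int[knormalize dk P x]_y h y =
  ((fine (\int[mu]_y (w (x, y))%:E))^-1)%:E * \int[mu]_y (h y * (w (x, y))%:E).
Proof.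
move=> h0 mh /andP[Z0 Zoo].
have ZE : dk x setT = \int[mu]_y (w (x, y))%:E by [].
have i0 : (0 <= (fine (\int[mu]_y (w (x, y))%:E))^-1)%R by rewrite invr_ge0 fine_ge0// ltW.
rewrite -integral_density// -(@ge0_integral_mscale _ _ _ (dk x) setT measurableT (NngNum i0) h)//.
apply: eq_measure_integral => A mA _.
transitivity (dk x A * ((fine (\int[mu]_y (w (x, y))%:E))^-1)%:E); last first.
  by rewrite /mscale/= muleC.
by rewrite /knormalize /= /mnormalize /= /density_kernel gt_eqF//= lt_eqF.
Qed.

End density_integrals.

Section tuple_tonelli.
Context (R : realType).
Local Open Scope ereal_scope.

Lemma emeasurable_prod d (T : measurableType d) (I : Type) (r : seq I) (f : I -> T -> \bar R) :
  (forall i, measurable_fun setT (f i)) ->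
  measurable_fun setT (fun x => \prod_(i <- r) f i x).
Proof.
move=> mf; elim: r => [|i r IH].
  by under eq_fun do rewrite big_nil; exact: measurable_cst.
by under eq_fun do rewrite big_cons; exact: emeasurable_funM.
Qed.

Lemma lee_prod (I : Type) (r : seq I) (P : pred I) (f g : I -> \bar R) :
  (forall i, P i -> 0 <= f i <= g i) ->
  \prod_(i <- r | P i) f i <= \prod_(i <- r | P i) g i.
Proof.
move=> fg; elim: r => [|i r IH]; first by rewrite !big_nil.
rewrite !big_cons; case: ifPn => // Pi; have /andP[f0 fgi] := fg i Pi.
apply: lee_pmul => //; apply: prode_ge0 => j Pj.
by have /andP[] := fg j Pj.
Qed.

Lemma measurable_coord p (f : R -> \bar R) (j : 'I_p) : measurable_fun setT f ->
  measurable_fun setT (fun v : p.-tuple (measurableTypeR R) => f (tnth v j)).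
Proof.
by move=> mf; apply: (measurableT_comp (f := f)) => //; exact: measurable_tnth.
Qed.

(** Induction on [p]: the measure on [p.+1]-tuples is the image of a product, so Tonelli splits off
    the head. This is how every normalizing constant factors over the coordinates. *)
Lemma integral_tuple_prod p (f : 'I_p -> R -> \bar R) :
  (forall j x, 0 <= f j x) -> (forall j, measurable_fun setT (f j)) ->
  \int[tuple_lebesgue R p]_v \prod_(j < p) f j (tnth v j) =
  \prod_(j < p) \int[lebesgue_measure]_x f j x.
Proof.
elim: p f => [f f0 mf|p IH f f0 mf].
  rewrite big_ord0 (eq_integral (cst 1)); last by move=> v _; rewrite big_ord0.
  by rewrite integral_cst// mul1e /= diracT.
have mF q (g : 'I_q -> R -> \bar R) : (forall j, measurable_fun setT (g j)) ->
    measurable_fun setT (fun v : q.-tuple (measurableTypeR R) => \prod_(j < q) g j (tnth v j)).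
  by move=> mg; apply: emeasurable_prod => j; exact: measurable_coord.
have F0 q (g : 'I_q -> R -> \bar R) : (forall j x, 0 <= g j x) ->
    forall v : q.-tuple (measurableTypeR R), 0 <= \prod_(j < q) g j (tnth v j).
  by move=> g0 v; apply: prode_ge0 => j _.
rewrite /= ge0_integral_pushforward//; last 3 first.
- exact: (measurable_cons measurable_fst measurable_snd).
- exact: mF.
- by move=> v _; exact: F0.
rewrite preimage_setT.
pose g j := f (lift ord0 j).
rewrite (eq_integral (fun z : measurableTypeR R * p.-tuple (measurableTypeR R) =>
   f ord0 z.1 * \prod_(j < p) g j (tnth z.2 j))); last first.
  move=> [a v] _ /=; rewrite big_ord_recl tnth0; congr (_ * _).
  by apply: eq_bigr => j _; rewrite tnthS.
rewrite fubini_tonelli1//; last 2 first.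
- apply: emeasurable_funM.
    by apply: (measurableT_comp (mf ord0)); exact: measurable_fst.
  by apply: (measurableT_comp (mF p g _)) => // j; exact: mf.
- by move=> z; rewrite mule_ge0// F0// => j x; exact: f0.
rewrite /fubini_F/= big_ord_recl.
transitivity (\int[lebesgue_measure]_(a in [set: measurableTypeR R])
    (f ord0 a * \prod_(j < p) \int[lebesgue_measure]_x g j x)).
  apply: eq_integral => a _; rewrite ge0_integralZl//.
  - by rewrite IH// => j; [exact: f0|exact: mf].
  - by apply: mF => j; exact: mf.
  - by move=> v _; apply: F0 => j x; exact: f0.
rewrite ge0_integralZr//; first exact: mf.
by apply: prode_ge0 => j _; apply: integral_ge0 => x _; exact: f0.
Qed.

End tuple_tonelli.

(** * Integrals of the Lyapunov function against Gaussians *)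

(* The Lyapunov function of the sampler is a sum of [|b_j| ^ (-1/2)], made
   infinite on the hyperplanes [b_j = 0]. *)
Definition inv_sqrt (R : realType) (x : R) : \bar R :=
  if x == 0 then +oo%E else ((Num.sqrt `|x|)^-1)%:E.

Section inv_sqrt.
Context (R : realType).
Local Open Scope ereal_scope.

Lemma inv_sqrt_gt0 (x : R) : 0 < inv_sqrt x.
Proof.
rewrite /inv_sqrt; case: eqVneq => // x0.
by rewrite lte_fin invr_gt0 sqrtr_gt0 normr_gt0.
Qed.

Lemma inv_sqrt_ge0 (x : R) : 0 <= inv_sqrt x.
Proof. exact/ltW/inv_sqrt_gt0. Qed.

Lemma measurable_inv_sqrt : measurable_fun setT (@inv_sqrt R).
Proof.
rewrite /inv_sqrt; apply: measurable_fun_ifT => //.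
  by apply: measurable_fun_eqr => //; exact: measurable_cst.
apply/measurable_EFinP; apply: (measurableT_comp measurable_invr).
apply: measurableT_comp; last exact: normr_measurable.
apply: continuous_measurable_fun; exact: sqrt_continuous.
Qed.

Lemma inv_sqrt_le (x r : R) : (0 < r)%R -> (r <= `|x|)%R -> inv_sqrt x <= ((Num.sqrt r)^-1)%:E.
Proof.
move=> r0 rx; have x0 : (0 < `|x|)%R by exact: lt_le_trans rx.
rewrite /inv_sqrt -normr_eq0 gt_eqF// lee_fin lef_pV2 ?posrE ?sqrtr_gt0//.
by rewrite ler_wsqrtr.
Qed.

(** Turns a bound on [sum_inv_sqrt] of the scales into a lower bound on each of them. *)
Lemma inv_sqrt_le_norm (x r : R) : (0 < r)%R -> inv_sqrt x <= r%:E -> (r ^- 2 <= `|x|)%R.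
Proof.
move=> r0; rewrite /inv_sqrt; case: eqVneq => // x0; rewrite lee_fin => h.
have s0 : (0 < Num.sqrt `|x|)%R by rewrite sqrtr_gt0 normr_gt0.
have : (r^-1 <= Num.sqrt `|x|)%R by rewrite -[leRHS]invrK lef_pV2 ?posrE ?invr_gt0.
move=> h'; rewrite -[leRHS](sqr_sqrtr (normr_ge0 x)) -exprVn.
by rewrite lerXn2r// nnegrE ltW// invr_gt0.
Qed.

Definition sum_inv_sqrt p (v : p.-tuple R) : \bar R := \sum_(j < p) inv_sqrt (tnth v j).

Lemma sum_inv_sqrt_ge0 p (v : p.-tuple R) : 0 <= sum_inv_sqrt v.
Proof. by apply: sume_ge0 => j _; exact: inv_sqrt_ge0. Qed.

Lemma measurable_sum_inv_sqrt p :
  measurable_fun setT (@sum_inv_sqrt p : p.-tuple (measurableTypeR R) -> \bar R).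
Proof.
apply: emeasurable_sum => j; apply: measurable_coord; exact: measurable_inv_sqrt.
Qed.

Lemma inv_sqrt_le_sum p (v : p.-tuple R) j : inv_sqrt (tnth v j) <= sum_inv_sqrt v.
Proof.
rewrite /sum_inv_sqrt (bigD1 j)//= leeDl// sume_ge0// => i _; exact: inv_sqrt_ge0.
Qed.

Lemma sum_inv_sqrt_lty p (v : p.-tuple R) :
  (forall j, tnth v j != 0%R) -> sum_inv_sqrt v < +oo.
Proof.
by move=> v0; apply: lte_sum_pinfty => j _; rewrite /inv_sqrt (negbTE (v0 j)) ltry.
Qed.

End inv_sqrt.

Section inv_sqrt_integral.
Context (R : realType).
Local Notation mu := (@lebesgue_measure R).

Lemma integral_inv_sqrt_itv (a r : R) : 0 < a -> a < r ->
  (\int[mu]_(x in `[a, r]) ((Num.sqrt x)^-1)%:E = (2 * (Num.sqrt r - Num.sqrt a))%:E)%E.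
Proof.
move=> a0 ar.
have dsqrt (x : R) : 0 < x -> is_derive x 1 (fun x => 2 * Num.sqrt x) (Num.sqrt x)^-1.
  move=> x0; have -> : (Num.sqrt x)^-1 = 2 *: (2 * Num.sqrt x)^-1.
    by rewrite /GRing.scale/= invfM mulrA divff// mul1r.
  exact: is_deriveZ (is_derive1_sqrt x0).
have csqrt (x : R) : {for x, continuous (fun x : R => 2 * Num.sqrt x)}.
  by apply: cvgMr; exact: sqrt_continuous.
rewrite (@continuous_FTC2 _ _ (fun x => 2 * Num.sqrt x)) //.
- by rewrite -EFinB mulrBr.
- apply: continuous_in_subspaceT => x; rewrite inE/= in_itv/= => /andP[ax _].
  have x0 : 0 < x by exact: lt_le_trans ax.
  by apply: cvgV; [rewrite gt_eqF// sqrtr_gt0|exact: sqrt_continuous].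
- split.
  + move=> x; rewrite in_itv/= => /andP[ax _].
    by have [] := dsqrt x (lt_trans a0 ax).
  + by apply: cvg_at_right_filter; exact: csqrt.
  + by apply: cvg_at_left_filter; exact: csqrt.
move=> x; rewrite in_itv/= => /andP[ax _].
by rewrite derive1E; apply: derive_val; exact: dsqrt (lt_trans a0 ax).
Qed.

Lemma integral_inv_sqrt_oc (r : R) : 0 < r ->
  (\int[mu]_(x in `]0%R, r]) ((Num.sqrt x)^-1)%:E <= (2 * Num.sqrt r)%:E)%E.
Proof.
move=> r0.
(* The index [n.+2] keeps the interval nondegenerate at [n = 0], as the formula on [[a, r]] requires
   [a < r]. *)
pose F n : set R := `[r / n.+2%:R, r]%classic.
have FE : `]0%R, r]%classic = \bigcup_n F n.
  apply/seteqP; split => [x|x [n _]]; rewrite /F /= !in_itv/=.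
    move=> /andP[x0 xr]; exists (Num.truncn (r / x)) => //=.
    rewrite in_itv/= xr andbT ler_pdivrMr// mulrC -ler_pdivrMr//.
    apply/ltW; apply: lt_trans (truncnS_gt _) _; by rewrite ltr_nat.
  move=> /andP[rx ->]; rewrite andbT; apply: lt_le_trans rx.
  by rewrite divr_gt0.
have mF n : measurable (F n) by exact: measurable_itv.
have mf : measurable_fun setT (fun x : R => ((Num.sqrt x)^-1)%:E).
  apply/measurable_EFinP; apply: (measurableT_comp measurable_invr).
  by apply: continuous_measurable_fun; exact: sqrt_continuous.
rewrite FE; have cvgF : (\int[mu]_(x in F n) ((Num.sqrt x)^-1)%:E @[n --> \oo] -->
   \int[mu]_(x in \bigcup_i F i) ((Num.sqrt x)^-1)%:E)%E.
  apply: ge0_nondecreasing_set_cvg_integral => //.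
  - move=> n m nm; apply/subsetPset => x; rewrite /F /= !in_itv/= => /andP[rx ->].
    rewrite andbT; apply: le_trans rx; rewrite ler_pM2l// lef_pV2 ?posrE//.
    by rewrite ler_nat ltnS.
  - by move=> n; exact: measurable_funTS.
rewrite -(cvg_lim _ cvgF)//; apply: lime_le; first by apply/cvg_ex; eexists; exact: cvgF.
apply: nearW => n; rewrite /F integral_inv_sqrt_itv//.
- rewrite lee_fin ler_pM2l// lerBlDr lerDl sqrtr_ge0//.
- by rewrite divr_gt0.
- by rewrite ltr_pdivrMr// ltr_pMr// ltr1n.
Qed.

Lemma ge0_even_integral (f : R -> \bar R) : measurable_fun setT f ->
  (forall x, 0 <= f x)%E -> (forall x, f (- x) = f x) ->
  (\int[mu]_x f x = 2%:E * \int[mu]_(x in `]0%R, +oo[) f x)%E.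
Proof.
move=> mf f0 fN.
have -> : [set: R] = `]-oo, 0]%classic `|` `]0, +oo[%classic.
  by rewrite -itv_bndbnd_setU// ?set_itvNyy.
rewrite ge0_integral_setU//=; last 2 first.
- by apply: measurable_funTS.
- rewrite disj_set2E; apply/eqP/seteqP; split => // x [] /=.
  by rewrite !in_itv/= andbT => x0 /(le_lt_trans x0); rewrite ltxx.
rewrite -[2%R]/(1 + 1)%R EFinD ge0_muleDl// mul1e; congr (_ + _)%E.
rewrite integral_itv_obnd_cbnd//; last exact: measurable_funTS.
rewrite ge0_integration_by_substitution0//.
by under [RHS]eq_integral do rewrite fN.
Qed.

End inv_sqrt_integral.

Lemma integral_cst_itv (R : realType) (a b k : R) : a < b ->
  (\int[@lebesgue_measure R]_(x in `[a, b]) k%:E = (k * (b - a))%:E)%E.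
Proof.
move=> ab; rewrite integral_cst//.
by rewrite [X in (_ * X)%E](lebesgue_measure_itv `[a, b])/= lte_fin ab EFinM EFinB.
Qed.

Section gaussian.
Context (R : realType).
Local Notation mu := (@lebesgue_measure R).

Definition gaussian (s x : R) : R := expR (- (2^-1 * s ^- 2 * x ^+ 2)).

Definition sqrt2pi : R := Num.sqrt (2 * pi).

Lemma sqrt2pi_gt0 : 0 < sqrt2pi.
Proof. by rewrite sqrtr_gt0 mulr_gt0// pi_gt0. Qed.

Lemma gaussian_ge0 s x : 0 <= gaussian s x.
Proof. exact: expR_ge0. Qed.

Lemma gaussian_le1 s x : gaussian s x <= 1.
Proof.
by rewrite -expR0 ler_expR oppr_le0 mulr_ge0 ?sqr_ge0// mulr_ge0// invr_ge0 sqr_ge0.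
Qed.

Lemma measurable_gaussian s : measurable_fun setT (gaussian s).
Proof.
apply: measurableT_comp => //; apply: measurableT_comp => //.
by apply: measurable_funM => //; exact: measurable_funX.
Qed.

Lemma integral_gaussian s : 0 < s ->
  (\int[mu]_x (gaussian s x)%:E = (sqrt2pi * s)%:E)%E.
Proof.
move=> s0; have s1 : s != 0 by rewrite gt_eqF.
have := integral_normal_pdf 0 s; under eq_integral.
  move=> x _; rewrite normal_pdfE// (_ : normal_fun 0 s x = gaussian s x); last first.
    rewrite /normal_fun /gaussian subr0; congr expR.
    by rewrite -[s ^+ 2 *+ 2]mulr_natl invfM mulNr; congr (- _); lra.
  rewrite EFinM; over.
have pk := normal_peak_gt0 s1.
rewrite /= ge0_integralZl_EFin ?normal_peak_ge0//; last 2 first.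
- by move=> x _; rewrite lee_fin gaussian_ge0.
- by apply/measurable_EFinP; exact: measurable_gaussian.
move=> h.
have -> : (\int[mu]_x (gaussian s x)%:E =
    ((normal_peak s)^-1)%:E * ((normal_peak s)%:E * \int[mu]_x (gaussian s x)%:E))%E.
  by rewrite muleA -EFinM mulVf ?gt_eqF// mul1e.
rewrite h mule1 /normal_peak invrK /sqrt2pi; congr (_%:E).
rewrite -[s in RHS]gtr0_norm// -sqrtr_sqr -sqrtrM ?mulr_ge0 ?pi_ge0//.
by congr Num.sqrt; rewrite -mulr_natl; lra.
Qed.

(** On this interval the integrand is at least [expR (- 2^-1)]. *)
Lemma integral_gaussian_itv s : 0 < s ->
  ((2 * expR (- 2^-1) * s)%:E <= \int[mu]_(x in `[(- s)%R, s]) (gaussian s x)%:E)%E.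
Proof.
move=> s0.
apply: (@le_trans _ _ (\int[mu]_(x in `[(- s)%R, s]) (expR (- 2^-1))%:E)%E).
  by rewrite integral_cst_itv ?gtrN// lee_fin; lra.
apply: ge0_le_integral => //.
- by apply/measurable_EFinP/measurable_funTS; exact: measurable_gaussian.
move=> x; rewrite /= in_itv/= => /andP[x1 x2]; rewrite lee_fin ler_expR lerN2.
rewrite -mulrA -[leRHS]mulr1 ler_pM2l// mulrC ler_pdivrMr ?exprn_gt0// mul1r.
by rewrite -[leLHS]real_normK ?num_real// ler_sqr ?nnegrE// ?(ltW s0)// ler_norml x1.
Qed.

(** Split at [|x| = s]. Inside, the Gaussian factor is at most 1 and the power integrates to
    [2 * sqrt s] on each side. Outside, the power is at most [s ^ (-1/2)] and the Gaussian has mass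
    at most [sqrt2pi * s]. Divided by a normalizing constant of order [s], the bound becomes
    [s ^ (-1/2)]. *)
Lemma integral_inv_sqrt_gaussian s : 0 < s ->
  (\int[mu]_x (inv_sqrt x * (gaussian s x)%:E) <= ((4 + sqrt2pi) * Num.sqrt s)%:E)%E.
Proof.
move=> s0.
have mg : measurable_fun setT (fun x => (gaussian s x)%:E).
  by apply/measurable_EFinP; exact: measurable_gaussian.
have mf : measurable_fun setT (fun x : R => (inv_sqrt x * (gaussian s x)%:E)%E).
  by apply: emeasurable_funM => //; exact: measurable_inv_sqrt.
have f0 (x : R) : (0 <= inv_sqrt x * (gaussian s x)%:E)%E.
  by rewrite mule_ge0// ?inv_sqrt_ge0// lee_fin gaussian_ge0.
rewrite ge0_even_integral//; last first.
  by move=> x; rewrite /inv_sqrt oppr_eq0 normrN /gaussian sqrrN.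
have -> : `]0, +oo[%classic = `]0, s]%classic `|` `]s, +oo[%classic :> set R.
  by rewrite -itv_bndbnd_setU// bnd_simp ltW.
rewrite ge0_integral_setU//=; last 2 first.
- exact: measurable_funTS.
- rewrite disj_set2E; apply/eqP/seteqP; split => // x [] /=.
  by rewrite !in_itv/= andbT => /andP[_ xs] /(le_lt_trans xs); rewrite ltxx.
rewrite ge0_muleDr ?integral_ge0//.
have -> : (4 + sqrt2pi) * Num.sqrt s = 2 * (2 * Num.sqrt s) + (Num.sqrt s)^-1 * (sqrt2pi * s).
  have ss : Num.sqrt s * Num.sqrt s = s by rewrite -expr2 sqr_sqrtr// ltW.
  have sq0 : Num.sqrt s != 0 by rewrite gt_eqF// sqrtr_gt0.
  have h : (Num.sqrt s)^-1 * s = Num.sqrt s by rewrite -{2}ss mulKf.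
  by rewrite [X in _ = _ + X]mulrCA h; ring.
rewrite [leRHS]EFinD; apply: leeD.
  rewrite EFinM; apply: lee_pmul => //; first by apply: integral_ge0.
  apply: le_trans (integral_inv_sqrt_oc s0); apply: ge0_le_integral => //.
  - exact: measurable_funTS.
  - apply/measurable_EFinP; apply: (measurableT_comp measurable_invr).
    by apply: measurable_funTS; apply: continuous_measurable_fun; exact: sqrt_continuous.
  move=> x /=; rewrite in_itv/= => /andP[x0 _].
  rewrite /inv_sqrt gt_eqF// gtr0_norm// -EFinM lee_fin ler_piMr// ?gaussian_le1//.
apply: (@le_trans _ _ (2%:E * (((Num.sqrt s)^-1)%:E * \int[mu]_(x in `]0%R, +oo[) (gaussian s x)%:E))%E).
  apply: lee_pmul => //; first by apply: integral_ge0.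
  rewrite -ge0_integralZl_EFin//; last 2 first.
  - by move=> x _; rewrite lee_fin gaussian_ge0.
  - exact: measurable_funTS.
  apply: (@le_trans _ _ (\int[mu]_(x in `]s, +oo[) (((Num.sqrt s)^-1)%:E * (gaussian s x)%:E))%E).
    apply: ge0_le_integral => //.
    - exact: measurable_funTS.
    - by apply: measurable_funeM; exact: measurable_funTS.
    move=> x /=; rewrite in_itv/= andbT => sx.
    apply: lee_pmul => //.
    - exact: inv_sqrt_ge0.
    - by rewrite lee_fin gaussian_ge0.
    by apply: inv_sqrt_le => //; rewrite gtr0_norm ?(lt_trans s0)// ltW.
  apply: ge0_subset_integral => //.
  - by apply: measurable_funeM; exact: measurable_funTS.
  - by move=> x _; rewrite mule_ge0// lee_fin ?gaussian_ge0// invr_ge0 sqrtr_ge0.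
  by move=> x /=; rewrite !in_itv/= !andbT; exact: lt_trans.
rewrite muleCA -ge0_even_integral//; last 2 first.
- by move=> x; rewrite lee_fin gaussian_ge0.
- by move=> x; rewrite /gaussian sqrrN.
by rewrite integral_gaussian// EFinM.
Qed.

End gaussian.

(** * Update of beta *)

Section likelihood.
Context {R : realType} (n p : nat) (X : 'M[R]_(n, p)) (y : 'I_n -> bool).

Definition likelihood (b : p.-tuple R) : R :=
  \prod_(i < n) (Phi (lin_pred X i b) ^+ y i * (1 - Phi (lin_pred X i b)) ^+ (1 - y i)%N).

Lemma normal_prob_itv_gt0 (a b : R) : a < b -> (0 < normal_prob 0 1 `[a, b] :> \bar R)%E.
Proof.
move=> ab; pose m := expR (- (Num.max `|a| `|b|) ^+ 2).
have pk : 0 < normal_peak (1 : R) by apply: normal_peak_gt0.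
apply: (@lt_le_trans _ _ (\int[lebesgue_measure]_(x in `[a, b]) (normal_peak 1 * m)%:E)%E).
  by rewrite integral_cst_itv// lte_fin !mulr_gt0// ?expR_gt0// subr_gt0.
apply: ge0_le_integral => //.
- by move=> x _; rewrite lee_fin mulr_ge0 ?expR_ge0// ltW.
- by apply/measurable_EFinP/measurable_funTS; exact: measurable_normal_pdf.
move=> x; rewrite /= in_itv/= => /andP[ax xb]; rewrite lee_fin normal_pdfE//.
rewrite ler_pM2l// /normal_fun ler_expR subr0 expr1n mulNr lerN2.
have : x ^+ 2 <= (Num.max `|a| `|b|) ^+ 2.
  rewrite -[leLHS]real_normK ?num_real// ler_sqr ?nnegrE//.
  rewrite le_max; have [x0|x0] := leP 0 x.
    by rewrite orbC (ger0_norm x0) (le_trans xb)// ler_norm.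
  by rewrite (ltr0_norm x0) (@le_trans _ _ (- a)) ?lerN2// -normrN ler_norm.
by have := sqr_ge0 x; lra.
Qed.

Lemma Phi_gt0 (x : R) : 0 < Phi x.
Proof.
rewrite /Phi fine_gt0// ltey_eq fin_num_measure//= andbT.
apply: lt_le_trans (@normal_prob_itv_gt0 (x - 1) x _) _; first by rewrite ltrBlDr ltrDl.
by apply: le_measure; rewrite ?inE//; exact: subitvPl.
Qed.

Lemma Phi_lt1 (x : R) : Phi x < 1.
Proof.
have d0 : `]-oo, x]%classic `&` `[x + 1, x + 2]%classic = set0 :> set R.
  apply/seteqP; split => // z [] /=.
  by rewrite !in_itv/= => zx /andP[xz _]; lra.
have h := @normal_prob_itv_gt0 (x + 1) (x + 2) ltac:(by rewrite ltrD2l ltr1n).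
have : (normal_prob 0 1 (`]-oo, x] `|` `[(x + 1)%R, (x + 2)%R]) <= 1 :> \bar R)%E.
  by apply: probability_le1; exact: measurableU.
rewrite measureU//.
rewrite -[X in (X + _)%E]fineK ?fin_num_measure// -[X in (_ + X)%E]fineK ?fin_num_measure//.
rewrite -EFinD lee_fin; move: h; rewrite -[X in (0 < X)%E]fineK ?fin_num_measure// lte_fin /Phi.
lra.
Qed.

Lemma Phi_le (r s : R) : r <= s -> Phi r <= Phi s.
Proof.
by move=> rs; rewrite fine_le ?fin_num_measure// le_measure ?inE//; exact: subitvPr.
Qed.

Lemma likelihood_ge0 b : 0 <= likelihood b.
Proof.
by apply: prodr_ge0 => i _; rewrite mulr_ge0// exprn_ge0// ?Phi_ge0// subr_ge0 Phi_le1.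
Qed.

Lemma likelihood_le1 b : likelihood b <= 1.
Proof.
apply: prodr_ile1 => i _; apply/andP; split.
  by rewrite mulr_ge0// exprn_ge0// ?Phi_ge0// subr_ge0 Phi_le1.
case: (y i); rewrite ?expr1 ?expr0 ?mulr1 ?mul1r ?Phi_le1// lerBlDr lerDl.
exact: Phi_ge0.
Qed.

(** On a box every linear predictor is bounded and [Phi] is monotone with values strictly between 0
    and 1. Together with [likelihood_le1], this makes the beta weight comparable to a product of
    Gaussians near the origin. *)
Lemma likelihood_lb (r : R) : exists2 L : R, 0 < L &
  forall b, (forall j, `|tnth b j| <= r) -> L <= likelihood b.
Proof.
pose M i := \sum_(j < p) `|X i j| * r.
exists (\prod_(i < n) (Phi (- M i) ^+ y i * (1 - Phi (M i)) ^+ (1 - y i)%N)).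
  by apply: prodr_gt0 => i _; rewrite mulr_gt0// exprn_gt0 ?Phi_gt0// subr_gt0 Phi_lt1.
move=> b br; apply: ler_prod => i _.
have : `|lin_pred X i b| <= M i.
  apply: (le_trans (ler_norm_sum _ _ _)); apply: ler_sum => j _.
  by rewrite normrM ler_wpM2l.
rewrite ler_norml => /andP[h1 h2]; apply/andP; split.
  by rewrite mulr_ge0// exprn_ge0 ?Phi_ge0// subr_ge0 Phi_le1.
case: (y i); rewrite ?expr1 ?expr0 ?mulr1 ?mul1r; first exact: Phi_le.
by rewrite lerD2l lerN2 Phi_le.
Qed.

End likelihood.

(** * Gaussian bounds for the unnormalized law of beta *)

Section beta_update.
Context {R : realType} (n p : nat).
Variables (X : 'M[R]_(n, p)) (y : 'I_n -> bool) (zeta : R).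
Hypothesis zeta_gt0 : 0 < zeta.
Local Notation Rm := (measurableTypeR R).
Local Notation Rp := (p.-tuple (measurableTypeR R)).
Local Notation state := (gibbs_state R p).
Local Notation mu := (@lebesgue_measure R).
Local Notation lik := (likelihood X y).

(** Precision of the Gaussian factor of one [b_j] given the scales. As the inverse of 0 is 0, it is
    at least [zeta ^- 2] for all real [t] and [l], so the bounds on the beta weight need no sign
    condition. *)
Definition slab_prec (t l : R) : R := zeta ^- 2 + t ^- 2 * l ^- 2.

Definition slab_sd (t l : R) : R := (Num.sqrt (slab_prec t l))^-1.

Lemma slab_prec_ge t l : zeta ^- 2 <= slab_prec t l.
Proof.
by rewrite lerDl mulr_ge0// invr_ge0 sqr_ge0.
Qed.

Let zeta2_gt0 : 0 < zeta ^- 2. Proof. by rewrite invr_gt0 exprn_gt0. Qed.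

Let prec_gt0 t l : 0 < slab_prec t l.
Proof. exact: lt_le_trans (slab_prec_ge t l). Qed.

Lemma slab_sd_gt0 t l : 0 < slab_sd t l.
Proof. by rewrite invr_gt0 sqrtr_gt0 prec_gt0. Qed.

Lemma slab_sd_le t l : slab_sd t l <= zeta.
Proof.
rewrite /slab_sd -[leRHS]invrK lef_pV2 ?posrE ?invr_gt0 ?sqrtr_gt0 ?prec_gt0//.
rewrite -[leLHS]gtr0_norm ?invr_gt0// -sqrtr_sqr ler_wsqrtr// exprVn.
exact: slab_prec_ge.
Qed.

Lemma slab_sd_sqr t l : slab_sd t l ^- 2 = slab_prec t l.
Proof. by rewrite /slab_sd exprVn invrK sqr_sqrtr// ltW// prec_gt0. Qed.

Lemma beta_weightE t (l b : p.-tuple R) :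
  beta_weight X y zeta t l b = lik b * \prod_(j < p) gaussian (slab_sd t (tnth l j)) (tnth b j).
Proof.
by rewrite /beta_weight; congr (_ * _); apply: eq_bigr => j _; rewrite /gaussian slab_sd_sqr.
Qed.

Let gprod t (l b : p.-tuple R) :=
  (\prod_(j < p) (gaussian (slab_sd t (tnth l j)) (tnth b j))%:E)%E.

Let mgau s : measurable_fun setT (fun x : R => (gaussian s x)%:E).
Proof. by apply/measurable_EFinP; exact: measurable_gaussian. Qed.

Let gau0 s (x : R) : (0 <= (gaussian s x)%:E)%E.
Proof. by rewrite lee_fin gaussian_ge0. Qed.

Let weight_le t (l b : p.-tuple R) : ((beta_weight X y zeta t l b)%:E <= gprod t l b)%E.
Proof.
rewrite beta_weightE /gprod prodEFin lee_fin ler_piMl ?likelihood_le1//.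
by apply: prodr_ge0 => j _; exact: gaussian_ge0.
Qed.

Let mgprod t (l : p.-tuple R) : measurable_fun setT (gprod t l : Rp -> \bar R).
Proof.
by apply: emeasurable_prod => j; apply: (@measurable_coord _ _ (fun x => (gaussian _ x)%:E)).
Qed.

Lemma measurable_beta_weight1 t (l : p.-tuple R) :
  measurable_fun setT (fun b : Rp => (beta_weight X y zeta t l b)%:E).
Proof.
apply/measurable_EFinP.
pose x0 : state * Rm * Rp :=
  ((nseq_tuple p (0 : Rm), nseq_tuple p (0 : Rm), (0 : Rm)), (t : Rm), (l : Rp)).
exact: (measurableT_comp (@measurable_beta_weight R n p X y zeta) (pair1_measurable x0)).
Qed.

Lemma integral_beta_weight_le t (l : p.-tuple R) :
  (\int[tuple_lebesgue R p]_b (beta_weight X y zeta t l b)%:E <=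
   (\prod_(j < p) (sqrt2pi R * slab_sd t (tnth l j)))%:E)%E.
Proof.
apply: (@le_trans _ _ (\int[tuple_lebesgue R p]_b gprod t l b)%E).
  apply: ge0_le_integral => //.
  - by move=> b _; rewrite lee_fin beta_weight_ge0.
  - exact: measurable_beta_weight1.
rewrite (@integral_tuple_prod _ _ (fun j x => (gaussian (slab_sd t (tnth l j)) x)%:E))//.
rewrite -prodEFin; apply: lee_prod => j _; rewrite integral_gaussian ?slab_sd_gt0//.
by rewrite lexx lee_fin mulr_ge0// ltW// ?sqrt2pi_gt0 ?slab_sd_gt0.
Qed.

(** Bounding the likelihood by 1 leaves a product over the coordinates: the [i]-th factor is the
    singular Gaussian integral, the others are full Gaussian masses. *)
Lemma integral_inv_sqrt_beta_weight_le t (l : p.-tuple R) i :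
  (\int[tuple_lebesgue R p]_b (inv_sqrt (tnth b i) * (beta_weight X y zeta t l b)%:E) <=
   ((4 + sqrt2pi R) * Num.sqrt (slab_sd t (tnth l i)) *
     \prod_(j < p | j != i) (sqrt2pi R * slab_sd t (tnth l j)))%:E)%E.
Proof.
pose f j (x : R) := ((if j == i then inv_sqrt x else 1) * (gaussian (slab_sd t (tnth l j)) x)%:E)%E.
have f0 j x : (0 <= f j x)%E.
  by rewrite /f mule_ge0//; case: ifP => // _; exact: inv_sqrt_ge0.
have mf j : measurable_fun setT (f j).
  apply: emeasurable_funM => //; case: eqP => _; last exact: measurable_cst.
  exact: measurable_inv_sqrt.
apply: (@le_trans _ _ (\int[tuple_lebesgue R p]_b \prod_(j < p) f j (tnth b j))%E).
  apply: ge0_le_integral => //.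
  - by move=> b _; rewrite mule_ge0 ?inv_sqrt_ge0// lee_fin beta_weight_ge0.
  - apply: emeasurable_funM; last exact: measurable_beta_weight1.
    by apply: measurable_coord; exact: measurable_inv_sqrt.
  - by apply: emeasurable_prod => j; apply: measurable_coord.
  move=> b _; have -> : (\prod_(j < p) f j (tnth b j) = inv_sqrt (tnth b i) * gprod t l b)%E.
    rewrite (bigD1 i)//= /gprod [in RHS](bigD1 i)//= /f eqxx muleA; congr (_ * _)%E.
    by apply: eq_bigr => j /negbTE ->; rewrite mul1e.
  by apply: lee_pmul; rewrite ?lexx ?inv_sqrt_ge0 ?weight_le// lee_fin beta_weight_ge0.
rewrite (@integral_tuple_prod _ _ f)// (bigD1 i)//= EFinM; apply: lee_pmul.
- by apply: integral_ge0.
- by apply: prode_ge0 => j _; apply: integral_ge0.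
- rewrite /f eqxx; apply: integral_inv_sqrt_gaussian; exact: slab_sd_gt0.
rewrite -prodEFin; apply: lee_prod => j /negbTE ji; rewrite /f ji.
under eq_integral do rewrite mul1e.
rewrite integral_gaussian ?slab_sd_gt0// lexx lee_fin mulr_ge0// ltW//.
  exact: sqrt2pi_gt0.
exact: slab_sd_gt0.
Qed.

(** Restrict to [|b_j| <= slab_sd], where each Gaussian factor keeps a fixed fraction of its mass.
    As [slab_sd <= zeta], all these boxes lie in a single one, so the likelihood bound, hence [L],
    does not depend on the scales. *)
Lemma integral_beta_weight_ge : exists2 L : R, 0 < L & forall t (l : p.-tuple R),
  ((L * \prod_(j < p) slab_sd t (tnth l j))%:E <=
   \int[tuple_lebesgue R p]_b (beta_weight X y zeta t l b)%:E)%E.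
Proof.
have [L0 L0_gt0 hL] := likelihood_lb X y zeta.
pose k : R := 2 * expR (- 2^-1).
have k0 : 0 < k by rewrite mulr_gt0// expR_gt0.
exists (L0 * k ^+ p); first by rewrite mulr_gt0// exprn_gt0.
move=> t l; set s := fun j => slab_sd t (tnth l j).
pose f j (x : R) := ((gaussian (s j) x)%:E * (\1_(`[- s j, s j]%classic : set R) x)%:E)%E.
have f0 j x : (0 <= f j x)%E by rewrite /f mule_ge0// lee_fin.
have mf j : measurable_fun setT (f j).
  by apply: emeasurable_funM => //; apply/measurable_EFinP; exact: measurable_indic.
apply: (@le_trans _ _ (L0%:E * \int[tuple_lebesgue R p]_b \prod_(j < p) f j (tnth b j))%E).
  rewrite (@integral_tuple_prod _ _ f)// -mulrA EFinM; apply: lee_pmul; rewrite ?lexx//.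
  - by rewrite lee_fin ltW.
  - rewrite lee_fin ltW// mulr_gt0 ?exprn_gt0// prodr_gt0// => j _; exact: slab_sd_gt0.
  rewrite -[X in k ^+ X]card_ord -prodr_const -big_split/= -prodEFin.
  apply: lee_prod => j _; rewrite lee_fin mulr_ge0 ?(ltW k0) ?(ltW (slab_sd_gt0 _ _))//=.
  apply: le_trans (integral_gaussian_itv (slab_sd_gt0 t (tnth l j))) _.
  rewrite integral_mkcond le_eqVlt; apply/orP; left; apply/eqP.
  apply: eq_integral => x _; rewrite /f patchE indicE.
  by case: ifPn => _; rewrite ?mule1 ?mule0.
rewrite -ge0_integralZl_EFin ?(ltW L0_gt0)//; last 2 first.
- by move=> b _; apply: prode_ge0.
- by apply: emeasurable_prod => j; apply: measurable_coord.
apply: ge0_le_integral => //.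
- by move=> b _; rewrite mule_ge0 ?lee_fin ?(ltW L0_gt0)//; apply: prode_ge0.
- by apply: measurable_funeM; apply: emeasurable_prod => j; apply: measurable_coord.
- exact: measurable_beta_weight1.
move=> b _; rewrite beta_weightE.
have [bs|/existsNP[j /negP bs]] := pselect (forall j, `|tnth b j| <= s j).
  rewrite EFinM; apply: lee_pmul; rewrite ?lee_fin ?(ltW L0_gt0)//.
  - by apply: prode_ge0.
  - by apply: hL => j; apply: le_trans (bs j) _; exact: slab_sd_le.
  rewrite -prodEFin; apply: lee_prod => j _; rewrite f0/= /f.
  by rewrite -[leRHS]mule1; apply: lee_pmul => //; rewrite lee_fin indicE lern1 leq_b1.
rewrite (bigD1 j)//= /f indicE memNset ?mule0 ?mul0e ?mule0 ?lee_fin; last first.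
  by rewrite /= in_itv/= -ler_norml; exact/negP.
by rewrite mulr_ge0 ?likelihood_ge0// prodr_ge0// => i _; exact: gaussian_ge0.
Qed.

End beta_update.

(** * Moments and minorization of the draw of beta *)

Section beta_kernel_bounds.
Context {R : realType} (n p : nat).
Variables (X : 'M[R]_(n, p)) (y : 'I_n -> bool) (zeta : R).
Hypothesis zeta_gt0 : 0 < zeta.
Local Notation Rm := (measurableTypeR R).
Local Notation Rp := (p.-tuple (measurableTypeR R)).
Local Notation state := (gibbs_state R p).
Local Notation Z t l := (\int[tuple_lebesgue R p]_b (beta_weight X y zeta t l b)%:E)%E.

Lemma beta_weight_mass t (l : p.-tuple R) : (0 < Z t l < +oo)%E.
Proof.
have [L L0 hL] := integral_beta_weight_ge X y zeta_gt0.
apply/andP; split; last first.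
  by apply: le_lt_trans (integral_beta_weight_le X y zeta_gt0 t l) _; exact: ltry.
apply: lt_le_trans (hL t l); rewrite lte_fin mulr_gt0// prodr_gt0// => j _.
exact: slab_sd_gt0.
Qed.

Lemma integral_beta_kernel (x : state * Rm * Rp) (h : Rp -> \bar R) :
  (forall b, 0 <= h b)%E -> measurable_fun setT h ->
  (\int[beta_kernel X y zeta x]_b h b =
   ((fine (Z x.1.2 x.2))^-1)%:E *
   \int[tuple_lebesgue R p]_b (h b * (beta_weight X y zeta x.1.2 x.2 b)%:E))%E.
Proof.
move=> h0 mh; rewrite /beta_kernel integral_knormalize_density//.
exact: beta_weight_mass.
Qed.

(** The left side is the fourth root of the precision, and a fourth root is subadditive:
    [u ^+ 4 + w ^+ 4 <= (u + w) ^+ 4] with [u = zeta ^ (-1/2)] and [w = (tmin * |l|) ^ (-1/2)]. *)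
Lemma inv_sqrt_slab_sd (tmin t l : R) : 0 < tmin -> tmin <= t ->
  (((Num.sqrt (slab_sd zeta t l))^-1)%:E <=
   ((Num.sqrt zeta)^-1)%:E + ((Num.sqrt tmin)^-1)%:E * inv_sqrt l)%E.
Proof.
move=> tmin0 tt; have t0 : 0 < t by exact: lt_le_trans tt.
rewrite /inv_sqrt; case: eqVneq => [_|l0].
  by rewrite gt0_muley ?addey ?leey// lte_fin invr_gt0 sqrtr_gt0.
rewrite -EFinM -EFinD lee_fin /slab_sd sqrtrV ?sqrtr_ge0// invrK.
set u := (Num.sqrt zeta)^-1; set a := (Num.sqrt tmin)^-1; set b := (Num.sqrt `|l|)^-1.
have a0 : 0 <= a by rewrite invr_ge0 sqrtr_ge0.
have b0 : 0 <= b by rewrite invr_ge0 sqrtr_ge0.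
have u0 : 0 <= u by rewrite invr_ge0 sqrtr_ge0.
have u2 : u ^+ 2 = zeta^-1 by rewrite exprVn sqr_sqrtr// ltW.
have a2 : a ^+ 2 = tmin^-1 by rewrite exprVn sqr_sqrtr// ltW.
have b2 : b ^+ 2 = `|l|^-1 by rewrite exprVn sqr_sqrtr.
have uab : 0 <= u + a * b by rewrite addr_ge0// mulr_ge0.
rewrite -[leRHS]ger0_norm// -sqrtr_sqr ler_wsqrtr//.
rewrite -[leRHS]ger0_norm ?sqr_ge0// -sqrtr_sqr ler_wsqrtr// /slab_prec.
have h1 : t ^- 2 * l ^- 2 <= (a * b) ^+ 4.
  rewrite exprMn (_ : a ^+ 4 = (a ^+ 2) ^+ 2) -?exprM// (_ : b ^+ 4 = (b ^+ 2) ^+ 2) -?exprM//.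
  rewrite !exprM a2 b2 exprVn exprVn real_normK ?num_real// ler_wpM2r ?invr_ge0 ?sqr_ge0//.
  by rewrite lef_pV2 ?posrE ?exprn_gt0// ler_sqr ?nnegrE// ltW.
have h2 : zeta ^- 2 = u ^+ 4 by rewrite -exprVn -u2 -exprM.
rewrite h2; apply: (@le_trans _ _ (u ^+ 4 + (a * b) ^+ 4)); first by rewrite lerD2l.
have : 0 <= a * b by exact: mulr_ge0.
move: (a * b) => w w0; rewrite -exprM.
have := mulr_ge0 u0 w0; have := mulr_ge0 (mulr_ge0 u0 w0) (sqr_ge0 (u + w)).
have := mulr_ge0 (mulr_ge0 u0 w0) (mulr_ge0 u0 w0).
have := mulr_ge0 (mulr_ge0 u0 w0) (sqr_ge0 u).
have := mulr_ge0 (mulr_ge0 u0 w0) (sqr_ge0 w).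
rewrite !exprS !expr0 => *; nra.
Qed.

(** In the quotient of the upper bound on the moment by the lower bound on the mass, the factors
    [s j] with [j != i] cancel; what remains is [k * sqrt (s i) / s i = k / sqrt (s i)]. *)
Lemma beta_kernel_sum_inv_sqrt (tmin : R) : 0 < tmin ->
  exists C0 C1 : R, [/\ 0 <= C0, 0 < C1 & forall x : state * Rm * Rp, tmin <= x.1.2 :> R ->
    (\int[beta_kernel X y zeta x]_b sum_inv_sqrt b <=
     C0%:E + C1%:E * sum_inv_sqrt x.2)%E].
Proof.
move=> tmin0.
have [L L0 hL] := integral_beta_weight_ge X y zeta_gt0.
have c0 := sqrt2pi_gt0 R.
pose k := (4 + sqrt2pi R) * sqrt2pi R ^+ p.-1 / L.
have k0 : 0 < k by rewrite divr_gt0// mulr_gt0 ?exprn_gt0// addr_gt0.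
have one (x : state * Rm * Rp) i : tmin <= x.1.2 :> R ->
    (\int[beta_kernel X y zeta x]_b inv_sqrt (tnth b i) <=
     (k / Num.sqrt zeta)%:E + (k / Num.sqrt tmin)%:E * inv_sqrt (tnth x.2 i))%E.
  move=> tx; set t := x.1.2; set l := x.2.
  rewrite integral_beta_kernel//; last 2 first.
  - by move=> b; exact: inv_sqrt_ge0.
  - by apply: measurable_coord; exact: measurable_inv_sqrt.
  rewrite -/t -/l; have /andP[Z0 Zoo] := beta_weight_mass t l.
  set s := fun j => slab_sd zeta t (tnth l j).
  have s0 j : 0 < s j by exact: slab_sd_gt0.
  have ZE : Z t l = (fine (Z t l))%:E by rewrite fineK// ge0_fin_numE// ltW.
  have fZ0 : 0 < fine (Z t l) by rewrite -lte_fin -ZE.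
  have ZL : L * \prod_(j < p) s j <= fine (Z t l) by rewrite -lee_fin -ZE; exact: hL.
  apply: (@le_trans _ _ (k%:E * ((Num.sqrt (s i))^-1)%:E)%E); last first.
    have -> : ((k / Num.sqrt zeta)%:E + (k / Num.sqrt tmin)%:E * inv_sqrt (tnth l i) =
      k%:E * (((Num.sqrt zeta)^-1)%:E + ((Num.sqrt tmin)^-1)%:E * inv_sqrt (tnth l i)))%E.
      rewrite ge0_muleDr ?muleA -?EFinM// ?lee_fin ?invr_ge0 ?sqrtr_ge0//.
      by rewrite mule_ge0 ?inv_sqrt_ge0// lee_fin invr_ge0 sqrtr_ge0.
    apply: lee_pmul => //; rewrite ?lee_fin ?invr_ge0 ?sqrtr_ge0 ?(ltW k0)//.
    exact: inv_sqrt_slab_sd.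
  apply: (@le_trans _ _ (((fine (Z t l))^-1)%:E * ((4 + sqrt2pi R) * Num.sqrt (s i) *
     \prod_(j < p | j != i) (sqrt2pi R * s j))%:E)%E).
    apply: lee_pmul => //; first by rewrite lee_fin invr_ge0 ltW.
      apply: integral_ge0 => b _; rewrite mule_ge0 ?inv_sqrt_ge0// lee_fin.
      exact: beta_weight_ge0.
    exact: integral_inv_sqrt_beta_weight_le.
  rewrite -!EFinM lee_fin.
  have P0 : 0 < \prod_(j < p | j != i) s j by exact: prodr_gt0.
  have PE : \prod_(j < p | j != i) (sqrt2pi R * s j) =
      sqrt2pi R ^+ p.-1 * \prod_(j < p | j != i) s j.
    rewrite big_split/= prodr_const; congr (_ ^+ _ * _).
    by rewrite cardC1 card_ord.
  have sq : Num.sqrt (s i) * Num.sqrt (s i) = s i by rewrite -expr2 sqr_sqrtr// ltW.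
  have sq0 : 0 < Num.sqrt (s i) by rewrite sqrtr_gt0.
  rewrite mulrC ler_pdivrMr// PE.
  apply: (@le_trans _ _ (k / Num.sqrt (s i) * (L * \prod_(j < p) s j))); last first.
    by rewrite ler_pM2l// divr_gt0.
  rewrite le_eqVlt; apply/orP; left; apply/eqP.
  rewrite [\prod_(j < p) s j](bigD1 i)//= /k.
  move: (Num.sqrt (s i)) sq sq0 => q <- q0; field.
  by rewrite !gt_eqF.
exists (p%:R * (k / Num.sqrt zeta)), (k / Num.sqrt tmin); split.
- by rewrite mulr_ge0// divr_ge0 ?sqrtr_ge0// ltW.
- by rewrite divr_gt0// sqrtr_gt0.
move=> x tx; rewrite ge0_integral_sum//; last 2 first.
- by move=> j; apply: measurable_coord; exact: measurable_inv_sqrt.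
- by move=> j b _; exact: inv_sqrt_ge0.
apply: (@le_trans _ _ (\sum_(j < p) ((k / Num.sqrt zeta)%:E +
    (k / Num.sqrt tmin)%:E * inv_sqrt (tnth x.2 j)))%E).
  by apply: lee_sum => j _; exact: one.
rewrite big_split/= sumr_const card_ord -ge0_sume_distrr; last first.
  by move=> j _; exact: inv_sqrt_ge0.
by rewrite leeD2r// -[_ *+ p]EFin_natmul mulr_natl.
Qed.

(** The bound on [sum_inv_sqrt] forces [|l_j| >= r ^- 2], so the precisions are at most [a], and on
    the box each Gaussian factor is at least [m] and the likelihood at least [L]. The normalizing
    constant is at most [c ^+ p], because the standard deviations do not exceed [zeta]. *)
Lemma beta_kernel_ge (tmin r : R) : 0 < tmin -> 0 < r ->
  exists2 e : R, 0 < e & forall (x : state * Rm * Rp) (h : Rp -> \bar R),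
    tmin <= x.1.2 :> R -> (sum_inv_sqrt x.2 <= r%:E)%E ->
    (forall b, 0 <= h b)%E -> measurable_fun setT h ->
    (e%:E * \int[tuple_lebesgue R p]_b
        (h b * \prod_(j < p) (\1_(`[- zeta, zeta]%classic : set R) (tnth b j))%:E) <=
     \int[beta_kernel X y zeta x]_b h b)%E.
Proof.
move=> tmin0 r0.
have [L L0 hL] := likelihood_lb X y zeta.
pose a := zeta ^- 2 + tmin ^- 2 * r ^+ 4.
pose m := expR (- (2^-1 * a * zeta ^+ 2)).
pose c := sqrt2pi R * zeta.
have c0 : 0 < c by rewrite mulr_gt0// sqrt2pi_gt0.
exists (L * m ^+ p / c ^+ p).
  by rewrite divr_gt0 ?mulr_gt0 ?exprn_gt0// expR_gt0.
move=> x h tx xr h0 mh; set t := x.1.2; set l := x.2.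
have t0 : 0 < t by exact: lt_le_trans tx.
rewrite integral_beta_kernel// -/t -/l.
have /andP[Z0 Zoo] := beta_weight_mass t l.
have ZE : Z t l = (fine (Z t l))%:E by rewrite fineK// ge0_fin_numE// ltW.
have fZ0 : 0 < fine (Z t l) by rewrite -lte_fin -ZE.
have Zc : fine (Z t l) <= c ^+ p.
  rewrite -lee_fin -ZE; apply: le_trans (integral_beta_weight_le X y zeta_gt0 t l) _.
  rewrite lee_fin -[X in c ^+ X]card_ord -prodr_const; apply: ler_prod => j _.
  rewrite ler_pM2l ?sqrt2pi_gt0// slab_sd_le// andbT.
  by rewrite mulr_ge0// ltW ?sqrt2pi_gt0// slab_sd_gt0.
pose ind (b : Rp) : \bar R := (\prod_(j < p) (\1_(`[- zeta, zeta]%classic : set R) (tnth b j))%:E)%E.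
have ind0 b : (0 <= ind b)%E by apply: prode_ge0 => j _; rewrite lee_fin.
have mind : measurable_fun setT ind.
  apply: emeasurable_prod => j; apply: (@measurable_coord _ _ (fun x => (\1_(`[- zeta, zeta]%classic : set R) x)%:E)).
  by apply/measurable_EFinP; exact: measurable_indic.
rewrite -[X in (_ * X <= _)%E]/(\int[tuple_lebesgue R p]_b (h b * ind b))%E.
rewrite mulrC EFinM -muleA; apply: lee_pmul.
- by rewrite lee_fin invr_ge0 exprn_ge0// ltW.
- rewrite mule_ge0// ?lee_fin ?mulr_ge0 ?exprn_ge0 ?expR_ge0 ?(ltW L0)//.
  by apply: integral_ge0 => b _; rewrite mule_ge0.
- by rewrite lee_fin lef_pV2 ?posrE// exprn_gt0.
have k0 : 0 <= L * m ^+ p by rewrite mulr_ge0 ?exprn_ge0 ?expR_ge0 ?ltW.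
rewrite -ge0_integralZl_EFin//; last 2 first.
- by move=> b _; rewrite mule_ge0.
- exact: emeasurable_funM.
apply: ge0_le_integral => //.
- by move=> b _; rewrite !mule_ge0.
- by apply: measurable_funeM; exact: emeasurable_funM.
- by apply: emeasurable_funM => //; exact: measurable_beta_weight1.
move=> b _; rewrite muleCA; apply: lee_pmul => //; first by rewrite mule_ge0.
rewrite beta_weightE//.
have [bz|/existsNP[j /negP bz]] := pselect (forall j, `|tnth b j| <= zeta); last first.
  rewrite /ind (bigD1 j)//= indicE memNset ?mul0e ?mule0; last first.
    by rewrite /= in_itv/= -ler_norml; exact/negP.
  by rewrite lee_fin mulr_ge0 ?likelihood_ge0// prodr_ge0// => i _; exact: gaussian_ge0.
apply: (@le_trans _ _ (L * m ^+ p)%:E).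
  rewrite -[leRHS]mule1; apply: lee_pmul => //.
  rewrite /ind prodEFin lee_fin prodr_ile1// => j _.
  by rewrite indicE ler0n lern1 leq_b1.
rewrite lee_fin; apply: ler_pM; rewrite ?exprn_ge0 ?expR_ge0 ?(ltW L0)//.
  exact: hL.
rewrite -[X in m ^+ X]card_ord -prodr_const; apply: ler_prod => j _.
rewrite expR_ge0/= ler_expR lerN2 slab_sd_sqr//.
have hl : slab_prec zeta t (tnth l j) <= a.
  rewrite lerD2l.
  have lr : r ^- 2 <= `|tnth l j|.
    by apply: inv_sqrt_le_norm => //; apply: le_trans xr; exact: inv_sqrt_le_sum.
  apply: ler_pM; rewrite ?invr_ge0 ?sqr_ge0//.
    by rewrite lef_pV2 ?posrE ?exprn_gt0// ler_sqr ?nnegrE// ltW.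
  have -> : r ^+ 4 = ((r ^- 2) ^+ 2)^-1 by rewrite exprVn -exprM invrK.
  have rr : 0 < r ^- 2 by rewrite invr_gt0 exprn_gt0.
  have ll : 0 < `|tnth l j| by exact: lt_le_trans lr.
  rewrite -[tnth l j ^+ 2]real_normK ?num_real//.
  by rewrite lef_pV2 ?posrE ?exprn_gt0// ler_sqr ?nnegrE// ltW.
have p0 : 0 <= slab_prec zeta t (tnth l j).
  by apply: le_trans (slab_prec_ge zeta t _); rewrite invr_ge0 sqr_ge0.
apply: ler_pM; rewrite ?sqr_ge0 ?mulr_ge0//.
  by rewrite ler_pM2l.
by rewrite -[leLHS]real_normK ?num_real// ler_sqr ?nnegrE ?(ltW zeta_gt0)//.
Qed.

End beta_kernel_bounds.

(** * Update of lambda *)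

Lemma ge0_integral_le_lincomb d (T : measurableType d) (R : realType)
    (mu : {measure set T -> \bar R}) (A B : R) (f g h : T -> \bar R) :
  0 <= A -> 0 <= B -> (forall x, 0 <= f x)%E -> (forall x, 0 <= g x)%E ->
  (forall x, 0 <= h x)%E -> measurable_fun setT f -> measurable_fun setT g ->
  measurable_fun setT h -> (forall x, h x <= A%:E * f x + B%:E * g x)%E ->
  (\int[mu]_x h x <= A%:E * \int[mu]_x f x + B%:E * \int[mu]_x g x)%E.
Proof.
move=> A0 B0 f0 g0 h0 mf mg mh hfg.
rewrite -!ge0_integralZl_EFin// -ge0_integralD//; last 4 first.
- by move=> x _; rewrite mule_ge0.
- exact: measurable_funeM.
- by move=> x _; rewrite mule_ge0.
- exact: measurable_funeM.
apply: ge0_le_integral => //.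
by apply: emeasurable_funD; exact: measurable_funeM.
Qed.

Section scale_posterior.
Context {R : realType} (piloc : scale_density R).
Hypothesis piloc_bounded : (scale_sup piloc < +oo)%E.
Local Notation mu := (@lebesgue_measure R).

(** The density on the whole line: values of [piloc] outside []0, +oo[] are arbitrary and must be
    replaced by 0. *)
Definition scale_ext (l : R) : R := if 0 < l then piloc l else 0.

Lemma scale_ext_ge0 l : 0 <= scale_ext l.
Proof. by rewrite /scale_ext; case: ifPn => // l0; exact: scale_fun_ge0. Qed.

Lemma measurable_scale_ext : measurable_fun setT scale_ext.
Proof.
rewrite (_ : scale_ext = piloc \_ `]0, +oo[).
  by apply/(measurable_restrictT _ _).1 => //; exact: measurable_scale_fun.
apply/funext => x; rewrite /scale_ext patchE; case: ifPn => x0.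
  by rewrite mem_set//= in_itv/= x0.
by rewrite memNset//= in_itv/= (negbTE x0).
Qed.

Lemma scale_ext_bound : exists2 M : R, 0 < M & forall l, scale_ext l <= M.
Proof.
have le1 (l : R) : 0 < l -> ((piloc l)%:E <= scale_sup piloc)%E.
  by move=> l0; apply: ereal_sup_ubound; exists l => //=; rewrite in_itv/= l0.
have f : scale_sup piloc \is a fin_num.
  rewrite fin_numElt piloc_bounded andbT; apply: lt_le_trans (le1 1 ltr01).
  exact: ltNyr.
exists (`|fine (scale_sup piloc)| + 1); first by rewrite ltr_wpDl.
move=> l; rewrite /scale_ext; case: ifPn => l0; last by rewrite addr_ge0.
have := le1 l l0; rewrite -[X in (_ <= X)%E]fineK// lee_fin => h.
by apply: (le_trans h); apply: (le_trans (ler_norm _)); rewrite lerDl.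
Qed.

(** The parameter [c] stands for [|b| / t], through which alone the lambda weight depends on [b] and
    [t]. *)
Definition scale_weight (c l : R) : R := l^-1 * expR (- (2^-1 * (c / l) ^+ 2)) * scale_ext l.

Lemma scale_weight_ge0 c l : 0 <= scale_weight c l.
Proof.
rewrite /scale_weight /scale_ext; case: ifPn => l0; last by rewrite mulr0.
by rewrite !mulr_ge0 ?expR_ge0 ?scale_fun_ge0// invr_ge0 ltW.
Qed.

Lemma measurable_scale_weight c : measurable_fun setT (scale_weight c).
Proof.
apply: measurable_funM; last exact: measurable_scale_ext.
apply: measurable_funM; first exact: measurable_invr.
apply: measurableT_comp => //; apply: measurableT_comp => //.
apply: measurable_funM => //; apply: measurable_funX; apply: measurable_funM => //.
exact: measurable_invr.
Qed.

Lemma lambda_weightE b t l : 0 < t ->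
  lambda_weight piloc b t l = scale_weight (`|b| / t) l.
Proof.
move=> t0; rewrite /lambda_weight /scale_weight /scale_ext; case: ifPn => l0; last by rewrite mulr0.
congr (_ * expR (- _) * _); rewrite !exprMn real_normK ?num_real//.
by field; rewrite !gt_eqF.
Qed.

(** The normalizing constant of one scale; [scale_moment c / scale_mass c] is then the posterior
    mean of [l ^ (-1/2)], and the point is its growth as [c] tends to 0. *)
Definition scale_mass c : \bar R := (\int[mu]_l (scale_weight c l)%:E)%E.

Definition scale_moment c : \bar R := (\int[mu]_l (inv_sqrt l * (scale_weight c l)%:E))%E.

Let mpi : measurable_fun setT (fun l => (scale_ext l)%:E).
Proof. by apply/measurable_EFinP; exact: measurable_scale_ext. Qed.

Let mw c : measurable_fun setT (fun l => (scale_weight c l)%:E).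
Proof. by apply/measurable_EFinP; exact: measurable_scale_weight. Qed.

Let w0 c (l : R) : (0 <= (scale_weight c l)%:E)%E.
Proof. by rewrite lee_fin scale_weight_ge0. Qed.

Let pi0 (l : R) : (0 <= (scale_ext l)%:E)%E.
Proof. by rewrite lee_fin scale_ext_ge0. Qed.

Lemma integral_scale_ext : (\int[mu]_l (scale_ext l)%:E = 1)%E.
Proof.
rewrite -(scale_fun_int1 piloc) [RHS]integral_mkcond; apply: eq_integral => l _.
rewrite patchE /scale_ext; case: ifPn => l0.
  by rewrite mem_set//= in_itv/= l0.
by rewrite memNset//= in_itv/= (negbTE l0).
Qed.

Let expR_ge1Dhalf (u : R) : 1 + 2^-1 * u ^+ 2 <= expR (2^-1 * u ^+ 2).
Proof. by rewrite expR_ge1Dx. Qed.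

(** The common source of the bounds on powers of [u] below: [expR (2^-1 * u ^+ 2)] is at least
    [1 + 2^-1 * u ^+ 2]. *)
Let expN_le (u x : R) : 0 <= x -> x <= 1 + 2^-1 * u ^+ 2 -> x * expR (- (2^-1 * u ^+ 2)) <= 1.
Proof.
move=> x0 xu; rewrite expRN ler_pdivrMr ?expR_gt0// mul1r.
exact: le_trans (expR_ge1Dhalf u).
Qed.

Let u_exp (u : R) : 0 <= u -> u * expR (- (2^-1 * u ^+ 2)) <= 1.
Proof. by move=> u0; apply: expN_le => //; have := sqr_ge0 (u - 1); rewrite sqrrB1; lra. Qed.

Let sqrt_le1D (u : R) : 0 <= u -> Num.sqrt u <= (1 + u) / 2.
Proof.
move=> u0; have := sqr_ge0 (Num.sqrt u - 1); rewrite sqrrB1 sqr_sqrtr//; lra.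
Qed.

Let sqrt_exp (u : R) : 0 <= u -> Num.sqrt u * expR (- (2^-1 * u ^+ 2)) <= 1.
Proof.
move=> u0; apply: expN_le; first exact: sqrtr_ge0.
apply: le_trans (sqrt_le1D u0) _.
by have := sqr_ge0 (u - 1); rewrite sqrrB1; lra.
Qed.

Let usqrt_exp (u : R) : 0 <= u -> u * Num.sqrt u * expR (- (2^-1 * u ^+ 2)) <= 2.
Proof.
move=> u0.
have : 2^-1 * (u * Num.sqrt u) * expR (- (2^-1 * u ^+ 2)) <= 1.
  apply: expN_le; first by rewrite !mulr_ge0// sqrtr_ge0.
  have := ler_wpM2l u0 (sqrt_le1D u0).
  by have := sqr_ge0 (u - 1); rewrite sqrrB1; lra.
lra.
Qed.

Let sqrt_divE (c l : R) : 0 < c -> 0 < l -> (Num.sqrt l)^-1 = (Num.sqrt c)^-1 * Num.sqrt (c / l).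
Proof.
move=> c0 l0; rewrite sqrtrM ?ltW// mulKf ?gt_eqF ?sqrtr_gt0//.
by rewrite sqrtrV// ltW.
Qed.

(** With [u = c / l], one has [l^-1 = c^-1 * u], and [u * expR (- (2^-1 * u ^+ 2)) <= 1]. So a
    positive [c] makes the posterior normalizable even if [l^-1] times the prior is not
    integrable. *)
Lemma scale_weight_le c l : 0 < c -> scale_weight c l <= c^-1 * scale_ext l.
Proof.
move=> c0; rewrite /scale_weight /scale_ext; case: ifPn => l0; last by rewrite !mulr0.
rewrite ler_wpM2r ?scale_fun_ge0//.
have u0 : 0 <= c / l by rewrite divr_ge0 ?ltW.
have lE : l^-1 = c^-1 * (c / l) by rewrite mulKf ?gt_eqF.
by rewrite {1}lE -mulrA -[leRHS]mulr1 ler_pM2l ?invr_gt0// u_exp.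
Qed.

Lemma scale_mass_lty c : 0 < c -> (scale_mass c < +oo)%E.
Proof.
move=> c0; apply: (@le_lt_trans _ _ (c^-1)%:E); last exact: ltry.
rewrite -[leRHS]mule1 -integral_scale_ext -ge0_integralZl_EFin//; last first.
  by rewrite invr_ge0 ltW.
apply: ge0_le_integral => //.
- exact: mw.
- by apply: measurable_funeM; exact: mpi.
by move=> l _; rewrite -EFinM lee_fin scale_weight_le.
Qed.

(* Splitting at [l = c / k]: the function [u |-> sqrt u * exp (- u^2 / 2)] of
   [u = c / l] is at most [1]. *)
Lemma inv_sqrt_scale_weight_le1 c k l : 0 < c -> 0 < k ->
  (inv_sqrt l * (scale_weight c l)%:E <=
   (Num.sqrt k / Num.sqrt c)%:E * (scale_weight c l)%:E +
   ((Num.sqrt c)^-1)%:E * (l^-1 * scale_ext l * \1_(`]0%R, c / k[%classic : set R) l)%:E)%E.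
Proof.
move=> c0 k0; have [l0|l0] := leP l 0.
  have -> : scale_weight c l = 0 by rewrite /scale_weight /scale_ext ltNge l0 mulr0.
  by rewrite mule0 -!EFinM -EFinD lee_fin /scale_ext ltNge l0/= !(mulr0, mul0r) addr0.
rewrite /inv_sqrt gt_eqF// gtr0_norm// -!EFinM -EFinD lee_fin.
have sc : 0 < Num.sqrt c by rewrite sqrtr_gt0.
have [lk|lk] := ltP l (c / k); last first.
  rewrite ler_wpDr//.
    rewrite mulr_ge0 ?invr_ge0 ?sqrtr_ge0// mulr_ge0// mulr_ge0 ?scale_ext_ge0//.
    by rewrite invr_ge0 ltW.
  rewrite ler_wpM2r ?scale_weight_ge0// (sqrt_divE c0 l0) mulrC ler_pM2r ?invr_gt0//.
  by rewrite ler_wsqrtr// ler_pdivrMr// mulrC -ler_pdivrMr.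
rewrite indicE mem_set/= ?in_itv/= ?l0// mulr1 ler_wpDl//.
  by rewrite mulr_ge0 ?scale_weight_ge0// divr_ge0 ?sqrtr_ge0.
rewrite (sqrt_divE c0 l0) -mulrA ler_pM2l ?invr_gt0//.
rewrite /scale_weight mulrA ler_wpM2r ?scale_ext_ge0// mulrCA -[leRHS]mulr1.
by rewrite ler_pM2l ?invr_gt0// sqrt_exp// divr_ge0 ?ltW.
Qed.

(** Same split, but below [c / k] the factor [l^-1] is also absorbed:
    [l ^ (-3/2) = c ^ (-3/2) * u ^ (3/2)] with [u = c / l], and the exponential tames [u ^ (3/2)].
    The prior is bounded by [M], so what is left is an indicator, whose integral is [c / k]. *)
Lemma inv_sqrt_scale_weight_le2 c k M l : 0 < c -> 0 < k -> (forall l, scale_ext l <= M) ->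
  (inv_sqrt l * (scale_weight c l)%:E <=
   (Num.sqrt k / Num.sqrt c)%:E * (scale_weight c l)%:E +
   (2 * M / (c * Num.sqrt c))%:E * (\1_(`]0%R, c / k[%classic : set R) l)%:E)%E.
Proof.
move=> c0 k0 hM; have M0 : 0 <= M by exact: le_trans (scale_ext_ge0 0) (hM 0).
have sc : 0 < Num.sqrt c by rewrite sqrtr_gt0.
have B0 : 0 <= 2 * M / (c * Num.sqrt c) by rewrite divr_ge0 ?mulr_ge0// ltW.
have [l0|l0] := leP l 0.
  have -> : scale_weight c l = 0 by rewrite /scale_weight /scale_ext ltNge l0 mulr0.
  by rewrite !mule0 add0e mule_ge0.
rewrite /inv_sqrt gt_eqF// gtr0_norm// -!EFinM -EFinD lee_fin.
have [lk|lk] := ltP l (c / k); last first.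
  rewrite ler_wpDr//; first by rewrite mulr_ge0.
  rewrite ler_wpM2r ?scale_weight_ge0// (sqrt_divE c0 l0) mulrC ler_pM2r ?invr_gt0//.
  by rewrite ler_wsqrtr// ler_pdivrMr// mulrC -ler_pdivrMr.
rewrite indicE mem_set/= ?in_itv/= ?l0// mulr1 ler_wpDl//.
  by rewrite mulr_ge0 ?scale_weight_ge0// divr_ge0 ?sqrtr_ge0.
rewrite (sqrt_divE c0 l0) /scale_weight.
have u0 : 0 <= c / l by rewrite divr_ge0 ?ltW.
have lE : l^-1 = c^-1 * (c / l) by rewrite mulKf ?gt_eqF.
rewrite {2}lE; move: (c / l) u0 => u u0.
have -> : (Num.sqrt c)^-1 * Num.sqrt u * (c^-1 * u * expR (- (2^-1 * u ^+ 2)) * scale_ext l) =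
  (c * Num.sqrt c)^-1 * ((u * Num.sqrt u * expR (- (2^-1 * u ^+ 2))) * scale_ext l).
  by rewrite invfM; ring.
rewrite mulrC ler_pM2r ?invr_gt0 ?mulr_gt0//.
by apply: ler_pM; rewrite ?scale_ext_ge0 ?usqrt_exp// !mulr_ge0 ?expR_ge0 ?sqrtr_ge0.
Qed.

(** By monotone convergence, the compact intervals [[1 / n.+1, n.+1]] eventually carry more than
    half of the total mass 1. *)
Lemma scale_ext_window : exists a z v : R, [/\ 0 < a, 0 < z, 0 < v &
  (v%:E <= \int[mu]_(l in `[a, z]) (scale_ext l)%:E)%E].
Proof.
pose F (n : nat) : set R := `[n.+1%:R^-1, n.+1%:R]%classic.
have FE : `]0%R, +oo[%classic = \bigcup_n F n.
  apply/seteqP; split => [x|x [n _]]; rewrite /F /= !in_itv/= ?andbT.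
    move=> x0; exists (maxn (Num.truncn x) (Num.truncn x^-1)) => //=.
    rewrite in_itv/=; apply/andP; split.
      rewrite -[leRHS]invrK lef_pV2 ?posrE ?invr_gt0//.
      by apply/ltW; apply: lt_le_trans (truncnS_gt _) _; rewrite ler_nat ltnS leq_maxr.
    by apply/ltW; apply: lt_le_trans (truncnS_gt _) _; rewrite ler_nat ltnS leq_maxl.
  by move=> /andP[nx _]; apply: lt_le_trans nx; rewrite invr_gt0.
have : (\int[mu]_(x in F n) (scale_ext x)%:E @[n --> \oo] -->
   \int[mu]_(x in \bigcup_i F i) (scale_ext x)%:E)%E.
  apply: ge0_nondecreasing_set_cvg_integral => //.
  - move=> n m nm; apply/subsetPset => x; rewrite /F /= !in_itv/= => /andP[h1 h2].
    apply/andP; split; last by apply: le_trans h2 _; rewrite ler_nat ltnS.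
    by apply: le_trans h1; rewrite lef_pV2 ?posrE// ler_nat ltnS.
  - by move=> n; exact: measurable_itv.
  - by move=> n; exact: measurable_funTS.
rewrite -FE (_ : (\int[mu]_(x in _) _ = 1)%E); last first.
  rewrite -integral_scale_ext integral_mkcond; apply: eq_integral => l _.
  rewrite patchE; case: ifPn => //; rewrite notin_setE/= in_itv/= andbT => /negP l0.
  by rewrite /scale_ext (negbTE l0).
move=> /fine_cvgP[[N1 _ f1]] /cvgrPdist_lt /(_ 2^-1 ltac:(by []))[N2 _ f2].
pose n := maxn N1 N2.
have := f2 n (leq_maxr _ _); have := f1 n (leq_maxl _ _); rewrite /= => fin.
move=> /ltr_normlP[_ h].
exists n.+1%:R^-1, n.+1%:R, 2^-1; split => //.
by rewrite -(fineK fin) lee_fin /= in h *; lra.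
Qed.

(** On the window, [l^-1] is smallest at [z] and the exponential is smallest at [a]. *)
Lemma scale_mass_ge : exists a z v : R, [/\ 0 < a, 0 < z, 0 < v & forall c, 0 < c ->
  ((v / z * expR (- (2^-1 * (c / a) ^+ 2)))%:E <= scale_mass c)%E].
Proof.
have [a [z [v [a0 z0 v0 hv]]]] := scale_ext_window.
exists a, z, v; split => // c c0.
have e0 : 0 <= expR (- (2^-1 * (c / a) ^+ 2)) by exact: expR_ge0.
apply: (@le_trans _ _ (\int[mu]_(l in `[a, z]) (scale_weight c l)%:E)%E); last first.
  by apply: ge0_subset_integral => //; exact: mw.
apply: (@le_trans _ _ ((z^-1 * expR (- (2^-1 * (c / a) ^+ 2)))%:E *
    \int[mu]_(l in `[a, z]) (scale_ext l)%:E)%E).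
  rewrite -mulrA mulrC EFinM; apply: lee_pmul => //.
  - by rewrite lee_fin mulr_ge0// invr_ge0 ltW.
  - by rewrite lee_fin ltW.
rewrite -ge0_integralZl_EFin//; last 2 first.
- exact: measurable_funTS.
- by rewrite mulr_ge0// invr_ge0 ltW.
apply: ge0_le_integral => //.
- by move=> l _; rewrite -EFinM lee_fin mulr_ge0 ?scale_ext_ge0// mulr_ge0// invr_ge0 ltW.
- by apply: measurable_funeM; exact: measurable_funTS.
- by apply: measurable_funTS; exact: mw.
move=> l /=; rewrite in_itv/= => /andP[al lz]; rewrite -EFinM lee_fin.
have l0 : 0 < l by exact: lt_le_trans al.
rewrite ler_wpM2r ?scale_ext_ge0//; apply: ler_pM => //.
- by rewrite invr_ge0 ltW.
- by rewrite lef_pV2.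
rewrite ler_expR lerN2 ler_pM2l// ler_sqr ?nnegrE ?divr_ge0 ?(ltW c0) ?(ltW a0) ?(ltW l0)//.
by rewrite ler_pM2l// lef_pV2.
Qed.

Lemma scale_mass_gt0 c : 0 < c -> (0 < scale_mass c)%E.
Proof.
move=> c0; have [a [z [v [a0 z0 v0 /(_ c c0)]]]] := scale_mass_ge.
by apply: lt_le_trans; rewrite lte_fin mulr_gt0 ?expR_gt0// divr_gt0.
Qed.

Let mmoment c : measurable_fun setT (fun l : R => (inv_sqrt l * (scale_weight c l)%:E)%E).
Proof. by apply: emeasurable_funM => //; exact: measurable_inv_sqrt. Qed.

Let moment0 c (l : R) : (0 <= inv_sqrt l * (scale_weight c l)%:E)%E.
Proof. by rewrite mule_ge0// inv_sqrt_ge0. Qed.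

Let mind (r : R) : measurable_fun setT (fun l : R => (\1_(`]0, r[%classic : set R) l : R)%:E).
Proof. by apply/measurable_EFinP; exact: measurable_indic. Qed.

(** Split at the left end [a] of the window. Above [a], [l ^ (-1/2) <= a ^ (-1/2)]. Below [a], the
    integrand is at most [K * E] times the prior, where [E] is the very exponential of the lower
    bound on the mass; the quotient therefore stays bounded even as [c] tends to [+oo]. *)
Lemma scale_moment_large d : 0 < d -> exists2 C : R, 0 <= C &
  forall c, d <= c -> (scale_moment c <= C%:E * scale_mass c)%E.
Proof.
move=> d0; have [a [z [v [a0 z0 v0 hD]]]] := scale_mass_ge.
have sa : 0 < Num.sqrt a by rewrite sqrtr_gt0.
have sd : 0 < Num.sqrt d by rewrite sqrtr_gt0.
pose K := expR (2^-1 * (d / a) ^+ 2) * (2 / (d * Num.sqrt d)).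
have K0 : 0 <= K by rewrite mulr_ge0 ?expR_ge0// divr_ge0// mulr_ge0// ltW.
have saV : 0 <= (Num.sqrt a)^-1 by rewrite invr_ge0 ltW.
have Kzv : 0 <= K * z / v by rewrite divr_ge0 ?(ltW v0)// mulr_ge0// ltW.
exists ((Num.sqrt a)^-1 + K * z / v); first by rewrite addr_ge0.
move=> c dc; have c0 : 0 < c by exact: lt_le_trans dc.
pose E := expR (- (2^-1 * (c / a) ^+ 2)).
have E0 : 0 <= E by exact: expR_ge0.
have pw (l : R) : (inv_sqrt l * (scale_weight c l)%:E <=
    ((Num.sqrt a)^-1)%:E * (scale_weight c l)%:E + (K * E)%:E * (scale_ext l)%:E)%E.
  have [l0|l0] := leP l 0.
    have -> : scale_weight c l = 0 by rewrite /scale_weight /scale_ext ltNge l0 mulr0.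
    by rewrite !mule0 add0e mule_ge0// lee_fin mulr_ge0.
  rewrite /inv_sqrt gt_eqF// gtr0_norm// -!EFinM -EFinD lee_fin.
  have [al|la] := leP a l.
    rewrite ler_wpDr//; first by rewrite mulr_ge0 ?scale_ext_ge0// mulr_ge0.
    rewrite ler_wpM2r ?scale_weight_ge0// lef_pV2 ?posrE ?sqrtr_gt0//.
    by rewrite ler_wsqrtr.
  rewrite ler_wpDl//; first by rewrite mulr_ge0// scale_weight_ge0.
  rewrite /scale_weight mulrA ler_wpM2r ?scale_ext_ge0// mulrA.
  (* Amounts to [(c ^+ 2 - d ^+ 2) * (l ^- 2 - a ^- 2) >= 0]. The factor in [d / l] is retained to
     absorb [l ^ (-3/2)]. *)
  have e1 : expR (- (2^-1 * (c / l) ^+ 2)) <=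
      E * expR (2^-1 * (d / a) ^+ 2) * expR (- (2^-1 * (d / l) ^+ 2)).
    rewrite /E -!expRD ler_expR !exprMn.
    have h1 : a^-1 ^+ 2 <= l^-1 ^+ 2.
      rewrite ler_sqr ?nnegrE ?invr_ge0 ?(ltW a0) ?(ltW l0)//.
      by rewrite lef_pV2// ltW.
    have h2 : d ^+ 2 <= c ^+ 2 by rewrite ler_sqr ?nnegrE ?(ltW c0) ?(ltW d0).
    have := mulr_ge0 (_ : 0 <= c ^+ 2 - d ^+ 2) (_ : 0 <= l^-1 ^+ 2 - a^-1 ^+ 2).
    rewrite !subr_ge0 => /(_ h2 h1); lra.
  apply: le_trans (ler_wpM2l _ e1) _.
    by rewrite mulr_ge0 ?invr_ge0 ?sqrtr_ge0// ltW.
  rewrite (sqrt_divE d0 l0).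
  have lE : l^-1 = d^-1 * (d / l) by rewrite mulKf ?gt_eqF.
  rewrite {2}lE; have := usqrt_exp (_ : 0 <= d / l); rewrite divr_ge0 ?(ltW d0) ?(ltW l0)//.
  move=> /(_ isT); move: (d / l) => u hu.
  rewrite (_ : (Num.sqrt d)^-1 * _ * _ * _ = (E * expR (2^-1 * (d / a) ^+ 2) / (d * Num.sqrt d)) *
    (u * Num.sqrt u * expR (- (2^-1 * u ^+ 2)))); last by rewrite invfM; ring.
  rewrite (_ : K * E = (E * expR (2^-1 * (d / a) ^+ 2) / (d * Num.sqrt d)) * 2); last first.
    by rewrite /K; ring.
  by rewrite ler_wpM2l// divr_ge0 ?mulr_ge0 ?expR_ge0// ltW.
apply: (@le_trans _ _ (((Num.sqrt a)^-1)%:E * scale_mass c + (K * E)%:E)%E).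
  rewrite -[X in (_ + X)%E]mule1 -integral_scale_ext.
  have KE0 : 0 <= K * E by exact: mulr_ge0.
  by apply: ge0_integral_le_lincomb => //; [exact: mw|exact: mmoment].
rewrite EFinD ge0_muleDl//; apply: leeD => //.
apply: (@le_trans _ _ ((K * z / v)%:E * (v / z * E)%:E)%E); last first.
  by apply: lee_pmul => //; [rewrite lee_fin mulr_ge0// divr_ge0 ?ltW|exact: hD].
rewrite -EFinM lee_fin le_eqVlt; apply/orP; left; apply/eqP.
by field; rewrite !gt_eqF.
Qed.

(** The limit of [scale_weight c l] as [c] tends to 0. *)
Let odds (l : R) : \bar R := (l^-1 * scale_ext l)%:E.

Let odds0 l : (0 <= odds l)%E.
Proof.
rewrite lee_fin /scale_ext; case: ifPn => l0; last by rewrite mulr0.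
by rewrite mulr_ge0 ?scale_fun_ge0// invr_ge0 ltW.
Qed.

Let modds : measurable_fun setT odds.
Proof.
apply/measurable_EFinP; apply: measurable_funM; first exact: measurable_invr.
exact: measurable_scale_ext.
Qed.

Let cvg_odds : (\int[mu]_(l in `[(n.+1%:R^-1)%R, +oo[) odds l @[n --> \oo] -->
  \int[mu]_(l in `]0%R, +oo[) odds l)%E.
Proof.
pose F (n : nat) : set R := `[n.+1%:R^-1, +oo[%classic.
have -> : `]0%R, +oo[%classic = \bigcup_n F n.
  apply/seteqP; split => [x|x [n _]]; rewrite /F /= !in_itv/= ?andbT.
    move=> x0; exists (Num.truncn x^-1) => //=.
    rewrite in_itv/= andbT -[leRHS]invrK lef_pV2 ?posrE ?invr_gt0//.
    by apply/ltW; exact: truncnS_gt.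
  by apply: lt_le_trans.
apply: ge0_nondecreasing_set_cvg_integral => //.
- move=> n m nm; apply/subsetPset => x; rewrite /F /= !in_itv/= !andbT.
  by apply: le_trans; rewrite lef_pV2 ?posrE// ler_nat ltnS.
- by move=> n; exact: measurable_funTS.
Qed.

(** For [l >= r] the quotient [c / l] is at most 1, so the exponential factor is at least
    [expR (- 2^-1)]. *)
Let odds_tail_le c r : 0 < c -> c <= r ->
  ((expR (- 2^-1))%:E * \int[mu]_(l in `[r, +oo[) odds l <= scale_mass c)%E.
Proof.
move=> c0 cr.
apply: (@le_trans _ _ (\int[mu]_(l in `[r, +oo[) (scale_weight c l)%:E)%E); last first.
  by apply: ge0_subset_integral => //; exact: mw.
rewrite -ge0_integralZl_EFin ?expR_ge0//; last exact: measurable_funTS.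
apply: ge0_le_integral => //.
- by move=> l _; rewrite mule_ge0// lee_fin expR_ge0.
- by apply: measurable_funeM; exact: measurable_funTS.
- by apply: measurable_funTS; exact: mw.
move=> l /=; rewrite in_itv/= andbT => rl.
have l0 : 0 < l by apply: lt_le_trans rl; exact: lt_le_trans cr.
rewrite /odds -EFinM lee_fin /scale_weight mulrA ler_wpM2r ?scale_ext_ge0// mulrC.
rewrite ler_pM2l ?invr_gt0// ler_expR lerN2 -[leRHS]mulr1 ler_pM2l// expr_le1//.
  by rewrite ler_pdivrMr// mul1r (le_trans cr).
by rewrite divr_ge0 ?ltW.
Qed.

(* If [\int l^-1 pi(l) dl] diverges, the normalizing constant [scale_mass c] blows up
   at [0]; otherwise the mass of [l^-1 pi(l)] near [0] is small. *)
Lemma scale_moment_small eta : 0 < eta -> exists2 d : R, 0 < d &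
  forall c, 0 < c -> c <= d -> (scale_moment c <= (eta / Num.sqrt c)%:E * scale_mass c)%E.
Proof.
(* With this [k], the part [l >= c / k] of the moment costs exactly half of [eta]; the other half is
   left for the part below. *)
move=> eta0; pose k := (eta / 2) ^+ 2.
have k0 : 0 < k by rewrite exprn_gt0// divr_gt0.
have sk : Num.sqrt k = eta / 2 by rewrite sqrtr_sqr gtr0_norm// divr_gt0.
suff [d d0 hd] : exists2 d : R, 0 < d & forall c, 0 < c -> c <= d ->
    (scale_moment c <= (Num.sqrt k / Num.sqrt c)%:E * scale_mass c +
      ((Num.sqrt c)^-1)%:E * ((eta / 2)%:E * scale_mass c))%E.
  exists d => // c c0 cd; apply: le_trans (hd c c0 cd) _.
  have sc : 0 < Num.sqrt c by rewrite sqrtr_gt0.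
  have m0 : (0 <= scale_mass c)%E by exact/ltW/scale_mass_gt0.
  rewrite muleA -ge0_muleDl//; last first.
    by rewrite -EFinM lee_fin mulr_ge0 ?invr_ge0 ?sqrtr_ge0// divr_ge0 ?ltW.
  rewrite -EFinM -EFinD sk; apply: lee_pmul => //.
  - by rewrite lee_fin addr_ge0// mulr_ge0 ?invr_ge0 ?sqrtr_ge0 ?divr_ge0 ?ltW.
  by rewrite lee_fin; move: ((Num.sqrt c)^-1) => q; lra.
have [a [z [v [a0 z0 v0 hD]]]] := scale_mass_ge.
have [M M0 hM] := scale_ext_bound.
have head c : 0 < c -> (\int[mu]_(l in `]0%R, (c / k)%R[) odds l <= (eta / 2)%:E * scale_mass c)%E ->
    (scale_moment c <= (Num.sqrt k / Num.sqrt c)%:E * scale_mass c +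
      ((Num.sqrt c)^-1)%:E * ((eta / 2)%:E * scale_mass c))%E.
  move=> c0 h.
  have sc : 0 < Num.sqrt c by rewrite sqrtr_gt0.
  have A0 : 0 <= Num.sqrt k / Num.sqrt c by rewrite divr_ge0 ?sqrtr_ge0.
  pose g (l : R) := (l^-1 * scale_ext l * \1_(`]0%R, c / k[%classic : set R) l)%:E.
  have g0 l : (0 <= g l)%E by rewrite /g EFinM mule_ge0 ?lee_fin// -lee_fin; exact: odds0.
  have mg : measurable_fun setT g.
    rewrite /g; under eq_fun do rewrite EFinM.
    by apply: emeasurable_funM => //; exact: modds.
  apply: (@le_trans _ _ ((Num.sqrt k / Num.sqrt c)%:E * scale_mass c +
      ((Num.sqrt c)^-1)%:E * \int[mu]_l g l)%E).
    have sV : 0 <= (Num.sqrt c)^-1 by rewrite invr_ge0 ltW.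
    apply: ge0_integral_le_lincomb => //; [exact: mw|exact: mmoment|].
    by move=> l; exact: inv_sqrt_scale_weight_le1.
  rewrite leeD2l//; apply: lee_pmul => //; first by apply: integral_ge0.
  apply: le_trans h; rewrite [leRHS]integral_mkcond le_eqVlt; apply/orP; left; apply/eqP.
  apply: eq_integral => l _; rewrite patchE /g indicE /odds.
  by case: ifPn => _; rewrite ?mulr1 ?mulr0.
have [I|I] := eqVneq (\int[mu]_(l in `]0%R, +oo[) odds l)%E +oo%E.
  (* The part below [c / k] costs [2 * M / (c * sqrt c)] times the length [c / k], that is
     [2 * M / k / sqrt c]. This [A] is the value of the truncated integral that forces
     [(eta / 2) * scale_mass c] above [2 * M / k]. *)
  pose A := 2 * M / k / (eta / 2) * expR 2^-1.
  have A0 : 0 < A by rewrite mulr_gt0 ?expR_gt0// !divr_gt0// mulr_gt0.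
  have [n hn] : exists n, (A%:E <= \int[mu]_(l in `[(n.+1%:R^-1)%R, +oo[) odds l)%E.
    apply: contrapT => /forallNP no.
    have : (\int[mu]_(l in `]0%R, +oo[) odds l <= A%:E)%E.
      rewrite -(cvg_lim _ cvg_odds)//; apply: lime_le.
        by apply/cvg_ex; eexists; exact: cvg_odds.
      by apply: nearW => n; have /negP := no n; rewrite -ltNge => /ltW.
    by rewrite I leNgt ltry.
  exists n.+1%:R^-1; first by [].
  move=> c c0 cn.
  have sc : 0 < Num.sqrt c by rewrite sqrtr_gt0.
  have A1 : 0 <= Num.sqrt k / Num.sqrt c by rewrite divr_ge0 ?sqrtr_ge0.
  have B1 : 0 <= 2 * M / (c * Num.sqrt c) by rewrite divr_ge0 ?mulr_ge0 ?ltW.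
  apply: (@le_trans _ _ ((Num.sqrt k / Num.sqrt c)%:E * scale_mass c +
      (2 * M / (c * Num.sqrt c))%:E * \int[mu]_l (\1_(`]0%R, c / k[%classic : set R) l)%:E)%E).
    apply: ge0_integral_le_lincomb => //; [exact: mw|exact: mind|exact: mmoment|].
    by move=> l; exact: inv_sqrt_scale_weight_le2.
  rewrite leeD2l// integral_indic// setIT.
  rewrite [X in (_ * X <= _)%E](lebesgue_measure_itv `]0%R, c / k[)/= lte_fin divr_gt0// sube0.
  have h := le_trans (lee_wpmul2l _ hn) (odds_tail_le c0 cn).
  have {h} : ((expR (- 2^-1))%:E * A%:E <= scale_mass c)%E by apply: h; rewrite lee_fin expR_ge0.
  rewrite -EFinM (_ : expR (- 2^-1) * A = 2 * M / k / (eta / 2)); last first.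
    by rewrite /A mulrCA expRN mulVf ?mulr1// gt_eqF// expR_gt0.
  move=> h; rewrite -EFinM.
  apply: (@le_trans _ _ (((Num.sqrt c)^-1)%:E * ((eta / 2)%:E * (2 * M / k / (eta / 2))%:E))%E).
    rewrite -!EFinM lee_fin le_eqVlt; apply/orP; left; apply/eqP.
    by field; rewrite !gt_eqF.
  have e20 : 0 < eta / 2 by rewrite divr_gt0.
  have X0 : 0 < 2 * M / k / (eta / 2) by rewrite !divr_gt0// mulr_gt0.
  apply: lee_pmul => //; first by rewrite lee_fin (ltW (mulr_gt0 e20 X0)).
  by apply: lee_pmul => //; rewrite lee_fin ltW.
(* A lower bound for [scale_mass c] valid for all [c <= 1]. If the integral of [odds] near 0 is at
   most [e], it is then at most [(eta / 2) * scale_mass c]; the choice of [d] below ensures both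
   [c <= 1] and that [c / k] lies in the range where this holds. *)
pose Dm := v / z * expR (- (2^-1 * (1 / a) ^+ 2)).
have Dm0 : 0 < Dm by rewrite mulr_gt0 ?expR_gt0// divr_gt0.
pose e := eta / 2 * Dm.
have e0 : 0 < e by rewrite mulr_gt0// divr_gt0.
have Ifin : (\int[mu]_(l in `]0%R, +oo[) odds l)%E \is a fin_num.
  by rewrite ge0_fin_numE ?integral_ge0// lt_neqAle I leey.
have [n hn] : exists n, (\int[mu]_(l in `]0%R, (n.+1%:R^-1)%R[) odds l <= e%:E)%E.
  apply: contrapT => /forallNP no.
  have split n : (\int[mu]_(l in `]0%R, +oo[) odds l =
     \int[mu]_(l in `]0%R, (n.+1%:R^-1)%R[) odds l + \int[mu]_(l in `[(n.+1%:R^-1)%R, +oo[) odds l)%E.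
    have -> : `]0%R, +oo[%classic = `]0%R, n.+1%:R^-1[%classic `|` `[n.+1%:R^-1, +oo[%classic :> set R.
      by rewrite -itv_bndbnd_setU// bnd_simp.
    rewrite ge0_integral_setU//; first exact: measurable_funTS.
    rewrite disj_set2E; apply/eqP/seteqP; split => // x [] /=.
    by rewrite !in_itv/= andbT => /andP[_ xn] /(lt_le_trans xn); rewrite ltxx.
  (* If every neighbourhood of 0 carried more than [e], the truncated integrals would all stay [e]
     below the finite total to which they converge. *)
  have : (\int[mu]_(l in `]0%R, +oo[) odds l <= \int[mu]_(l in `]0%R, +oo[) odds l - e%:E)%E.
    rewrite -[leLHS](cvg_lim _ cvg_odds)//; apply: lime_le.
      by apply/cvg_ex; eexists; exact: cvg_odds.
    apply: nearW => n; have /negP := no n; rewrite -ltNge => /ltW h.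
    by rewrite leeBrDr// (split n) [leLHS]addeC; exact: leeD.
  by rewrite leNgt lteBlDr// lteDl// lte_fin e0.
pose d := Num.min 1 (k / n.+1%:R).
exists d; first by rewrite lt_min ltr01/= divr_gt0.
move=> c c0; rewrite le_min => /andP[c1 cn]; apply: head => //.
apply: (@le_trans _ _ e%:E).
  apply: le_trans hn; apply: ge0_subset_integral => //; first exact: measurable_funTS.
  move=> l /=; rewrite !in_itv/= => /andP[-> lc]/=; apply: (lt_le_trans lc).
  by rewrite ler_pdivrMr// mulrC.
rewrite /e EFinM; apply: lee_pmul => //; rewrite ?lee_fin ?(ltW Dm0) ?divr_ge0 ?(ltW eta0)//.
apply: le_trans (hD c c0); rewrite lee_fin /Dm ler_pM2l ?divr_gt0// ler_expR lerN2.
rewrite ler_pM2l// ler_sqr ?nnegrE ?divr_ge0 ?(ltW c0) ?(ltW a0)//.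
by rewrite ler_pM2r ?invr_gt0.
Qed.

Lemma scale_moment_le eta : 0 < eta -> exists2 C : R, 0 <= C &
  forall c, 0 < c -> (scale_moment c <= (eta / Num.sqrt c + C)%:E * scale_mass c)%E.
Proof.
move=> eta0; have [d d0 hd] := scale_moment_small eta0.
have [C C0 hC] := scale_moment_large d0.
exists C => // c c0.
have sc : 0 <= eta / Num.sqrt c by rewrite divr_ge0 ?sqrtr_ge0 ?ltW.
have m0 : (0 <= scale_mass c)%E by exact/ltW/scale_mass_gt0.
have [cd|dc] := leP c d.
  apply: le_trans (hd c c0 cd) _; apply: lee_pmul => //; rewrite lee_fin ?lerDl//.
apply: le_trans (hC c (ltW dc)) _; apply: lee_pmul => //; rewrite lee_fin ?lerDr//.
Qed.

End scale_posterior.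

(** * Moments of the draw of lambda *)

Section lambda_kernel_bounds.
Context {R : realType} (p : nat) (piloc : scale_density R).
Hypothesis piloc_bounded : (scale_sup piloc < +oo)%E.
Local Notation Rm := (measurableTypeR R).
Local Notation Rp := (p.-tuple (measurableTypeR R)).
Local Notation state := (gibbs_state R p).

(** The normalizing constant is a product over the coordinates and its factors with [j != i] cancel.
    All [b_j] must be nonzero, not just [b_i], for the joint mass to be finite and the default of
    [knormalize] to be avoided. *)
Lemma integral_lambda_kernel_coord (x : state * Rm) i :
  0 < x.2 :> R -> (forall j, tnth x.1.1.1 j != 0 :> R) ->
  exists2 m : R, 0 < m &
    scale_mass piloc (`|tnth x.1.1.1 i| / x.2) = m%:E /\
    (\int[lambda_kernel p piloc x]_l inv_sqrt (tnth l i) =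
      (m^-1)%:E * scale_moment piloc (`|tnth x.1.1.1 i| / x.2))%E.
Proof.
set b := x.1.1.1; set t : R := x.2 => t0 b0.
pose c j := `|tnth b j| / t.
have c0 j : 0 < c j by rewrite divr_gt0// normr_gt0.
pose m j := fine (scale_mass piloc (c j)).
have mE j : scale_mass piloc (c j) = (m j)%:E.
  rewrite fineK// ge0_fin_numE; first exact: scale_mass_lty.
  exact/ltW/scale_mass_gt0.
have m0 j : 0 < m j by rewrite -lte_fin -mE scale_mass_gt0.
exists (m i) => //; split; first exact: mE.
have mw j : measurable_fun setT (fun l : R => (scale_weight piloc (c j) l)%:E).
  by apply/measurable_EFinP; exact: measurable_scale_weight.
have w0 j (l : R) : (0 <= (scale_weight piloc (c j) l)%:E)%E.
  by rewrite lee_fin scale_weight_ge0.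
have wE (l : Rp) : (\prod_(j < p) lambda_weight piloc (tnth b j) t (tnth l j))%:E =
    (\prod_(j < p) (scale_weight piloc (c j) (tnth l j))%:E)%E.
  by rewrite prodEFin; congr (_%:E); apply: eq_bigr => j _; rewrite lambda_weightE.
have ZE : (\int[tuple_lebesgue R p]_l
    (\prod_(j < p) lambda_weight piloc (tnth b j) t (tnth l j))%:E = (\prod_(j < p) m j)%:E)%E.
  under eq_integral do rewrite wE.
  rewrite (@integral_tuple_prod _ _ (fun j l => (scale_weight piloc (c j) l)%:E))//.
  by rewrite -prodEFin; apply: eq_bigr => j _; exact: mE.
rewrite /lambda_kernel integral_knormalize_density//; last 3 first.
- by move=> l; exact: inv_sqrt_ge0.
- by apply: measurable_coord; exact: measurable_inv_sqrt.
- by rewrite /= -/b -/t ZE ltry lte_fin andbT; exact: prodr_gt0.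
rewrite /= -/b -/t ZE/=.
pose f j (l : R) := ((if j == i then inv_sqrt l else 1) * (scale_weight piloc (c j) l)%:E)%E.
have f0 j l : (0 <= f j l)%E.
  by rewrite /f mule_ge0//; case: ifP => // _; exact: inv_sqrt_ge0.
have mf j : measurable_fun setT (f j).
  apply: emeasurable_funM => //; case: eqP => _; last exact: measurable_cst.
  exact: measurable_inv_sqrt.
transitivity (((\prod_(j < p) m j)^-1)%:E *
    \int[tuple_lebesgue R p]_l \prod_(j < p) f j (tnth l j))%E.
  congr (_ * _)%E; apply: eq_integral => l _; rewrite wE.
  rewrite (bigD1 i)//= [in RHS](bigD1 i)//= {1}/f eqxx muleA; congr (_ * _)%E.
  by apply: eq_bigr => j /negbTE ji; rewrite /f ji mul1e.
rewrite (@integral_tuple_prod _ _ f)//.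
rewrite [(\prod_(j < p) \int[lebesgue_measure]_l f j l)%E](bigD1 i)//=.
have -> : (\int[lebesgue_measure]_l f i l = scale_moment piloc (c i))%E.
  by apply: eq_integral => l _; rewrite /f eqxx.
have -> : (\prod_(j < p | j != i) \int[lebesgue_measure]_l f j l =
    (\prod_(j < p | j != i) m j)%:E)%E.
  rewrite -prodEFin; apply: eq_bigr => j /negbTE ji; rewrite -mE.
  by apply: eq_integral => l _; rewrite /f ji mul1e.
rewrite (bigD1 i)//= muleC -muleA -EFinM muleC; congr (_%:E * _)%E.
have P0 : \prod_(j < p | j != i) m j != 0 by rewrite gt_eqF// prodr_gt0.
by field; rewrite P0 gt_eqF.
Qed.

Lemma lambda_kernel_sum_inv_sqrt (tmax eta : R) : 0 < tmax -> 0 < eta ->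
  exists2 C : R, 0 <= C & forall x : state * Rm, 0 < (x.2 : R) <= tmax ->
    (\int[lambda_kernel p piloc x]_l sum_inv_sqrt l <=
     eta%:E * sum_inv_sqrt x.1.1.1 + C%:E)%E.
Proof.
move=> tmax0 eta0; have st : 0 < Num.sqrt tmax by rewrite sqrtr_gt0.
(* The bound is in [c = |b_i| / t], and [c ^ (-1/2)] is at most [sqrt tmax * |b_i| ^ (-1/2)];
   dividing [eta] by [sqrt tmax] compensates. *)
have [C C0 hC] := scale_moment_le piloc_bounded (divr_gt0 eta0 st).
exists (p%:R * C); first by rewrite mulr_ge0.
move=> x /andP[t0 tmx].
(* If some [b_j] vanishes, the right side is [+oo], and nothing has to be known of the draw, which
   may be the default one. *)
have [b0|/existsNP[j /negP]] := pselect (forall j, tnth x.1.1.1 j != 0 :> R); last first.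
  rewrite negbK => /eqP bj.
  have -> : sum_inv_sqrt x.1.1.1 = +oo%E.
    rewrite /sum_inv_sqrt (bigD1 j)//= {1}/inv_sqrt bj eqxx addye//.
    by rewrite gt_eqF// (lt_le_trans (ltNyr 0))// sume_ge0// => i _; exact: inv_sqrt_ge0.
  by rewrite gt0_muley ?lte_fin// addye// leey.
rewrite ge0_integral_sum//; last 2 first.
- by move=> j; apply: measurable_coord; exact: measurable_inv_sqrt.
- by move=> j b _; exact: inv_sqrt_ge0.
apply: (@le_trans _ _ (\sum_(j < p) (eta%:E * inv_sqrt (tnth x.1.1.1 j) + C%:E))%E).
  apply: lee_sum => i _.
  have [m m0 [mE ->]] := integral_lambda_kernel_coord i t0 b0.
  set c := `|tnth x.1.1.1 i| / x.2 in mE *.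
  have bi : 0 < `|tnth x.1.1.1 i| by rewrite normr_gt0.
  have c0 : 0 < c by rewrite divr_gt0.
  apply: (@le_trans _ _ ((m^-1)%:E * ((eta / Num.sqrt tmax / Num.sqrt c + C)%:E * m%:E))%E).
    apply: lee_pmul => //; first by rewrite lee_fin invr_ge0 ltW.
      by apply: integral_ge0 => l _; rewrite mule_ge0 ?inv_sqrt_ge0// lee_fin scale_weight_ge0.
    by rewrite -mE; exact: hC.
  rewrite -!EFinM mulrCA mulVf ?gt_eqF// mulr1 EFinD leeD2r//.
  rewrite /inv_sqrt (negbTE (b0 i)) -EFinM lee_fin -!mulrA ler_pM2l//.
  rewrite -invfM lef_pV2 ?posrE ?mulr_gt0 ?sqrtr_gt0//.
  rewrite -sqrtrM ?(ltW tmax0)// ler_wsqrtr// /c mulrCA ler_peMr ?(ltW bi)//.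
  by rewrite ler_pdivlMr// mul1r.
rewrite big_split/= -ge0_sume_distrr; last by move=> j _; exact: inv_sqrt_ge0.
by rewrite leeD2l// sumr_const card_ord -[_ *+ p]EFin_natmul mulr_natl.
Qed.

End lambda_kernel_bounds.

(** * Update of tau *)

Section tau_kernel_bounds.
Context {R : realType} (p : nat) (piglo : probability (measurableTypeR R) R).
Variables tmin tmax : R.
Hypotheses (tmin_gt0 : 0 < tmin) (tmin_max : tmin <= tmax).
Hypothesis piglo_supp : piglo `[tmin, tmax]%classic = 1%E.
Local Notation Rm := (measurableTypeR R).
Local Notation Rp := (p.-tuple (measurableTypeR R)).
Local Notation state := (gibbs_state R p).
Local Notation supp := (`[tmin, tmax]%classic : set Rm).

Let tmax_gt0 : 0 < tmax. Proof. exact: lt_le_trans tmin_max. Qed.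

Lemma integral_piglo (h : Rm -> \bar R) : (forall t, 0 <= h t)%E -> measurable_fun setT h ->
  (\int[piglo]_t h t = \int[piglo]_(t in supp) h t)%E.
Proof.
move=> h0 mh; have mS : measurable supp by exact: measurable_itv.
rewrite -(setUv supp) ge0_integral_setU//; last 3 first.
- exact: measurableC.
- by rewrite setUv.
- by rewrite disj_set2E setICr.
rewrite [X in (_ + X)%E](_ : _ = 0%E) ?adde0//.
apply: null_set_integral => //; first exact: measurableC.
  exact: measurable_funTS.
by have := probability_setC piglo mS; rewrite piglo_supp subee.
Qed.

Lemma tau_weight_le (b l : p.-tuple R) t : tmin <= t -> tau_weight b l t <= tmin ^- p.
Proof.
move=> tt; have t0 : 0 < t by exact: lt_le_trans tt.
rewrite /tau_weight t0 -exprVn -[X in _ <= _ ^+ X]card_ord -prodr_const; apply: ler_prod => j _.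
rewrite mulr_ge0 ?expR_ge0 ?invr_ge0 ?(ltW t0)//= -[leRHS]mulr1.
apply: ler_pM; rewrite ?expR_ge0 ?invr_ge0 ?(ltW t0)//; first by rewrite lef_pV2.
by rewrite -expR0 ler_expR oppr_le0 divr_ge0 ?sqr_ge0// mulr_ge0 ?sqr_ge0// mulr_ge0 ?sqr_ge0.
Qed.

Lemma tau_weight_ge (b l : p.-tuple R) t q : tmin <= t <= tmax ->
  (forall j, tnth b j ^+ 2 / tnth l j ^+ 2 <= q) ->
  (tmax^-1 * expR (- (q / (2 * tmin ^+ 2)))) ^+ p <= tau_weight b l t.
Proof.
move=> /andP[tt1 tt2] bl; have t0 : 0 < t by exact: lt_le_trans tt1.
rewrite /tau_weight t0 -[X in _ ^+ X]card_ord -prodr_const; apply: ler_prod => j _.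
rewrite mulr_ge0 ?expR_ge0 ?invr_ge0 ?(ltW tmax_gt0)//=.
apply: ler_pM; rewrite ?expR_ge0 ?invr_ge0 ?(ltW tmax_gt0)//; first by rewrite lef_pV2.
rewrite ler_expR lerN2 invfM mulrA mulrAC.
have bl0 : 0 <= tnth b j ^+ 2 / tnth l j ^+ 2 by rewrite divr_ge0// sqr_ge0.
apply: ler_pM => //; first by rewrite invr_ge0 mulr_ge0// sqr_ge0.
rewrite lef_pV2 ?posrE ?mulr_gt0 ?exprn_gt0// ler_pM2l// ler_sqr// nnegrE ltW//.
Qed.

Let mtau (s : state) : measurable_fun setT (fun t : Rm => (tau_weight s.1.1 s.1.2 t)%:E).
Proof.
apply/measurable_EFinP.
exact: (measurableT_comp (@measurable_tau_weight R p) (pair1_measurable s)).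
Qed.

Let tau0 (s : state) t : (0 <= (tau_weight s.1.1 s.1.2 t)%:E)%E.
Proof. by rewrite lee_fin tau_weight_ge0. Qed.

Local Notation Z s := (\int[piglo]_t (tau_weight s.1.1 s.1.2 t)%:E)%E.

Lemma tau_mass_le (s : state) : (Z s <= (tmin ^- p)%:E)%E.
Proof.
rewrite integral_piglo//.
apply: (@le_trans _ _ (\int[piglo]_(t in supp) (tmin ^- p)%:E)%E).
  apply: ge0_le_integral => //; first exact: measurable_funTS.
  by move=> t /=; rewrite in_itv/= lee_fin => /andP[t1 _]; exact: tau_weight_le.
by rewrite integral_cst// [X in (_ * X)%E]piglo_supp mule1.
Qed.

(** For a fixed state the sum [q] bounds all quotients [b_j ^+ 2 / l_j ^+ 2], so the weight is
    bounded below on the support. A zero scale is harmless, its quotient being 0 by convention: the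
    draw of tau is never the default one. *)
Lemma tau_mass_gt0 (s : state) : (0 < Z s)%E.
Proof.
pose q := \sum_(j < p) tnth s.1.1 j ^+ 2 / tnth s.1.2 j ^+ 2 : R.
have sq j : 0 <= (tnth s.1.1 j : R) ^+ 2 / (tnth s.1.2 j : R) ^+ 2 by rewrite divr_ge0// sqr_ge0.
have hq j : (tnth s.1.1 j : R) ^+ 2 / (tnth s.1.2 j : R) ^+ 2 <= q.
  by rewrite /q (bigD1 j)//= lerDl sumr_ge0.
pose w := (tmax^-1 * expR (- (q / (2 * tmin ^+ 2)))) ^+ p.
have w0 : 0 < w by rewrite exprn_gt0// mulr_gt0 ?expR_gt0// invr_gt0.
apply: (@lt_le_trans _ _ (\int[piglo]_(t in supp) w%:E)%E).
  by rewrite integral_cst// [X in (_ * X)%E]piglo_supp mule1 lte_fin.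
rewrite integral_piglo//; apply: ge0_le_integral => //.
- by move=> t _; rewrite lee_fin ltW.
- exact: measurable_funTS.
by move=> t /=; rewrite in_itv/= lee_fin => tt; exact: tau_weight_ge.
Qed.

Lemma integral_tau_kernel (s : state) (h : Rm -> \bar R) :
  (forall t, 0 <= h t)%E -> measurable_fun setT h ->
  (\int[tau_kernel p piglo s]_t h t =
   ((fine (Z s))^-1)%:E * \int[piglo]_(t in supp) (h t * (tau_weight s.1.1 s.1.2 t)%:E))%E.
Proof.
move=> h0 mh; rewrite /tau_kernel integral_knormalize_density//=; last first.
  by rewrite tau_mass_gt0/= (le_lt_trans (tau_mass_le s))// ltry.
rewrite -integral_piglo//; last exact: emeasurable_funM.
by move=> t; rewrite mule_ge0.
Qed.

(** Drift and minorization only have to be checked for [t] in the support of the prior. *)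
Lemma le_integral_tau_kernel (s : state) (f g : Rm -> \bar R) :
  (forall t, 0 <= f t)%E -> (forall t, 0 <= g t)%E ->
  measurable_fun setT f -> measurable_fun setT g ->
  (forall t, tmin <= t <= tmax -> (f t <= g t)%E) ->
  (\int[tau_kernel p piglo s]_t f t <= \int[tau_kernel p piglo s]_t g t)%E.
Proof.
move=> f0 g0 mf mg fg; rewrite !integral_tau_kernel//; apply: lee_pmul => //.
- by rewrite lee_fin invr_ge0 fine_ge0// ltW// tau_mass_gt0.
- by apply: integral_ge0 => t _; rewrite mule_ge0.
apply: ge0_le_integral => //.
- by move=> t _; rewrite mule_ge0.
- by apply: measurable_funTS; exact: emeasurable_funM.
- by apply: measurable_funTS; exact: emeasurable_funM.
by move=> t /=; rewrite in_itv/= => tt; apply: lee_pmul => //; exact: fg.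
Qed.

(** The density with respect to the prior is at least the lower bound [w] of the weight over the
    upper bound [tmin ^- p] of its mass, for all states with quotients at most [q]. *)
Lemma tau_kernel_ge q : exists2 e : R, 0 < e &
  forall (s : state) (h : Rm -> \bar R),
    (forall j, (tnth s.1.1 j : R) ^+ 2 / (tnth s.1.2 j : R) ^+ 2 <= q) ->
    (forall t, 0 <= h t)%E -> measurable_fun setT h ->
    (e%:E * \int[piglo]_t h t <= \int[tau_kernel p piglo s]_t h t)%E.
Proof.
pose w := (tmax^-1 * expR (- (q / (2 * tmin ^+ 2)))) ^+ p.
have w0 : 0 < w by rewrite exprn_gt0// mulr_gt0 ?expR_gt0// invr_gt0.
exists (tmin ^+ p * w); first by rewrite mulr_gt0// exprn_gt0.
move=> s h sq h0 mh; rewrite integral_tau_kernel// EFinM -muleA.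
have ZE : Z s = (fine (Z s))%:E.
  rewrite fineK// ge0_fin_numE ?(ltW (tau_mass_gt0 s))//.
  by rewrite (le_lt_trans (tau_mass_le s))// ltry.
have fZ0 : 0 < fine (Z s) by rewrite -lte_fin -ZE tau_mass_gt0.
apply: lee_pmul.
- by rewrite lee_fin exprn_ge0// ltW.
- by rewrite mule_ge0 ?lee_fin ?(ltW w0)//; apply: integral_ge0.
- rewrite lee_fin -[leLHS]invrK lef_pV2 ?posrE ?invr_gt0 ?exprn_gt0//.
  by rewrite -lee_fin -ZE tau_mass_le.
rewrite integral_piglo// -ge0_integralZl_EFin ?(ltW w0)//; last exact: measurable_funTS.
apply: ge0_le_integral => //.
- by move=> t _; rewrite mule_ge0// lee_fin ltW.
- by apply: measurable_funeM; exact: measurable_funTS.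
- by apply: measurable_funTS; exact: emeasurable_funM.
move=> t /=; rewrite in_itv/= muleC => tt; apply: lee_pmul => //.
  by rewrite lee_fin ltW.
by rewrite lee_fin; exact: tau_weight_ge.
Qed.

End tau_kernel_bounds.

(** * The Gibbs sampler *)

Section gibbs_operators.
Context {R : realType} (n p : nat).
Variables (X : 'M[R]_(n, p)) (y : 'I_n -> bool) (zeta : R).
Variables (piloc : scale_density R) (piglo : probability (measurableTypeR R) R).
Local Notation Rm := (measurableTypeR R).
Local Notation Rp := (p.-tuple (measurableTypeR R)).
Local Notation state := (gibbs_state R p).
Local Open Scope ereal_scope.

(** The mean of [f] at the new state once tau and lambda are drawn; [lambda_integral] is its mean
    once tau alone is drawn. Peeling off the draws this way lets each update be bounded
    separately. *)
Definition beta_integral (f : state -> \bar R) (z : state * Rm * Rp) : \bar R :=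
  \int[beta_kernel X y zeta z]_b f (b, z.2, z.1.2).

Definition lambda_integral (f : state -> \bar R) (z : state * Rm) : \bar R :=
  \int[lambda_kernel p piloc z]_l beta_integral f (z, l).

Variable f : state -> \bar R.
Hypotheses (f0 : forall s, 0 <= f s) (mf : measurable_fun setT f).

Lemma beta_integral_ge0 z : 0 <= beta_integral f z.
Proof. by apply: integral_ge0 => b _. Qed.

Lemma lambda_integral_ge0 z : 0 <= lambda_integral f z.
Proof. by apply: integral_ge0 => l _; exact: beta_integral_ge0. Qed.

Lemma measurable_beta_integral : measurable_fun setT (beta_integral f).
Proof.
apply: (measurable_fun_integral_sfinite_kernel
  (fun zb : state * Rm * Rp * Rp => f (zb.2, zb.1.2, zb.1.1.2))) => //.
exact: (measurableT_comp mf (@measurable_new_state R p)).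
Qed.

Lemma measurable_lambda_integral : measurable_fun setT (lambda_integral f).
Proof.
apply: (measurable_fun_integral_sfinite_kernel (beta_integral f)) => //.
- exact: beta_integral_ge0.
- exact: measurable_beta_integral.
Qed.

Lemma integral_gibbs_kernel s :
  \int[gibbs_kernel X y zeta piloc piglo s]_z f z =
  \int[tau_kernel p piglo s]_t lambda_integral f (s, t).
Proof.
rewrite [LHS](@integral_kcomp _ _ _ _ _ _ _ (tau_kernel p piglo)
  (lambda_kernel p piloc \; (beta_kernel X y zeta \; kdirac (@measurable_new_state R p))))//.
apply: eq_integral => t _.
rewrite [LHS](@integral_kcomp _ _ _ _ _ _ _ (lambda_kernel p piloc)
  (beta_kernel X y zeta \; kdirac (@measurable_new_state R p)))//.
apply: eq_integral => l _.
rewrite [LHS](@integral_kcomp _ _ _ _ _ _ _ (beta_kernel X y zeta)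
  (kdirac (@measurable_new_state R p)))//.
apply: eq_integral => b _.
by rewrite /kdirac integral_dirac// diracT mul1e.
Qed.

End gibbs_operators.

Section lambda_integral_theory.
Context {R : realType} (n p : nat).
Variables (X : 'M[R]_(n, p)) (y : 'I_n -> bool) (zeta : R) (piloc : scale_density R).
Local Notation Rm := (measurableTypeR R).
Local Notation Rp := (p.-tuple (measurableTypeR R)).
Local Notation state := (gibbs_state R p).
Local Open Scope ereal_scope.

Lemma measurable_pair_beta (l : Rp) (t : Rm) : measurable_fun setT (fun b : Rp => (b, l, t) : state).
Proof. by apply/measurable_fun_pair => //=; apply/measurable_fun_pair. Qed.

Lemma beta_integralD (f g : state -> \bar R) z :
  (forall s, 0 <= f s) -> measurable_fun setT f ->
  (forall s, 0 <= g s) -> measurable_fun setT g ->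
  beta_integral X y zeta (fun s => f s + g s) z =
  beta_integral X y zeta f z + beta_integral X y zeta g z.
Proof.
move=> f0 mf g0 mg; rewrite /beta_integral ge0_integralD//.
- exact: (measurableT_comp mf (measurable_pair_beta _ _)).
- exact: (measurableT_comp mg (measurable_pair_beta _ _)).
Qed.

Lemma lambda_integralD (f g : state -> \bar R) z :
  (forall s, 0 <= f s) -> measurable_fun setT f ->
  (forall s, 0 <= g s) -> measurable_fun setT g ->
  lambda_integral X y zeta piloc (fun s => f s + g s) z =
  lambda_integral X y zeta piloc f z + lambda_integral X y zeta piloc g z.
Proof.
move=> f0 mf g0 mg; rewrite /lambda_integral.
under eq_integral do rewrite beta_integralD//.
have mb h : (forall s, 0 <= h s) -> measurable_fun setT h ->
    measurable_fun setT (fun l => beta_integral X y zeta h (z, l)).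
  by move=> h0 mh; exact: (measurableT_comp (measurable_beta_integral X y zeta h0 mh) (pair1_measurable z)).
rewrite ge0_integralD//; try exact: mb.
- by move=> l _; exact: beta_integral_ge0.
- by move=> l _; exact: beta_integral_ge0.
Qed.

Lemma lambda_integral_ge (f : state -> \bar R) (a : R) z : (0 <= a)%R ->
  measurable_fun setT f -> (forall s, a%:E <= f s) -> a%:E <= lambda_integral X y zeta piloc f z.
Proof.
move=> a0 mf af; have f0 s : 0 <= f s by apply: le_trans (af s); rewrite lee_fin.
have cstk d d' (T : measurableType d) (T' : measurableType d') (k : R.-pker T ~> T') x :
    a%:E = \int[k x]__ a%:E.
  by rewrite integral_cst// prob_kernel mule1.
rewrite [leLHS](cstk _ _ _ _ (lambda_kernel p piloc) z); apply: ge0_le_integral => //.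
- exact: (measurableT_comp (measurable_beta_integral X y zeta f0 mf) (pair1_measurable z)).
move=> l _; rewrite [leLHS](cstk _ _ _ _ (beta_kernel X y zeta) (z, l)).
apply: ge0_le_integral => //.
- exact: (measurableT_comp mf (measurable_pair_beta _ _)).
Qed.

End lambda_integral_theory.

(** Markov's inequality, integrated from the pointwise bound of 1 by the indicator of [h <= r] plus
    [h / r]. The level [2 * E + 1] makes [E / r] at most one half and stays positive when
    [E = 0]. *)
Lemma prob_kernel_sublevel_ge d d' (T : measurableType d) (T' : measurableType d') (R : realType)
    (k : R.-pker T ~> T') x (h : T' -> \bar R) (E : R) : 0 <= E ->
  (forall z, 0 <= h z)%E -> measurable_fun setT h -> (\int[k x]_z h z <= E%:E)%E ->
  ((2^-1)%:E <= \int[k x]_z (if h z <= (2 * E + 1)%:E then 1 else 0))%E.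
Proof.
move=> E0 h0 mh hE; set r := 2 * E + 1.
have r0 : 0 < r by rewrite /r; lra.
have mi : measurable_fun setT (fun z => if (h z <= r%:E)%E then 1%E else 0%E : \bar R).
  by apply: measurable_fun_ifT => //; exact: measurable_fun_lee.
have i0 z : (0 <= if h z <= r%:E then 1 else 0 : \bar R)%E by case: ifP.
have k1 : k x setT = 1%E by exact: prob_kernel.
have : (1 <= 1%:E * \int[k x]_z (if h z <= r%:E then 1 else 0) + (r^-1)%:E * \int[k x]_z h z)%E.
  rewrite -[leLHS]mule1 -[X in (_ * X)%E]k1 -integral_cst//.
  apply: ge0_integral_le_lincomb => //; first by rewrite invr_ge0 ltW.
  move=> z; case: ifPn => hz; rewrite ?mule0 ?mule1 ?add0e.
    by rewrite leeDl// mule_ge0// lee_fin invr_ge0 ltW.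
  move: hz; rewrite -ltNge => /ltW hz.
  apply: (@le_trans _ _ ((r^-1)%:E * r%:E)%E); first by rewrite -EFinM mulVf// gt_eqF.
  by apply: lee_pmul => //; rewrite lee_fin ?invr_ge0 ltW.
rewrite mul1e => h1.
have h2 : ((r^-1)%:E * \int[k x]_z h z <= (2^-1)%:E)%E.
  apply: (@le_trans _ _ ((r^-1)%:E * E%:E)%E).
    apply: lee_pmul => //; first by rewrite lee_fin invr_ge0 ltW.
    exact: integral_ge0.
  rewrite -EFinM lee_fin mulrC ler_pdivrMr// /r; lra.
have := le_trans h1 (leeD (lexx _) h2).
rewrite -leeBlDr// -EFinB (_ : 1 - 2^-1 = 2^-1 :> R)//; lra.
Qed.

(** * Drift and two-step minorization of the sampler *)

Section gibbs_ergodicity.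
Context {R : realType} (n p : nat).
Variables (X : 'M[R]_(n, p)) (y : 'I_n -> bool) (zeta : R).
Hypothesis zeta_gt0 : 0 < zeta.
Variable piloc : scale_density R.
Hypothesis piloc_bounded : (scale_sup piloc < +oo)%E.
Variable piglo : probability (measurableTypeR R) R.
Variables tmin tmax : R.
Hypotheses (tmin_gt0 : 0 < tmin) (tmin_max : tmin <= tmax).
Hypothesis piglo_supp : piglo `[tmin, tmax]%classic = 1%E.
Local Notation Rm := (measurableTypeR R).
Local Notation Rp := (p.-tuple (measurableTypeR R)).
Local Notation state := (gibbs_state R p).
Local Notation K := (gibbs_kernel X y zeta piloc piglo).
Local Notation lamint := (lambda_integral X y zeta piloc).
Local Notation betint := (beta_integral X y zeta).

Let tmax_gt0 : 0 < tmax. Proof. exact: lt_le_trans tmin_max. Qed.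

Definition gibbs_lyapunov (s : state) : \bar R := sum_inv_sqrt s.1.1.

Lemma gibbs_lyapunov_ge0 s : (0 <= gibbs_lyapunov s)%E.
Proof. exact: sum_inv_sqrt_ge0. Qed.

Lemma measurable_gibbs_lyapunov : measurable_fun setT gibbs_lyapunov.
Proof.
apply: (measurableT_comp (@measurable_sum_inv_sqrt R p)).
by apply: measurableT_comp => //; exact: measurable_fst.
Qed.

Lemma gibbs_drift : exists2 B : R, 0 <= B & forall s,
  (\int[K s]_z gibbs_lyapunov z <= (2^-1)%:E * gibbs_lyapunov s + B%:E)%E.
Proof.
have [C0 [C1 [C00 C10 hb]]] := beta_kernel_sum_inv_sqrt X y zeta_gt0 tmin_gt0.
(* The draw of beta multiplies the lambda moment by [C1]; this [eta] brings the overall drift factor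
   down to one half. *)
have eta0 : 0 < (2 * C1)^-1 by rewrite invr_gt0 mulr_gt0.
have [C C_ge0 hl] := lambda_kernel_sum_inv_sqrt p piloc_bounded tmax_gt0 eta0.
exists (C0 + C1 * C); first by rewrite addr_ge0// mulr_ge0// ltW.
move=> s; have V0 := gibbs_lyapunov_ge0; have mV := measurable_gibbs_lyapunov.
rewrite integral_gibbs_kernel//.
set c := ((2^-1)%:E * gibbs_lyapunov s + (C0 + C1 * C)%:E)%E.
have c0 : (0 <= c)%E.
  apply: adde_ge0; first by rewrite mule_ge0// V0.
  by rewrite lee_fin addr_ge0// mulr_ge0// ltW.
have -> : c = (\int[tau_kernel p piglo s]__ c)%E by rewrite integral_cst// prob_kernel mule1.
apply: (le_integral_tau_kernel tmin_gt0 tmin_max piglo_supp) => //.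
- by move=> t; exact: lambda_integral_ge0.
- exact: (measurableT_comp (measurable_lambda_integral X y zeta piloc V0 mV) (pair1_measurable s)).
move=> t /andP[t1 t2]; have t0 : 0 < t by exact: lt_le_trans t1.
rewrite /lambda_integral.
apply: (@le_trans _ _ (C0%:E * \int[lambda_kernel p piloc (s, t)]__ 1 +
    C1%:E * \int[lambda_kernel p piloc (s, t)]_l sum_inv_sqrt l)%E).
  apply: ge0_integral_le_lincomb => //; first exact: ltW.
  - by move=> l; exact: sum_inv_sqrt_ge0.
  - by move=> l; exact: beta_integral_ge0.
  - exact: measurable_sum_inv_sqrt.
  - exact: (measurableT_comp (measurable_beta_integral X y zeta V0 mV) (pair1_measurable _)).
  by move=> l; rewrite mule1; exact: hb.
rewrite integral_cst// prob_kernel !mule1.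
apply: (@le_trans _ _ (C0%:E + C1%:E * (((2 * C1)^-1)%:E * gibbs_lyapunov s + C%:E))%E).
  rewrite leeD2l//; apply: lee_pmul => //; first by rewrite lee_fin ltW.
    by apply: integral_ge0 => l _; exact: sum_inv_sqrt_ge0.
  by apply: hl; rewrite t0.
rewrite ge0_muleDr ?lee_fin//; last by rewrite mule_ge0 ?V0// lee_fin ltW.
rewrite muleA -!EFinM (_ : C1 * (2 * C1)^-1 = 2^-1); last by field; rewrite gt_eqF.
by rewrite addeCA -EFinD /c addrC.
Qed.

Let box (b : Rp) : \bar R :=
  (\prod_(j < p) (\1_(`[- zeta, zeta]%classic : set R) (tnth b j))%:E)%E.

Let box_ge0 b : (0 <= box b)%E.
Proof. by apply: prode_ge0 => j _; rewrite lee_fin. Qed.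

Let measurable_box : measurable_fun setT box.
Proof.
apply: emeasurable_prod => j.
apply: (@measurable_coord _ _ (fun x => (\1_(`[- zeta, zeta]%classic : set R) x)%:E)).
by apply/measurable_EFinP; exact: measurable_indic.
Qed.

Let integral_box : (\int[tuple_lebesgue R p]_b box b = ((2 * zeta) ^+ p)%:E)%E.
Proof.
rewrite (@integral_tuple_prod _ _ (fun j x => (\1_(`[- zeta, zeta]%classic : set R) x)%:E))//; last first.
  by move=> j; apply/measurable_EFinP; exact: measurable_indic.
rewrite -[X in _ ^+ X]card_ord -prodr_const -prodEFin; apply: eq_bigr => j _.
rewrite integral_indic// setIT [LHS](lebesgue_measure_itv `[- zeta, zeta])/= lte_fin gtrN//.
by rewrite -EFinB; congr (_%:E); lra.
Qed.

(* The draw of lambda given tau reads the previous state only through its beta part, so the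
   other components are dummies. *)
Let regen_state (z : Rp * Rm) : state * Rm := ((z.1, nseq_tuple p (0 : Rm), 0 : Rm), z.2).

Let measurable_regen_state : measurable_fun setT regen_state.
Proof.
apply/measurable_fun_pair => //=; apply/measurable_fun_pair => //=.
by apply/measurable_fun_pair.
Qed.

(* The minorizing functional: beta uniform on a box, tau drawn from its prior, and then
   a regular update of lambda and beta. *)
Let regen (f : state -> \bar R) : \bar R :=
  (\int[tuple_lebesgue R p]_b ((\int[piglo]_t lamint f (regen_state (b, t))) * box b))%E.

Let measurable_regen_inner f : (forall s, 0 <= f s)%E -> measurable_fun setT f ->
  measurable_fun setT (fun b : Rp => (\int[piglo]_t lamint f (regen_state (b, t)))%E).
Proof.
move=> f0 mf.
apply: (@measurable_fun_fubini_tonelli_F _ _ _ _ _ piglo (lamint f \o regen_state)).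
  exact: (measurableT_comp (measurable_lambda_integral X y zeta piloc f0 mf)).
by move=> z; exact: lambda_integral_ge0.
Qed.

Let measurable_regen_slice f b : (forall s, 0 <= f s)%E -> measurable_fun setT f ->
  measurable_fun setT (fun t : Rm => lamint f (regen_state (b, t))).
Proof.
move=> f0 mf.
apply: (measurableT_comp (measurable_lambda_integral X y zeta piloc f0 mf)).
exact: (measurableT_comp measurable_regen_state (pair1_measurable b)).
Qed.

Let regen_ge0 f : (forall s, 0 <= f s)%E -> (0 <= regen f)%E.
Proof.
move=> f0; apply: integral_ge0 => b _; rewrite mule_ge0//.
by apply: integral_ge0 => t _; exact: lambda_integral_ge0.
Qed.

(** [regen] is additive, and lambda, beta and tau are drawn from probabilities; so a lower bound [a]
    on [f + g] survives all the averages and is finally multiplied by the volume of the box. *)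
Let regen_overlap f g (a : R) : (forall s, 0 <= f s)%E -> measurable_fun setT f ->
  (forall s, 0 <= g s)%E -> measurable_fun setT g -> 0 <= a ->
  (forall s, a%:E <= f s + g s)%E ->
  ((a * (2 * zeta) ^+ p)%:E <= regen f + regen g)%E.
Proof.
move=> f0 mf g0 mg a0 afg.
have inner0 h b : (forall s, 0 <= h s)%E -> (0 <= \int[piglo]_t lamint h (regen_state (b, t)))%E.
  by move=> h0; apply: integral_ge0 => t _; exact: lambda_integral_ge0.
rewrite /regen -ge0_integralD//; last 4 first.
- by move=> b _; rewrite mule_ge0// inner0.
- by apply: emeasurable_funM => //; exact: measurable_regen_inner.
- by move=> b _; rewrite mule_ge0// inner0.
- by apply: emeasurable_funM => //; exact: measurable_regen_inner.
rewrite EFinM -integral_box -ge0_integralZl_EFin//.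
apply: ge0_le_integral => //.
- by move=> b _; rewrite mule_ge0.
- exact: measurable_funeM.
- by apply: emeasurable_funD; apply: emeasurable_funM => //; exact: measurable_regen_inner.
move=> b _; rewrite -ge0_muleDl ?inner0//; apply: lee_pmul => //.
rewrite -ge0_integralD//; last 4 first.
- by move=> t _; exact: lambda_integral_ge0.
- exact: measurable_regen_slice.
- by move=> t _; exact: lambda_integral_ge0.
- exact: measurable_regen_slice.
have -> : a%:E = (\int[piglo]__ a%:E)%E.
  by rewrite integral_cst// [X in (_ * X)%E]probability_setT mule1.
apply: ge0_le_integral => //.
- by apply: emeasurable_funD; exact: measurable_regen_slice.
move=> t _; rewrite -lambda_integralD//; apply: lambda_integral_ge => //.
exact: emeasurable_funD.
Qed.

Let two_step_ge_regen (r : R) : exists2 e : R, 0 < e &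
  forall (s : state) f, (gibbs_lyapunov s <= r%:E)%E -> (forall s, 0 <= f s)%E ->
    measurable_fun setT f -> (e%:E * regen f <= two_step K f s)%E.
Proof.
have [C C_ge0 hl] := lambda_kernel_sum_inv_sqrt p piloc_bounded tmax_gt0 (@ltr01 R).
(* Bounds the mean of [sum_inv_sqrt] of the new scales, by the drift of lambda with [eta = 1]; the
   absolute value makes it nonnegative for any real [r]. Then [r'] is the level below which these
   scales stay with probability at least one half. *)
pose E := `|r| + C.
have E0 : 0 <= E by rewrite addr_ge0.
pose r' := 2 * E + 1.
have r'0 : 0 < r' by rewrite /r'; lra.
have [e1 e1_gt0 hb] := beta_kernel_ge X y zeta_gt0 tmin_gt0 r'0.
(* Bounds [b_j ^+ 2 / l_j ^+ 2] for [b] in the box and scales at least [r' ^- 2] in absolute value,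
   which is the condition under which the draw of tau dominates its prior. *)
pose q := zeta ^+ 2 / (r' ^- 2) ^+ 2.
have [e2 e2_gt0 ht] := tau_kernel_ge p tmin_gt0 tmin_max piglo_supp q.
have e12 : 0 < e1 * e2 by rewrite mulr_gt0.
exists (2^-1 * (e1 * e2)); first by rewrite mulr_gt0.
move=> s f Vs f0 mf.
pose Kf z := (\int[K z]_w f w)%E.
have Kf0 z : (0 <= Kf z)%E by exact: integral_ge0.
have mKf : measurable_fun setT Kf by exact: measurable_kernel_integral.
have rf0 : (0 <= regen f)%E by exact: regen_ge0.
rewrite /two_step -/Kf integral_gibbs_kernel//.
set c := ((2^-1 * (e1 * e2))%:E * regen f)%E.
have c0 : (0 <= c)%E by rewrite mule_ge0// lee_fin ltW// mulr_gt0.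
have -> : c = (\int[tau_kernel p piglo s]__ c)%E by rewrite integral_cst// prob_kernel mule1.
apply: (le_integral_tau_kernel tmin_gt0 tmin_max piglo_supp) => //.
- by move=> t; exact: lambda_integral_ge0.
- exact: (measurableT_comp (measurable_lambda_integral X y zeta piloc Kf0 mKf) (pair1_measurable s)).
move=> t /andP[t1 t2]; have t0 : 0 < t by exact: lt_le_trans t1.
pose ind (l : Rp) : \bar R := (if sum_inv_sqrt l <= r'%:E then 1 else 0)%E.
have ind0 l : (0 <= ind l)%E by rewrite /ind; case: ifP.
have mind : measurable_fun setT ind.
  apply: measurable_fun_ifT => //; apply: measurable_fun_lee => //.
  exact: measurable_sum_inv_sqrt.
have half : ((2^-1)%:E <= \int[lambda_kernel p piloc (s, t)]_l ind l)%E.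
  apply: prob_kernel_sublevel_ge => //.
  - by move=> l; exact: sum_inv_sqrt_ge0.
  - exact: measurable_sum_inv_sqrt.
  apply: le_trans (hl (s, t) _) _; first by rewrite t0.
  rewrite mul1e /E EFinD leeD2r//; apply: (le_trans Vs).
  by rewrite lee_fin ler_norm.
apply: (@le_trans _ _ ((e1 * e2)%:E * regen f *
    \int[lambda_kernel p piloc (s, t)]_l ind l)%E).
  rewrite /c mulrC EFinM -muleA muleCA muleC; apply: lee_pmul => //.
  by rewrite mule_ge0// lee_fin ltW.
rewrite -ge0_integralZl//; last by rewrite mule_ge0// lee_fin ltW.
have e12r : (0 <= (e1 * e2)%:E * regen f)%E by rewrite mule_ge0// lee_fin ltW.
apply: ge0_le_integral.
- exact: measurableT.
- by move=> l _; exact: mule_ge0.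
- exact: measurable_funeM.
- exact: (measurableT_comp (measurable_beta_integral X y zeta Kf0 mKf) (pair1_measurable _)).
move=> l _; rewrite {1}/ind; case: ifPn => lr; last first.
  by rewrite mule0; exact: beta_integral_ge0.
rewrite mule1.
have mKfb : measurable_fun setT (fun b : Rp => Kf (b, l, t)).
  exact: (measurableT_comp mKf (measurable_pair_beta _ _)).
apply: le_trans (hb ((s, t), l) (fun b : Rp => Kf (b, l, t)) t1 lr (fun b => Kf0 _) mKfb).
rewrite EFinM -muleA; apply: lee_pmul.
- by rewrite lee_fin ltW.
- by apply: mule_ge0 rf0; rewrite lee_fin ltW.
- exact: lexx.
have inner0 b : (0 <= \int[piglo]_t lamint f (regen_state (b, t)))%E.
  by apply: integral_ge0 => u _; exact: lambda_integral_ge0.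
have e20 : (0 <= e2%:E)%E by rewrite lee_fin ltW.
have mreg : measurable_fun setT
    (fun b : Rp => ((\int[piglo]_u lamint f (regen_state (b, u))) * box b)%E).
  by apply: emeasurable_funM; [exact: measurable_regen_inner|exact: measurable_box].
have reg0 b : (0 <= (\int[piglo]_u lamint f (regen_state (b, u))) * box b)%E.
  by apply: mule_ge0; [exact: inner0|exact: box_ge0].
rewrite /regen -(ge0_integralZl_EFin _ measurableT (fun b _ => reg0 b) mreg (ltW e2_gt0)).
apply: ge0_le_integral.
- exact: measurableT.
- by move=> b _; apply: mule_ge0 (reg0 b).
- exact: measurable_funeM.
- by apply: emeasurable_funM; [exact: mKfb|exact: measurable_box].
move=> b _; rewrite -/(box b).
have [bz|/existsNP[j /negP bz]] := pselect (forall j, `|tnth b j : R| <= zeta); last first.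
  have -> : box b = 0%E.
    rewrite /box (bigD1 j)//= indicE memNset ?mul0e//.
    by rewrite /= in_itv/= -ler_norml; exact/negP.
  by rewrite !mule0.
rewrite muleA; apply: lee_pmul => //; first by rewrite mule_ge0 ?lee_fin ?(ltW e2_gt0).
rewrite /Kf integral_gibbs_kernel//.
(* The kernels of lambda and beta project only [b] and [u] out of the previous state and the new
   tau. The actual state [(b, l, t)] and the dummy one of [regen_state] therefore give convertible
   integrals. *)
apply: (ht (b, l, t) (fun u => lamint f ((b, l, t), u))).
- move=> j; rewrite /q; apply: ler_pM; rewrite ?sqr_ge0 ?invr_ge0 ?sqr_ge0//.
    by rewrite -[leLHS]real_normK ?num_real// ler_sqr ?nnegrE ?(ltW zeta_gt0)//; exact: bz.
  have lj : r' ^- 2 <= `|tnth l j : R|.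
    by apply: inv_sqrt_le_norm => //; apply: le_trans lr; exact: inv_sqrt_le_sum.
  have rr : 0 < r' ^- 2 by rewrite invr_gt0 exprn_gt0.
  have ll : 0 < `|tnth l j : R| by exact: lt_le_trans lj.
  rewrite -[(tnth l j : R) ^+ 2]real_normK ?num_real//.
  by rewrite lef_pV2 ?posrE ?exprn_gt0// ler_sqr ?nnegrE ?(ltW rr) ?(ltW ll).
- by move=> u; exact: lambda_integral_ge0.
- exact: (measurableT_comp (measurable_lambda_integral X y zeta piloc f0 mf) (pair1_measurable _)).
Qed.

Lemma gibbs_overlap (r : R) : exists2 e : R, 0 < e &
  forall (s s' : state) (f g : state -> \bar R) (a : R),
    (gibbs_lyapunov s <= r%:E)%E -> (gibbs_lyapunov s' <= r%:E)%E ->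
    (forall z, 0 <= f z)%E -> (forall z, 0 <= g z)%E ->
    measurable_fun setT f -> measurable_fun setT g ->
    0 <= a -> (forall z, a%:E <= f z + g z)%E ->
    ((e * a)%:E <= two_step K f s + two_step K g s')%E.
Proof.
have [e e0 he] := two_step_ge_regen r.
exists (e * (2 * zeta) ^+ p); first by rewrite mulr_gt0// exprn_gt0// mulr_gt0.
move=> s s' f g a Vs Vs' f0 g0 mf mg a0 afg.
apply: le_trans (leeD (he s f Vs f0 mf) (he s' g Vs' g0 mg)).
rewrite -ge0_muleDr ?regen_ge0// -mulrA [X in e * X]mulrC EFinM.
apply: lee_pmul => //.
- by rewrite lee_fin ltW.
- by rewrite lee_fin mulr_ge0// exprn_ge0// mulr_ge0// ltW.
exact: regen_overlap.
Qed.

End gibbs_ergodicity.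

Theorem theoremB2 (R : realType) (n p : nat)
    (X : 'M[R]_(n, p)) (y : 'I_n -> bool) (zeta : R) (zeta_gt0 : 0 < zeta)
    (piloc : scale_density R)
    (piloc_bounded : (scale_sup piloc < +oo)%E)
    (piloc_ac : abs_continuous_at_scale_min piloc)
    (piglo : probability (measurableTypeR R) R)
    (tau_min tau_max : R)
    (tau_min_gt0 : 0 < tau_min) (tau_min_max : tau_min <= tau_max)
    (piglo_supp : piglo `[tau_min, tau_max]%classic = 1%E) :
  geometrically_ergodic_on (@gibbs_start R p) (gibbs_kernel X y zeta piloc piglo).
Proof.
have [B B0 drift] := gibbs_drift X y zeta_gt0 piloc_bounded tau_min_gt0 tau_min_max piglo_supp.
(* A base point of finite Lyapunov function, from which the stationary law is constructed. *)
pose s0 : gibbs_state R p := (nseq_tuple p 1, nseq_tuple p 1, 1).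
have half : 0 <= (2^-1 : R) < 1 by apply/andP; split; lra.
apply: (harris (@measurable_gibbs_lyapunov R p) (@gibbs_lyapunov_ge0 R p) half B0 drift
  (gibbs_overlap X y zeta_gt0 piloc_bounded tau_min_gt0 tau_min_max piglo_supp) (x0 := s0)).
  apply: sum_inv_sqrt_lty => j; rewrite /= /tnth nth_nseq ltn_ord.
  exact: oner_neq0.
by move=> s [b0 _ _]; exact: sum_inv_sqrt_lty.
Qed.
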